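(* Let $A\in\mathbb{R}^{n\times n}$, $B\in\mathbb{R}^{n\times m}$ and $C\in\mathbb{R}^{q\times n}$ satisfy the following: $(A,B)$ is stabilizable, $(C,A)$ is detectable, and all eigenvalues of $A$ lie in the closed left half plane. Let $\bar\tau\ge0$ satisfy \[ \bar\tau\,\omega_{\max}<\frac{\pi}{2}, \] where $\omega_{\max}=0$ if $A$ is Hurwitz and $\omega_{\max}=\max\{\omega\in\mathbb{R}:\det(j\omega I-A)=0\}$ otherwise. Let $K$ be any matrix such that $A-KC$ is Hurwitz. Then there exist $\rho>1$ and $\varepsilon^*>0$, depending only on $A,B,C$ and $\bar\tau$, such that the following holds for every $\varepsilon\in(0,\varepsilon^*]$. Let $P_\varepsilon$ be the unique positive definite solution of \[ A^{T}P_\varepsilon+P_\varepsilon A-P_\varepsilon BB^{T}P_\varepsilon+\varepsilon I=0 . \] Consider any integer $N\ge1$, any nonempty node set $\mathcal{C}\subseteq\{1,\dots,N\}$, any weighted directed graph $\mathcal{G}\in\mathbb{G}_{\mathcal{C}}^N$ with adjacency weights $a_{ij}\ge0$ ($a_{ii}=0$), and any delays $\tau_1,\dots,\tau_N\in[0,\bar\tau]$. Let the multi-agent system be \[ \dot x_i(t)=Ax_i(t)+Bu_i(t-\tau_i),\quad y_i(t)=Cx_i(t),\quad x_i(\delta)=\phi_i(\delta),\ \delta\in[-\bar\tau,0],\qquad i=1,\dots,N, \] with arbitrary continuous initial functions $\phi_i$. Let the exosystem be $\dot x_r(t)=Ax_r(t)$, $y_r(t)=Cx_r(t)$, with arbitrary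 initial condition. Let each agent $i$ use the protocol \[ \begin{aligned} \dot{\hat x}_i(t)&=A\hat x_i(t)+B\Phi_i^\tau(t)+K(\bar\zeta_i(t)-C\hat x_i(t))+\iota_iBu_i(t-\tau_i),\\ \dot\chi_i(t)&=A\chi_i(t)+Bu_i(t-\tau_i)+\hat x_i(t)-\check\zeta_i(t)-\iota_i\chi_i(t),\\ u_i(t)&=-\rho B^{T}P_\varepsilon\chi_i(t), \end{aligned} \] with arbitrary initial conditions, where \[ \bar\zeta_i(t)=\sum_{j=1}^N a_{ij}(y_i(t)-y_j(t))+\iota_i(y_i(t)-y_r(t)), \] \[ \check\zeta_i(t)=\sum_{j=1}^N a_{ij}(\chi_i(t)-\chi_j(t)), \] \[ \Phi_i^\tau(t)=\sum_{j=1}^N a_{ij}\big(u_i(t-\tau_i)-u_j(t-\tau_j)\big), \] and $\iota_i=1$ if $i\in\mathcal{C}$, $\iota_i=0$ otherwise. Then $\lim_{t\to\infty}(x_i(t)-x_r(t))=0$ for all $i=1,\dots,N$; that is, the scalable regulated state synchronization problem with additional information exchange is solved.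
   Context: A weighted directed graph on nodes $\{1,\dots,N\}$ has adjacency matrix $[a_{ij}]$ with $a_{ij}>0$ iff there is an edge from $j$ to $i$, and $a_{ii}=0$. A directed tree is a subgraph in which every node has exactly one parent except one node, the root, which has none. For a node set $\mathcal{C}$, $\mathbb{G}_{\mathcal{C}}^N$ denotes the set of all such graphs with $N$ nodes containing $\mathcal{C}$ in which every node is a member of a directed tree whose root lies in $\mathcal{C}$. $j=\sqrt{-1}$. ''Hurwitz'' means all eigenvalues lie in the open left half plane. *)

(* Defs.v *)
From HB Require Import structures.
From mathcomp Require Import all_boot all_order all_algebra.
From mathcomp Require Import all_classical all_reals all_analysis.
From mathcomp Require Import complex.
Set Implicit Arguments. Unset Strict Implicit. Unset Printing Implicit Defensive.
Import Order.TTheory GRing.Theory Num.Theory numFieldNormedType.Exports.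
Local Open Scope ring_scope.

Section Defs.
Variable R : realType.

Definition cmx {m n : nat} (A : 'M[R]_(m, n)) : 'M[R[i]]_(m, n) :=
  map_mx (fun x => (x%:C)%C) A.

Definition eigenvalue_of {n : nat} (A : 'M[R]_n) (l : R[i]) : Prop :=
  \det (l%:M - cmx A) = 0.

Definition hurwitz {n : nat} (A : 'M[R]_n) : Prop :=
  forall l : R[i], eigenvalue_of A l -> complex.Re l < 0.

Definition eig_closed_lhp {n : nat} (A : 'M[R]_n) : Prop :=
  forall l : R[i], eigenvalue_of A l -> complex.Re l <= 0.

Definition stabilizable {n m : nat} (A : 'M[R]_n) (B : 'M[R]_(n, m)) : Prop :=
  exists F : 'M[R]_(m, n), hurwitz (A + B *m F).

Definition detectable {n q : nat} (C : 'M[R]_(q, n)) (A : 'M[R]_n) : Prop :=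
  exists L : 'M[R]_(n, q), hurwitz (A - L *m C).

Definition omega_max {n : nat} (A : 'M[R]_n) : R :=
  if `[< hurwitz A >] then 0
  else sup [set w : R | eigenvalue_of A (Complex 0 w)].

Definition posdef {n : nat} (P : 'M[R]_n) : Prop :=
  P^T = P /\ forall x : 'cV[R]_n, x != 0 -> 0 < (x^T *m P *m x) 0 0.

(* Directed tree in the graph with adjacency a (edge j -> i iff a i j > 0):
   node set T, root r in T, each non-root node v in T has the (unique) parent
   par v in T with an edge par v -> v, and following parents from v reaches r. *)
Definition directed_tree {N : nat} (a : 'M[R]_N) (T : {set 'I_N}) (r : 'I_N)
    (par : 'I_N -> 'I_N) : Prop :=
  r \in T /\
  forall v, v \in T -> v != r ->
    [/\ par v \in T, 0 < a v (par v) & exists k : nat, iter k par v = r].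

Definition in_graph_set {N : nat} (Cs : {set 'I_N}) (a : 'M[R]_N) : Prop :=
  (forall i j, 0 <= a i j) /\ (forall i, a i i = 0) /\
  forall i : 'I_N, exists (T : {set 'I_N}) (r : 'I_N) (par : 'I_N -> 'I_N),
    [/\ directed_tree a T r par, r \in Cs & i \in T].

End Defs.

Section Traj.
Variable R : realType.
Local Open Scope classical_set_scope.

Definition deriv_pos {n : nat} (f df : R -> 'cV[R]_n) : Prop :=
  forall t : R, 0 < t -> forall k : 'I_n,
    is_derive t (1 : R) (fun s => f s k 0) (df t k 0).

Definition cont_from {n : nat} (a : R) (f : R -> 'cV[R]_n) : Prop :=
  forall k : 'I_n, {within `[a, +oo[, continuous (fun s => f s k 0)}.

Definition tends_to_zero {n : nat} (f : R -> 'cV[R]_n) : Prop :=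
  forall k : 'I_n, (fun t => f t k 0) @ +oo --> (0 : R).
End Traj.

(* Main.v *)
Require Import Defs.
From HB Require Import structures.
From mathcomp Require Import all_boot all_order all_algebra.
From mathcomp Require Import all_classical all_reals all_analysis.
From mathcomp Require Import complex.
From mathcomp Require Import ring lra.
Set Implicit Arguments. Unset Strict Implicit. Unset Printing Implicit Defensive.
Import Order.TTheory GRing.Theory Num.Theory numFieldNormedType.Exports.
Local Open Scope ring_scope.

(** With [e_i = x_i - x_r], the observer error
    [w_i = \sum_j a_ij (e_i - e_j) + iota_i e_i - xhat_i] obeys [w_i' = (A - K C) w_i],
    and [d_i = e_i - chi_i] is driven by [w] through [A] and the grounded
    Laplacian, whose eigenvalues lie in the open right half plane; so [w] and [d]
    are square integrable. Each agent is then the single delayed loop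
    [e' = A e - rho B B^T P e(t - tau) + f] with [f] square integrable.

    Put [v = B^T P e] and choose [Om > omega_max A] with [Om taubar < pi / 2].
    Since the spectrum of [A] lies in the closed left half plane, spectral
    factorization of polynomials nonnegative on the imaginary axis gives a
    quadratic form whose derivative along the free motion dominates
    [|v'|^2 - Om^2 |v|^2] (a Bernstein inequality). On the other hand
    [\int_(t - tau)^t (|v'|^2 - Om^2 |v|^2)] is minimal for a solution of
    [m'' = - Om^2 m], which bounds the cross term [v(t) . v(t - tau)] as long as
    [Om tau < pi / 2]. Adding both corrections to [e^T P e] yields a Lyapunov
    functional when [rho cos (Om taubar) >= 2], because [P] tends to 0 with
    [eps]: a limit of [P / \tr P] would give a left eigenvector of [A] on the
    imaginary axis annihilating [B], against stabilizability. *)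

(** * Euclidean forms *)

(** Two uniformities shape the proof. [rho] and [eps_star] are fixed before [K] and the network, so
    these may enter the single loop only through the square integrable forcing [f], which a Lyapunov
    inequality absorbs additively. And the output [B^T P e] changes with [eps], so the Bernstein
    constants must not depend on the output matrix [c]: forms are measured by the sums [krylov A c],
    and the factorization concerns polynomials in [A] alone, [c] being inserted afterwards. For
    [c = B^T P] the same sums are small relative to [e^T P e] as [eps] decreases, so the corrections
    cannot destroy positivity. The constant 2 in [rho cos (Om taubar) >= 2] pays for the [|v|^2]
    left over by the Riccati equation and for the delayed input inside the Bernstein correction. No
    signal is Fourier transformed: improper integrals appear as bounded primitives, and all
    estimates are asserted for large times only. *)

Section Dot.
Variable R : realFieldType.

Definition dotv n (x y : 'cV[R]_n) : R := (x^T *m y) 0 0.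
Definition sqn n (x : 'cV[R]_n) : R := dotv x x.

Lemma dotvE n (x y : 'cV[R]_n) : dotv x y = \sum_i x i 0 * y i 0.
Proof. by rewrite /dotv mxE; apply: eq_bigr => i _; rewrite mxE. Qed.

Lemma sqnE n (x : 'cV[R]_n) : sqn x = \sum_i x i 0 ^+ 2.
Proof. by rewrite /sqn dotvE; apply: eq_bigr => i _; rewrite expr2. Qed.

Lemma dotvC n (x y : 'cV[R]_n) : dotv x y = dotv y x.
Proof. by rewrite !dotvE; apply: eq_bigr => i _; rewrite mulrC. Qed.

Lemma dotvDl n (x y z : 'cV[R]_n) : dotv (x + y) z = dotv x z + dotv y z.
Proof. by rewrite /dotv raddfD mulmxDl mxE. Qed.

Lemma dotvDr n (x y z : 'cV[R]_n) : dotv z (x + y) = dotv z x + dotv z y.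
Proof. by rewrite /dotv mulmxDr mxE. Qed.

Lemma dotvZl n a (x z : 'cV[R]_n) : dotv (a *: x) z = a * dotv x z.
Proof. by rewrite /dotv linearZ -scalemxAl mxE. Qed.

Lemma dotvZr n a (x z : 'cV[R]_n) : dotv z (a *: x) = a * dotv z x.
Proof. by rewrite dotvC dotvZl dotvC. Qed.

Lemma dotvNl n (x z : 'cV[R]_n) : dotv (- x) z = - dotv x z.
Proof. by rewrite -scaleN1r dotvZl mulN1r. Qed.

Lemma dotvNr n (x z : 'cV[R]_n) : dotv z (- x) = - dotv z x.
Proof. by rewrite dotvC dotvNl dotvC. Qed.

Lemma dotv0l n (z : 'cV[R]_n) : dotv 0 z = 0.
Proof. by rewrite -(scale0r 0) dotvZl mul0r. Qed.

Lemma dotv0r n (z : 'cV[R]_n) : dotv z 0 = 0.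
Proof. by rewrite dotvC dotv0l. Qed.

Lemma dotv_sumr n d (z : 'cV[R]_n) (F : 'I_d -> 'cV[R]_n) :
  dotv z (\sum_i F i) = \sum_i dotv z (F i).
Proof. by rewrite /dotv mulmx_sumr summxE. Qed.

Lemma dotvMl n p (M : 'M[R]_(p, n)) x y : dotv (M *m x) y = dotv x (M^T *m y).
Proof. by rewrite /dotv trmx_mul mulmxA. Qed.

Lemma dotvMr n p (M : 'M[R]_(p, n)) x y : dotv x (M *m y) = dotv (M^T *m x) y.
Proof. by rewrite dotvMl trmxK. Qed.

Lemma sqn_ge0 n (x : 'cV[R]_n) : 0 <= sqn x.
Proof. by rewrite sqnE sumr_ge0 // => i _; rewrite sqr_ge0. Qed.

Lemma sqn_eq0 n (x : 'cV[R]_n) : (sqn x == 0) = (x == 0).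
Proof.
apply/idP/eqP => [|->]; last by rewrite /sqn dotv0l.
rewrite sqnE psumr_eq0 => [/allP x0|i _]; last exact: sqr_ge0.
apply/matrixP => i j; rewrite ord1 mxE; apply/eqP.
by have := x0 i (mem_index_enum i); rewrite /= sqrf_eq0.
Qed.

Lemma sqnN n (x : 'cV[R]_n) : sqn (- x) = sqn x.
Proof. by rewrite /sqn dotvNl dotvNr opprK. Qed.

Lemma sqnZ n a (x : 'cV[R]_n) : sqn (a *: x) = a ^+ 2 * sqn x.
Proof. by rewrite /sqn dotvZl dotvZr mulrA expr2. Qed.

Lemma entry_sqr_le_sqn n (x : 'cV[R]_n) i : x i 0 ^+ 2 <= sqn x.
Proof.
rewrite sqnE (bigD1 i) //= lerDl sumr_ge0 // => j _; exact: sqr_ge0.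
Qed.

(** No sign of [c] is assumed, so that Cauchy-Schwarz becomes available for forms that are only
    semidefinite. *)
Lemma discr_le (a b c : R) :
  (forall t, 0 <= a + 2 * t * b + t ^+ 2 * c) -> b ^+ 2 <= a * c.
Proof.
move=> H; have [c0|c0] := eqVneq c 0.
  have [->|b0] := eqVneq b 0; first by rewrite c0 mulr0 expr0n.
  have := H (- (a + 1) / (2 * b)); rewrite c0 mulr0 addr0.
  have -> : 2 * (- (a + 1) / (2 * b)) * b = - (a + 1).
    by field.
  by move=> ?; exfalso; lra.
have c1 : 0 < c.
  rewrite lt_neqAle eq_sym c0 /= leNgt; apply/negP => cn.
  (* Adding the hypothesis at [t] and [- t] cancels [b]; this [t] satisfies [1 <= t] and
     [a + 1 <= t * (- c)], hence [a + t ^+ 2 * c < 0]. *)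
  pose t := (a + 1 + b ^+ 2) * (1 + (- c)^-1).
  have ci : 0 < (- c)^-1 by rewrite invr_gt0 oppr_gt0.
  have a0 : 0 <= a by have := H 0; rewrite mulr0 mul0r expr0n mul0r !addr0.
  have h1 := H t; have h2 := H (- t).
  have : 0 <= a + t ^+ 2 * c by move: h1 h2; rewrite sqrrN; lra.
  have b2 := sqr_ge0 b.
  have cn' : 0 < - c by rewrite oppr_gt0.
  have hc : (- c) * (- c)^-1 = 1 by rewrite mulfV // oppr_eq0.
  have t1 : 1 <= t by rewrite /t; nra.
  have tc : a + 1 <= t * (- c).
    have -> : t * - c = (a + 1 + b ^+ 2) * (1 - c) by rewrite /t; field.
    have := mulr_ge0 (addr_ge0 (addr_ge0 a0 ler01) b2) (ltW cn'); lra.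
  nra.
have := H (- b / c).
have -> : a + 2 * (- b / c) * b + (- b / c) ^+ 2 * c = (a * c - b ^+ 2) / c by field.
by rewrite pmulr_lge0 ?invr_gt0 // subr_ge0.
Qed.

Lemma psd_CS n (P : 'M[R]_n) (x y : 'cV[R]_n) : P^T = P ->
  (forall z, 0 <= dotv z (P *m z)) ->
  dotv x (P *m y) ^+ 2 <= dotv x (P *m x) * dotv y (P *m y).
Proof.
move=> Ps Pp; apply: discr_le => t.
have := Pp (x + t *: y).
have e : dotv y (P *m x) = dotv x (P *m y) by rewrite dotvMr Ps dotvC.
rewrite mulmxDr -scalemxAr !dotvDl !dotvDr !dotvZl !dotvZr e.
by congr (_ <= _); ring.
Qed.

Lemma dotv_CS n (x y : 'cV[R]_n) : dotv x y ^+ 2 <= sqn x * sqn y.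
Proof.
have := @psd_CS n 1%:M x y; rewrite !mul1mx; apply; first exact: trmx1.
by move=> z; rewrite mul1mx; apply: sqn_ge0.
Qed.

Lemma psd_ker n (P : 'M[R]_n) (y : 'cV[R]_n) : P^T = P ->
  (forall z, 0 <= dotv z (P *m z)) -> dotv y (P *m y) = 0 -> P *m y = 0.
Proof.
move=> Ps Pp y0; apply/eqP; rewrite -sqn_eq0 -sqrf_eq0.
apply/eqP/le_anti; rewrite sqr_ge0 andbT.
by have := psd_CS (P *m y) y Ps Pp; rewrite y0 mulr0.
Qed.

Definition frob m n (M : 'M[R]_(m, n)) : R := \sum_i \sum_j M i j ^+ 2.

Lemma frob_ge0 m n (M : 'M[R]_(m, n)) : 0 <= frob M.
Proof. by do 2!(rewrite sumr_ge0 // => ? _); rewrite sqr_ge0. Qed.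

Lemma sqn_mul_le m n (M : 'M[R]_(m, n)) x : sqn (M *m x) <= frob M * sqn x.
Proof.
rewrite sqnE /frob mulr_suml; apply: ler_sum => i _.
have -> : (M *m x) i 0 = dotv (row i M)^T x.
  by rewrite dotvE mxE; apply: eq_bigr => j _; rewrite !mxE.
apply: le_trans (dotv_CS _ _) _.
by rewrite sqnE; under eq_bigr do rewrite !mxE.
Qed.

Lemma trace_mul_tr m n (M : 'M[R]_(m, n)) : \tr (M^T *m M) = frob M.
Proof.
rewrite /frob exchange_big /mxtrace; apply: eq_bigr => i _.
by rewrite mxE; apply: eq_bigr => j _; rewrite mxE expr2.
Qed.

Lemma sqnD n (x y : 'cV[R]_n) : sqn (x + y) = sqn x + 2 * dotv x y + sqn y.
Proof. by rewrite /sqn dotvDl !dotvDr (dotvC y x); ring. Qed.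

Lemma dotv_le_young n (x y : 'cV[R]_n) (a : R) : 0 < a ->
  2 * dotv x y <= a * sqn x + a^-1 * sqn y.
Proof.
move=> a0; have := sqn_ge0 (a *: x - y).
rewrite sqnD sqnN sqnZ dotvNr dotvZl => H.
rewrite -(ler_pM2l a0).
have -> : a * (a * sqn x + a^-1 * sqn y) = a * (a * sqn x) + sqn y.
  by rewrite mulrDr mulVKf // gt_eqF.
lra.
Qed.

Lemma sqnD_young n (x y : 'cV[R]_n) (a : R) : 0 < a ->
  sqn (x + y) <= (1 + a) * sqn x + (1 + a^-1) * sqn y.
Proof.
move=> a0; have := dotv_le_young x y a0.
rewrite sqnD; lra.
Qed.

Lemma sqnD_le n (x y : 'cV[R]_n) : sqn (x + y) <= 2 * sqn x + 2 * sqn y.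
Proof. by have := @sqnD_young n x y 1 ltr01; rewrite invr1; lra. Qed.

Lemma sqn_sum_le n d (F : 'I_d -> 'cV[R]_n) :
  sqn (\sum_i F i) <= d%:R * \sum_i sqn (F i).
Proof.
have sq (f : 'I_d -> R) : (\sum_i f i) ^+ 2 <= d%:R * \sum_i f i ^+ 2.
  have := dotv_CS (\col_i f i) (const_mx 1).
  rewrite sqnE dotvE sqnE mulrC.
  under eq_bigr do rewrite !mxE mulr1.
  under [X in _ <= X * _]eq_bigr do rewrite !mxE expr1n.
  under [X in _ <= _ * X]eq_bigr do rewrite !mxE.
  by rewrite sumr_const card_ord.
rewrite sqnE.
under eq_bigr do rewrite summxE.
under [X in _ <= _ * X]eq_bigr do rewrite sqnE.
rewrite exchange_big mulr_sumr; apply: ler_sum => i _.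
exact: sq (fun j => F j i 0).
Qed.

End Dot.

(** * Signals with bounded improper integral *)

Section Calculus.
Variable R : realType.
Implicit Types (f g h F : R -> R) (a b c t T : R).
Local Open Scope classical_set_scope.

Notation D f t d := (is_derive (t : R) (1 : R) (f : R -> R) (d : R)).

Lemma der_eq f t a b : D f t a -> a = b -> D f t b.
Proof. by move=> ? <-. Qed.

Lemma derD f g t a b : D f t a -> D g t b -> D (fun s => f s + g s) t (a + b).
Proof. exact: is_deriveD. Qed.

Lemma derN f t a : D f t a -> D (fun s => - f s) t (- a).
Proof. exact: is_deriveN. Qed.

Lemma derB f g t a b : D f t a -> D g t b -> D (fun s => f s - g s) t (a - b).
Proof. exact: is_deriveB. Qed.

Lemma derM f g t a b : D f t a -> D g t b ->
  D (fun s => f s * g s) t (a * g t + f t * b).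
Proof.
move=> fa gb; apply: der_eq (is_deriveM fa gb) _.
by rewrite /GRing.scale /= addrC mulrC.
Qed.

Lemma derZ f t k a : D f t a -> D (fun s => k * f s) t (k * a).
Proof. exact: is_deriveZ. Qed.

Lemma der_cst t k : D (fun=> k) t 0.
Proof. exact: is_derive_cst. Qed.

Lemma der_sqr f t a : D f t a -> D (fun s => f s ^+ 2) t (2 * f t * a).
Proof.
move=> fa; have := derM fa fa; rewrite (_ : a * _ + _ = 2 * f t * a) //; ring.
Qed.

Lemma der_shift f t c a : D f (t - c) a -> D (fun s => f (s - c)) t a.
Proof.
move=> fa; have h : D (fun s => s - c) t 1.
  by have := derB (is_derive_id t 1) (der_cst t c); rewrite subr0.
by have := @is_derive1_comp R f (fun s => s - c) t a 1 fa h; rewrite mulr1.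
Qed.

Lemma der_sum n (f : 'I_n -> R -> R) t (d : 'I_n -> R) :
  (forall i, D (f i) t (d i)) -> D (fun s => \sum_i f i s) t (\sum_i d i).
Proof.
move=> fd; rewrite (_ : (fun s => \sum_i f i s) = \sum_i f i); last first.
  by apply/funext => s; rewrite fct_sumE.
exact: is_derive_sum.
Qed.

Lemma der_continuous f t a : D f t a -> {for t, continuous f}.
Proof.
by move=> [/derivable1_diffP fd _]; apply: differentiable_continuous.
Qed.

Lemma der_within f df a b : (forall t, a <= t <= b -> D f t (df t)) ->
  {within `[a, b], continuous f}.
Proof.
move=> fd; apply: derivable_within_continuous => t; rewrite in_itv => /fd.
by case.
Qed.

Lemma der_MVT f df a b : a <= b -> (forall t, a <= t <= b -> D f t (df t)) ->
  exists2 c, a <= c <= b & f b - f a = df c * (b - a).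
Proof.
move=> ab fd; have fd' t : t \in `]a, b[%R -> D f t (df t).
  by rewrite in_itv /= => /andP[/ltW at_ /ltW tb]; apply: fd; rewrite at_ tb.
have [c cab ->] := MVT_segment ab fd' (der_within fd).
by exists c.
Qed.

Lemma der_ge0_le f df a b : a <= b -> (forall t, a <= t <= b -> D f t (df t)) ->
  (forall t, a <= t <= b -> 0 <= df t) -> f a <= f b.
Proof.
move=> ab fd d0; have [c cab e] := der_MVT ab fd.
by rewrite -subr_ge0 e mulr_ge0 ?subr_ge0 ?d0.
Qed.

Lemma primitive_exists f a : (forall t, a <= t -> {for t, continuous f}) ->
  exists F, forall t, a < t -> D F t (f t).
Proof.
move=> fc.
exists (fun x => (\int[@lebesgue_measure R]_(s in [set` `[a, x]]) f s)%R).
move=> t at_; have tt : t < t + 1 by rewrite ltrDl.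
have fi : (@lebesgue_measure R).-integrable `[a, t + 1] (EFin \o f).
  apply: continuous_compact_integrable; first exact: segment_compact.
  apply: continuous_in_subspaceT => x; rewrite inE /= in_itv /= => /andP[ax _].
  exact: fc.
have [d e] := continuous_FTC1_closed tt fi at_ (fc _ (ltW at_)).
by rewrite -e derive1E; exact: derivableP d.
Qed.

(** An explicit strict threshold makes time shifts and the combination of finitely many conditions
    plain arithmetic. *)
Definition evt (P : R -> Prop) := exists T, forall t, T < t -> P t.

Lemma evt_and (P Q : R -> Prop) : evt P -> evt Q -> evt (fun t => P t /\ Q t).
Proof.
move=> [T1 p] [T2 q]; exists (Num.max T1 T2) => t.
by rewrite gt_max => /andP[/p ? /q ?].
Qed.

Lemma evt_mono (P Q : R -> Prop) : (forall t, P t -> Q t) -> evt P -> evt Q.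
Proof. by move=> PQ [T p]; exists T => t /p /PQ. Qed.

Lemma evt_all (P : R -> Prop) : (forall t, P t) -> evt P.
Proof. by exists 0. Qed.

Lemma evt_shift (P : R -> Prop) c : evt P -> evt (fun t => P (t - c)).
Proof. by move=> [T p]; exists (T + c) => t; rewrite -ltrBrDr => /p. Qed.

Lemma evt_fin n (P : 'I_n -> R -> Prop) : (forall i, evt (P i)) ->
  evt (fun t => forall i, P i t).
Proof.
move=> /choice[T p]; exists (\big[Num.max/0]_i T i) => t lt i; apply: p.
by apply: le_lt_trans lt; apply: le_bigmax.
Qed.

(* [intbl g]: the improper integral of [g] over a neighbourhood of infinity is
   bounded above; only used for [g >= 0]. *)
Definition intbl g :=
  exists F M, evt (fun t => D F t (g t) /\ F t <= M).

Definition evcont g := evt (fun t => {for t, continuous g}).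

Lemma evcont_primitive g : evcont g -> exists F, evt (fun t => D F t (g t)).
Proof.
move=> [T gc]; have gc1 t : T + 1 <= t -> {for t, continuous g}.
  by move=> le; apply: gc; apply: lt_le_trans le; rewrite ltrDl.
by have [F Fg] := primitive_exists gc1; exists F, (T + 1).
Qed.

(** The integrated dissipation inequality: [- L + H - G] is nondecreasing for primitives [G], [H],
    so a lower bound on [L] and an upper bound on [H] bound [G]. Every Lyapunov argument below ends
    here. *)
Lemma dissipation_intbl L dL g h M : evcont g -> intbl h ->
  evt (fun t => [/\ D L t (dL t), dL t <= - g t + h t & - M <= L t]) ->
  intbl g.
Proof.
move=> /evcont_primitive[G Gg] [H [MH hH]] Lh.
have [T E] := evt_and Gg (evt_and hH Lh).
pose T1 := T + 1; have TT1 : T < T1 by rewrite ltrDl.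
exists G, (G T1 + L T1 - H T1 + MH + M), T1 => t T1t.
have tT : T < t by apply: lt_trans T1t.
have [gt [[ht hM] [_ _ Lt]]] := E t tT.
split=> //.
pose f s := - L s + H s - G s.
have : f T1 <= f t.
  apply: (@der_ge0_le f (fun s => - dL s + h s - g s)) (ltW T1t) _ _.
    move=> s /andP[T1s _]; have [gs [[hs _] [Ls _ _]]] := E s (lt_le_trans TT1 T1s).
    exact: derB (derD (derN Ls) hs) gs.
  move=> s /andP[T1s _]; have [_ [_ [_ d _]]] := E s (lt_le_trans TT1 T1s).
  lra.
rewrite /f; lra.
Qed.

Lemma intbl_le g h : evcont g -> intbl h -> evt (fun t => 0 <= g t <= h t) ->
  intbl g.
Proof.
move=> gc hi gh; apply: (@dissipation_intbl (fun=> 0) (fun=> 0) g h 0) => //.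
apply: evt_mono gh => t /andP[_ gh]; split; first exact: der_cst.
  lra.
by rewrite oppr0.
Qed.

Lemma intblD g h : intbl g -> intbl h -> intbl (fun t => g t + h t).
Proof.
move=> [G [Mg gG]] [H [Mh hH]]; exists (fun t => G t + H t), (Mg + Mh).
have := evt_and gG hH; apply: evt_mono => t [[? ?] [? ?]]; split.
  exact: derD.
by rewrite lerD.
Qed.

Lemma intblZ g k : 0 <= k -> intbl g -> intbl (fun t => k * g t).
Proof.
move=> k0 [G [Mg gG]]; exists (fun t => k * G t), (k * Mg).
apply: evt_mono gG => t [? ?]; split; [exact: derZ|exact: ler_wpM2l].
Qed.

Lemma intbl_shift g c : intbl g -> intbl (fun t => g (t - c)).
Proof.
move=> [G [M gG]]; exists (fun t => G (t - c)), M.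
by have := evt_shift c gG; apply: evt_mono => t [? ?]; split=> //; exact: der_shift.
Qed.

Lemma intbl0 : intbl (fun=> 0).
Proof. by exists (fun=> 0), 0, 0 => t _; split=> //; exact: der_cst. Qed.

Lemma intbl_ext g h : g =1 h -> intbl g -> intbl h.
Proof. by move=> /funext ->. Qed.

Lemma intbl_sum n (g : 'I_n -> R -> R) : (forall i, intbl (g i)) ->
  intbl (fun t => \sum_i g i t).
Proof.
elim: n g => [|n IH] g gi.
  by apply: intbl_ext intbl0 => t; rewrite big_ord0.
apply: (@intbl_ext (fun t => g ord0 t + \sum_i g (lift ord0 i) t)).
  by move=> t; rewrite big_ord_recl.
by apply: intblD => //; apply: IH => i.
Qed.

(** The primitive is monotone and bounded, so beyond a point where it is within [e] of its supremum
    its increments are at most [e]. *)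
Lemma intbl_cauchy g : intbl g -> evt (fun t => 0 <= g t) ->
  exists G, evt (fun t => D G t (g t)) /\
  forall e, 0 < e -> evt (fun t => forall s, t <= s -> 0 <= G s - G t <= e).
Proof.
move=> [G [M gG]] g0; exists G; split; first by apply: evt_mono gG => t [].
move=> e e0; have [T E] := evt_and gG g0.
have mono s t : T < s -> s <= t -> G s <= G t.
  move=> Ts st; apply: (@der_ge0_le G g) => // u /andP[su _];
    by have [[]] := E u (lt_le_trans Ts su).
pose S := [set G t | t in [set t | T < t]].
have supS : has_sup S.
  split; first by exists (G (T + 1)); exists (T + 1) => //=; rewrite ltrDl.
  by exists M => _ [t /= Tt <-]; have [[]] := E t Tt.
have [_ [T1 /= TT1 <-] lt] := sup_adherent e0 supS.
exists T1 => t T1t s ts; have Tt := lt_trans TT1 T1t.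
rewrite subr_ge0 mono //=.
have : G s <= sup S by apply: sup_upper_bound => //; exists s => //=; exact: lt_le_trans ts.
have := mono T1 t TT1 (ltW T1t).
lra.
Qed.

(** A one-sided Barbalat lemma. On [[t - 1, t]] the mean value theorem finds an [s] with [g s] equal
    to a small integral, and from [s] to [t] the function can rise by at most the small integral of
    [h]. *)
Lemma barbalat g dg h : evt (fun t => 0 <= g t) -> intbl g ->
  evt (fun t => D g t (dg t) /\ dg t <= h t) ->
  evt (fun t => 0 <= h t) -> intbl h ->
  g @ +oo --> (0 : R).
Proof.
move=> g0 gi gd h0 hi.
have [G [Gg GC]] := intbl_cauchy gi g0.
have [H [Hh HC]] := intbl_cauchy hi h0.
apply/cvgrPdist_le => e e0.
have e2 : 0 < e / 2 by rewrite divr_gt0.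
have [T E] := evt_and g0 (evt_and gd (evt_and Gg (evt_and Hh (evt_and (GC _ e2) (HC _ e2))))).
exists (T + 1); split; first exact: num_real.
move=> t Tt; rewrite sub0r normrN.
have Tt' : T < t - 1 by rewrite ltrBrDr.
have le1 : t - 1 <= t by rewrite gerBl.
have Es s : t - 1 <= s -> _ := fun le => E s (lt_le_trans Tt' le).
have [g0t _] := Es t le1.
rewrite ger0_norm //.
have [s /andP[s1 s2] es] : exists2 s, t - 1 <= s <= t & G t - G (t - 1) = g s * (t - (t - 1)).
  by apply: der_MVT => // s /andP[ts _]; have [_ [_ []]] := Es s ts.
have [_ [_ [_ [_ [GC1 HC1]]]]] := Es (t - 1) (lexx _).
have := GC1 t le1; have := HC1 t le1.
have Hmono : H (t - 1) <= H s by have /andP[] := HC1 s s1; rewrite subr_ge0.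
have gH : H s - g s <= H t - g t.
  apply: (@der_ge0_le (fun s => H s - g s) (fun s => h s - dg s)) => // u /andP[su _].
    have [_ [[? _] [_ [? _]]]] := Es u (le_trans s1 su); exact: derB.
  have [_ [[_ ?] _]] := Es u (le_trans s1 su); lra.
move=> /andP[_ H1] /andP[_ H2].
have : g s = G t - G (t - 1) by rewrite es; lra.
lra.
Qed.

End Calculus.

(** * Energy of an oscillation *)

Section Oscillation.
Variable R : realType.
Local Open Scope classical_set_scope.

Notation D f t d := (is_derive (t : R) (1 : R) (f : R -> R) (d : R)).

Lemma evcontD (f g : R -> R) : evcont f -> evcont g -> evcont (fun t => f t + g t).
Proof.
move=> fc gc; have := evt_and fc gc; apply: evt_mono => t [? ?].
exact: continuousD.
Qed.

Lemma evcontM (f g : R -> R) : evcont f -> evcont g -> evcont (fun t => f t * g t).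
Proof.
move=> fc gc; have := evt_and fc gc; apply: evt_mono => t [? ?].
exact: continuousM.
Qed.

Lemma evcont_cst (k : R) : evcont (fun=> k).
Proof. by exists 0 => t _; exact: cst_continuous. Qed.

Lemma evcontX (f : R -> R) k : evcont f -> evcont (fun t => f t ^+ k).
Proof.
move=> fc; elim: k => [|k IH].
  by rewrite (_ : (fun t => _) = fun=> 1) //; exact: evcont_cst.
rewrite (_ : (fun t => _) = fun t => f t * f t ^+ k); first exact: evcontM.
by apply/funext => t; rewrite exprS.
Qed.

Lemma evcont_sum n (f : 'I_n -> R -> R) : (forall i, evcont (f i)) ->
  evcont (fun t => \sum_i f i t).
Proof.
elim: n f => [|n IH] f fc.
  rewrite (_ : (fun t => _) = fun=> 0); first exact: evcont_cst.
  by apply/funext => t; rewrite big_ord0.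
rewrite (_ : (fun t => _) = fun t => f ord0 t + \sum_i f (lift ord0 i) t).
  by apply: evcontD => //; apply: IH.
by apply/funext => t; rewrite big_ord_recl.
Qed.

Lemma evcont_shift (f : R -> R) c : evcont f -> evcont (fun t => f (t - c)).
Proof.
move=> /(evt_shift c); apply: evt_mono => t fc.
apply: (@continuous_comp _ _ _ (fun s => s - c) f) => //.
by apply: continuousB; [exact: cvg_id|exact: cst_continuous].
Qed.

Lemma der_affine (k c t : R) : D (fun s => k * (s - c)) t k.
Proof.
have := derZ k (derB (is_derive_id t 1) (der_cst t c)).
by rewrite subr0 mulr1.
Qed.

(* The right-hand side below is the least energy [\int (u'^2 - Om^2 u^2)] of a
   function with the same end values; the minimizer [m] solves [m'' = - Om^2 m],
   and the excess is the integral of [(w' + Om tan(.) w)^2] for [w = u - m]. *)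
Lemma oscillation_energy (u du Phi : R -> R) (Om tau s : R) :
  0 < Om -> 0 <= tau -> Om * tau < pi / 2 ->
  (forall t : R, s - tau <= t <= s ->
     D u t (du t) /\ D Phi t (du t ^+ 2 - Om ^+ 2 * u t ^+ 2)) ->
  Om * (cos (Om * tau) * (u s ^+ 2 + u (s - tau) ^+ 2) - 2 * u s * u (s - tau))
    <= sin (Om * tau) * (Phi s - Phi (s - tau)).
Proof.
move=> Om0; rewrite le_eqVlt => /orP[/eqP<- _ _|tau0 alt ud].
  by rewrite mulr0 cos0 sin0 !subr0 mul0r; nra.
set a := Om * tau in alt *.
have a0 : 0 < a by apply: mulr_gt0.
have pi0 := pi_gt0 R.
have sa0 : 0 < sin a by apply: sin_gt0_pi; rewrite a0 /=; lra.
pose S := (sin a)^-1.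
have Sa : S * sin a = 1 by rewrite mulVf // gt_eqF.
set c1 := u s; set c0 := u (s - tau).
pose A1 t := sin (Om * (t - (s - tau))); pose B1 t := cos (Om * (t - (s - tau))).
pose A0 t := sin (- Om * (t - s)); pose B0 t := cos (- Om * (t - s)).
have dA1 t : D A1 t (B1 t * Om).
  exact: (is_derive1_comp (is_derive_sin _) (der_affine Om (s - tau) t)).
have dB1 t : D B1 t (- A1 t * Om).
  exact: (is_derive1_comp (is_derive_cos _) (der_affine Om (s - tau) t)).
have dA0 t : D A0 t (B0 t * - Om).
  exact: (is_derive1_comp (is_derive_sin _) (der_affine (- Om) s t)).
have dB0 t : D B0 t (- A0 t * - Om).
  exact: (is_derive1_comp (is_derive_cos _) (der_affine (- Om) s t)).
pose m t := S * (c0 * A0 t + c1 * A1 t).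
pose m1 t := S * (c0 * (B0 t * - Om) + c1 * (B1 t * Om)).
have dm t : D m t (m1 t) by exact: derZ (derD (derZ _ (dA0 t)) (derZ _ (dA1 t))).
have dm1 t : D m1 t (- Om ^+ 2 * m t).
  have d0 : D (fun x => B0 x * - Om) t (- Om * (- A0 t * - Om)).
    by have := derZ (- Om) (dB0 t); under eq_fun do rewrite mulrC.
  have d1 : D (fun x => B1 x * Om) t (Om * (- A1 t * Om)).
    by have := derZ Om (dB1 t); under eq_fun do rewrite mulrC.
  apply: der_eq (derZ S (derD (derZ c0 d0) (derZ c1 d1))) _.
  rewrite /m; ring.
(* Centred at the midpoint, the argument of the tangent stays within [a / 2 < pi / 4] of 0, so [psi]
   is a regular solution of the scalar Riccati equation used to complete the square. *)
pose psi t := tan (Om * (t - (s - tau / 2))).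
have dpsi t : s - tau <= t <= s -> D psi t ((1 + psi t ^+ 2) * Om).
  move=> /andP[t1 t2].
  have x1 : Om * (- (tau / 2)) <= Om * (t - (s - tau / 2)).
    by rewrite ler_pM2l //; lra.
  have x2 : Om * (t - (s - tau / 2)) <= Om * (tau / 2).
    by rewrite ler_pM2l //; lra.
  have cx : cos (Om * (t - (s - tau / 2))) != 0.
    rewrite gt_eqF // cos_gt0_pihalf //.
    have e : Om * (tau / 2) = a / 2 by rewrite mulrA.
    move: x1 x2; rewrite mulrN e; lra.
  have dt := is_derive_tan cx; rewrite cos2_tan2 // in dt.
  exact: (@is_derive1_comp R tan (fun x => Om * (x - (s - tau / 2))) t _ _ dt
    (der_affine Om (s - tau / 2) t)).
(* The terms in [u t - m t] vanish at both ends because [m] interpolates [u]; only the boundary term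
   [m t * m1 t] contributes to the final inequality. *)
pose J t := Phi t + Om * (psi t * (u t - m t) ^+ 2) - 2 * (m1 t * (u t - m t)) - m t * m1 t.
pose dJ t := (du t - m1 t + Om * psi t * (u t - m t)) ^+ 2.
have : J (s - tau) <= J s.
  apply: (@der_ge0_le R J dJ); first by rewrite gerBl ltW.
    move=> t ht; have [dut dPt] := ud t ht.
    have dw := derB dut (dm t).
    have dw2 := der_sqr dw.
    apply: der_eq (derB (derB (derD dPt (derZ Om (derM (dpsi t ht) dw2)))
       (derZ 2 (derM (dm1 t) dw))) (derM (dm t) (dm1 t))) _.
    rewrite /dJ; ring.
  by move=> t _; exact: sqr_ge0.
have mE1 : m s = c1.
  rewrite /m /A0 /A1 subrr mulr0 sin0 mulr0 add0r opprB addrC subrK -/a.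
  by rewrite mulrCA Sa mulr1.
have mE0 : m (s - tau) = c0.
  rewrite /m /A0 /A1 subrr mulr0 sin0 mulr0 addr0.
  have -> : - Om * (s - tau - s) = a by rewrite /a; ring.
  by rewrite mulrCA Sa mulr1.
have m1E1 : m1 s = S * (Om * (cos a * c1 - c0)).
  rewrite /m1 /B0 /B1 subrr mulr0 cos0 subKr -/a; congr (_ * _); ring.
have m1E0 : m1 (s - tau) = S * (Om * (c1 - cos a * c0)).
  rewrite /m1 /B0 /B1 subrr mulr0 cos0.
  have -> : - Om * (s - tau - s) = a by rewrite /a; ring.
  congr (_ * _); ring.
rewrite /J mE1 mE0 m1E1 m1E0 -/c1 -/c0 !subrr expr0n /= !mulr0 !subr0 !addr0.
have k c x : sin a * (c * (S * x)) = c * x.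
  by rewrite mulrCA (mulrA (sin a)) (mulrC (sin a)) Sa mul1r.
rewrite -(ler_pM2l sa0) (mulrBr _ (Phi s)) (mulrBr _ (Phi (s - tau))) !k; lra.
Qed.

End Oscillation.

(** * Spectral factorization *)

Section SpectralFactorization.
Variable R : rcfType.
Implicit Types (p q h : {poly R}).

(** Quantitative continuity, since [R] is only a real closed field here: writing [p - p.[r]] as a
    multiple of ['X - r], with bounded cofactor near [r], a negative value at [r] would persist at
    distance [d]. *)
Lemma horner_ge0_adherent p r :
  (forall d : R, 0 < d -> exists y : R, `|y - r| <= d /\ 0 <= p.[y]) -> 0 <= p.[r].
Proof.
move=> H; rewrite leNgt; apply/negP => pr0.
have /factor_theorem[q qE] : root (p - p.[r]%:P) r.
  by rewrite rootE !hornerE subrr.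
have pE y : p.[y] = p.[r] + q.[y] * (y - r).
  by have := congr1 (horner^~ y) qE; rewrite !hornerE => <-; ring.
have [M qM] := poly_disk_bound q (`|r| + 1).
have M0 : 0 <= M.
  by apply: le_trans (qM r _); rewrite ?normr_ge0 // lerDl.
pose d := Num.min 1 (- p.[r] / (2 * (M + 1))).
have M1 : 0 < 2 * (M + 1) by lra.
have d0 : 0 < d by rewrite lt_min ltr01 divr_gt0 // oppr_gt0.
have [y [yd py]] := H d d0.
have d1 : d <= 1 by rewrite ge_min lexx.
have dM : d * (2 * (M + 1)) <= - p.[r].
  by rewrite -ler_pdivlMr // ge_min lexx orbT.
have qy : `|q.[y]| <= M.
  apply: qM; have -> : y = r + (y - r) by ring.
  by apply: le_trans (ler_normD _ _) _; rewrite lerD2l (le_trans yd).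
have : q.[y] * (y - r) <= M * d.
  apply: le_trans (ler_norm _) _; rewrite normrM; exact: ler_pM.
rewrite pE in py; nra.
Qed.

Local Notation opX p := (p \Po (- 'X)).
Local Notation sqX p := (p \Po 'X^2).

Lemma opX_X2 : opX ('X^2 : {poly R}) = 'X^2.
Proof. by rewrite comp_Xn_poly sqrrN. Qed.

(** The remainder modulo this real quadratic has degree at most 1 and vanishes at a nonreal point,
    hence is zero. *)
Lemma nonreal_root_dvdp p (a b : R) : b != 0 ->
  root (map_poly (real_complex R) p) (Complex a b) ->
  ('X^2 - (2 * a) *: 'X + (a ^+ 2 + b ^+ 2)%:P) %| p.
Proof.
move=> b0; set q := (X in X %| _) => rp.
have sq : size q = 3%N.
  rewrite /q -addrA size_polyDl size_polyXn //.
  rewrite (leq_ltn_trans (size_polyD _ _)) // gtn_max size_polyN.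
  by rewrite (leq_ltn_trans (size_scale_leq _ _)) ?size_polyX // size_polyC; case: eqP.
have q0 : q != 0 by rewrite -size_poly_eq0 sq.
rewrite /dvdp; set r := p %% q.
have sr : (size r < 3)%N by rewrite -sq ltn_modp.
have rE : r = r`_1 *: 'X + (r`_0)%:P.
  apply/polyP => i; rewrite !coefE; case: i => [|[|i]] /=; rewrite ?mulr0 ?mulr1 ?add0r ?addr0 //.
  by rewrite nth_default // -ltnS (leq_trans sr).
have qr : (map_poly (real_complex R) q).[Complex a b] = 0.
  rewrite /q !(rmorphB, rmorphD) /= map_polyZ map_polyX map_polyXn !map_polyC /=.
  rewrite !hornerE expr2; apply/eqP; rewrite eq_complex /=.
  by apply/andP; split; apply/eqP; ring.
have : (map_poly (real_complex R) r).[Complex a b] = 0.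
  move: rp; rewrite (divp_eq p q) rmorphD rmorphM /= /root hornerD hornerM qr mulr0 add0r.
  by move/eqP.
rewrite rE rmorphD /= map_polyZ map_polyX map_polyC /= !hornerE => /eqP.
rewrite eq_complex /= => /andP[/eqP e1 /eqP e2].
have r1 : r`_1 = 0.
  by apply/eqP; rewrite -(mulIr_eq0 _ (mulIf b0)); apply/eqP; lra.
by rewrite r1 scale0r add0r (_ : r`_0 = 0) ?polyC0 //; rewrite r1 in e1; lra.
Qed.

(* [h h(-X)] takes the value [|h(i w)|^2] at [i w]. *)
Lemma spectral_factor p : (forall y : R, y <= 0 -> 0 <= p.[y]) ->
  exists h, sqX p = h * opX h.
Proof.
have [n] := ubnP (size p); elim: n p => // n IH p; rewrite ltnS => sp p0.
have [/size1_polyC pc|sp1] := leqP (size p) 1.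
  exists (Num.sqrt p`_0)%:P; rewrite pc !comp_polyC coefC /=.
  rewrite -polyCM -expr2 sqr_sqrtr //.
  by have := p0 0 (lexx _); rewrite horner_coef0.
have pn0 : p != 0 by rewrite -size_poly_gt0 (ltn_trans _ sp1).
(* Spectral factors multiply, so the induction may split off any nonconstant factor that has one,
   provided the quotient remains nonnegative on the half-line. *)
have step q k : p = q * k -> (1 < size k)%N -> (forall y, y <= 0 -> 0 <= q.[y]) ->
    (exists h, sqX k = h * opX h) -> exists h, sqX p = h * opX h.
  move=> pE sk q0 [hk hkE].
  have qn0 : q != 0 by apply: contraNneq pn0 => q00; rewrite pE q00 mul0r.
  have kn0 : k != 0 by rewrite -size_poly_gt0 (ltn_trans _ sk).
  have [|hq hqE] := IH q _ q0.
    apply: leq_trans sp; rewrite pE size_mul //.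
    by case: (size k) sk => [|[|m]] // _; rewrite !addnS /= ltnS leq_addr.
  by exists (hq * hk); rewrite pE !comp_polyM hqE hkE mulrACA.
have [|mu rmu] := closed_rootP (map_poly (real_complex R) p) _.
  by rewrite size_map_poly gtn_eqF.
have [mi0|mi0] := eqVneq (complex.Im mu) 0; last first.
  (* Over ['X^2] the conjugate pair of roots becomes the four roots [s], [-s] and their conjugates;
     [h] collects [s] and its conjugate, and [h(-X)] the other two. *)
  pose s := sqrtc mu; pose a := complex.Re s; pose c := complex.Im s.
  have muE : mu = Complex (a ^+ 2 - c ^+ 2) (2 * (a * c)).
    rewrite -(sqr_sqrtc mu) -/s expr2 /a /c; case: (s) => x y.
    by apply/eqP; rewrite eq_complex /=; apply/andP; split; apply/eqP; ring.
  rewrite muE /= in mi0; rewrite muE in rmu.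
  have := nonreal_root_dvdp mi0 rmu => /dvdpP[q pE].
  apply: (step _ _ pE).
  - rewrite -addrA size_polyDl size_polyXn //.
    rewrite (leq_ltn_trans (size_polyD _ _)) // gtn_max size_polyN.
    by rewrite (leq_ltn_trans (size_scale_leq _ _)) ?size_polyX // size_polyC; case: eqP.
  - move=> y y0; have := p0 y y0; rewrite pE hornerM pmulr_lge0 //.
    rewrite [ltRHS](_ : _ = (y - (a ^+ 2 - c ^+ 2)) ^+ 2 + (2 * (a * c)) ^+ 2).
      by rewrite ltr_wpDl ?sqr_ge0 // exprn_even_gt0.
    rewrite !(hornerD, hornerN, hornerZ, hornerXn, hornerX, hornerC); ring.
  exists ('X^2 - (2 * a) *: 'X + (a ^+ 2 + c ^+ 2)%:P).
  rewrite !(comp_polyB, comp_polyD) !comp_polyZ !comp_polyC opX_X2 !comp_polyX.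
  rewrite comp_Xn_poly -!mul_polyC; ring.
have rE : mu = (complex.Re mu)%:C%C by case: (mu) mi0 => x y /= ->.
set r := complex.Re mu in rE.
have /factor_theorem[p1 pE] : root p r.
  by rewrite rE in rmu; rewrite -(fmorph_root (real_complex R)).
(* A root [r >= 0] is split off as [r - 'X], which is nonnegative on the half-line and becomes a
   difference of squares over ['X^2]. For [r = 0] the sign of the quotient at 0 is recovered by
   adherence. *)
have [r0|r0] := leP 0 r.
  have pE' : p = (- p1) * (r%:P - 'X) by rewrite pE; ring.
  have p1lt y : y < 0 -> 0 <= (- p1).[y].
    move=> y0; have := p0 y (ltW y0); rewrite pE' hornerM pmulr_lge0 //.
    by rewrite !hornerE; lra.
  apply: (step _ _ pE').
  - by rewrite -size_polyN opprB size_XsubC.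
  - move=> y; rewrite le_eqVlt => /orP[/eqP->|]; last exact: p1lt.
    apply: horner_ge0_adherent => d d0; exists (- d).
    by rewrite subr0 normrN gtr0_norm // lexx p1lt ?oppr_lt0.
  exists ((Num.sqrt r)%:P + 'X).
  rewrite comp_polyB comp_polyD !comp_polyC !comp_polyX.
  by rewrite -{1}(sqr_sqrtr r0) rmorphXn /=; ring.
(* At a negative root the cofactor is nonpositive to the left and nonnegative to the right, so it
   vanishes there too: the root is double, and [('X - r) ^+ 2] becomes the square of an even
   polynomial. *)
have p1l y : y < r -> p1.[y] <= 0.
  move=> yr; have := p0 y (ltW (lt_trans yr r0)); rewrite pE hornerM nmulr_lge0 //.
  by rewrite !hornerE; lra.
have p1r y : r < y -> y <= 0 -> 0 <= p1.[y].
  move=> yr y0; have := p0 y y0; rewrite pE hornerM pmulr_lge0 //.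
  by rewrite !hornerE; lra.
have rp1 : root p1 r.
  rewrite rootE; apply/eqP/le_anti/andP; split.
    rewrite -oppr_ge0 -hornerN; apply: horner_ge0_adherent => d d0; exists (r - d).
    rewrite addrC addKr normrN gtr0_norm // lexx hornerN oppr_ge0 p1l ?gtrBl //.
  apply: horner_ge0_adherent => d d0; exists (r + Num.min d (- r)).
  have m0 : 0 < Num.min d (- r) by rewrite lt_min d0 oppr_gt0.
  rewrite addrC addKr gtr0_norm // ge_min lexx; split => //; apply: p1r.
    by rewrite ltrDl.
  by rewrite -lerBrDl sub0r ge_min lexx orbT.
have /factor_theorem[p2 p1E] := rp1.
have pE2 : p = p2 * ('X - r%:P) ^+ 2 by rewrite pE p1E expr2 mulrA.
have p2n y : y <= 0 -> y != r -> 0 <= p2.[y].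
  move=> y0 yr; have := p0 y y0; rewrite pE2 hornerM pmulr_lge0 //.
  by rewrite !hornerE exprn_even_gt0 //= subr_eq0.
apply: (step _ _ pE2).
- by rewrite size_exp_XsubC.
- move=> y y0; have [->|] := eqVneq y r; last exact: p2n.
  apply: horner_ge0_adherent => d d0; exists (r - d).
  rewrite addrC addKr normrN gtr0_norm // lexx; split => //; apply: p2n; first lra.
  by rewrite -subr_eq0 addrC addKr oppr_eq0 gt_eqF.
exists ('X^2 - r%:P).
by rewrite rmorphXn /= !comp_polyB !comp_polyC opX_X2 comp_polyX expr2.
Qed.

End SpectralFactorization.

(** * Quadratic forms that are derivatives *)

Section LyapunovImage.
Variables (R : realType) (n : nat) (A : 'M[R]_n.+1).
Local Notation hA := (horner_mx A).

(** Along [z' = A z] the vectors [c A^j z] are the derivatives of the output [c z], so this measures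
    the output with its first [n] derivatives. *)
Definition krylov m (c : 'M[R]_(m, n.+1)) (z : 'cV[R]_n.+1) : R :=
  \sum_(j < n.+1) sqn (c *m A ^+ j *m z).

Lemma krylov_ge0 m (c : 'M[R]_(m, n.+1)) z : 0 <= krylov c z.
Proof. by apply: sumr_ge0 => i _; exact: sqn_ge0. Qed.

Lemma sqn_le_krylov m (c : 'M[R]_(m, n.+1)) z : sqn (c *m z) <= krylov c z.
Proof.
rewrite /krylov big_ord_recl expr0 mulmx1 lerDl.
by apply: sumr_ge0 => i _; exact: sqn_ge0.
Qed.

Lemma krylovZ m (c : 'M[R]_(m, n.+1)) a z : krylov c (a *: z) = a ^+ 2 * krylov c z.
Proof.
by rewrite /krylov mulr_sumr; apply: eq_bigr => i _; rewrite -scalemxAr sqnZ.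
Qed.

Lemma krylovD_le m (c : 'M[R]_(m, n.+1)) x y :
  krylov c (x + y) <= 2 * krylov c x + 2 * krylov c y.
Proof.
rewrite /krylov !mulr_sumr -big_split; apply: ler_sum => i _ /=.
by rewrite mulmxDr sqnD_le.
Qed.

Lemma krylov_le m (c : 'M[R]_(m, n.+1)) : exists2 k, 0 <= k &
  forall z, krylov c z <= k * sqn z.
Proof.
exists (\sum_(j < n.+1) frob (c *m A ^+ j)).
  by apply: sumr_ge0 => i _; exact: frob_ge0.
by move=> z; rewrite mulr_suml; apply: ler_sum => i _; exact: sqn_mul_le.
Qed.

(** Cayley-Hamilton reduces [g] modulo the characteristic polynomial to the powers counted by
    [krylov]. The constant precedes [c], which is the uniformity needed later. *)
Lemma horner_mx_krylov (g : {poly R}) : exists2 k, 0 <= k &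
  forall m (c : 'M[R]_(m, n.+1)) z, sqn (c *m hA g *m z) <= k * krylov c z.
Proof.
set r := g %% char_poly A.
exists (n.+1%:R * \sum_(i < n.+1) r`_i ^+ 2).
  by rewrite mulr_ge0 ?ler0n // sumr_ge0 // => i _; exact: sqr_ge0.
move=> m c z.
have sr : (size r <= n.+1)%N.
  rewrite -ltnS -(size_char_poly A) ltn_modp.
  by rewrite monic_neq0 // char_poly_monic.
have -> : hA g = \sum_(i < n.+1) r`_i *: A ^+ i.
  rewrite {1}(divp_eq g (char_poly A)) rmorphD rmorphM /= Cayley_Hamilton mulr0 add0r.
  rewrite -/r -{1}(coefK r) (_ : \poly_(i < size r) r`_i = \poly_(i < n.+1) r`_i).
    rewrite poly_def rmorph_sum; apply: eq_bigr => i _ /=.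
    by rewrite -mul_polyC rmorphM rmorphXn /= horner_mx_C horner_mx_X -scalemx1 -scalerAl mul1r.
  apply/polyP => i; rewrite !coef_poly; case: ltnP => [/leq_trans -> //|ri].
  by rewrite nth_default // if_same.
rewrite mulmx_sumr mulmx_suml.
apply: le_trans (sqn_sum_le _) _.
rewrite -mulrA ler_wpM2l ?ler0n // mulr_suml; apply: ler_sum => i _.
rewrite -scalemxAr -scalemxAl sqnZ ler_wpM2l ?sqr_ge0 //.
rewrite /krylov (bigD1 i) //= lerDl.
by apply: sumr_ge0 => j _; exact: sqn_ge0.
Qed.

(* Quadratic forms in the signal [c z] that are derivatives, along
   [z' = A z], of a form [Q] bounded by the Krylov norm of [c z]. *)
Definition lyap_image (F : forall m, 'M[R]_(m, n.+1) -> 'M[R]_n.+1) :=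
  exists2 k, 0 <= k & forall m (c : 'M[R]_(m, n.+1)), exists2 Q : 'M[R]_n.+1,
    F m c = A^T *m Q + Q *m A &
    forall z y, `|dotv z (Q *m y)| <= k * (krylov c z + krylov c y).

Lemma lyap_imageD F G : lyap_image F -> lyap_image G ->
  lyap_image (fun m c => F m c + G m c).
Proof.
move=> [k k0 Fk] [l l0 Gl]; exists (k + l); first exact: addr_ge0.
move=> m c; have [Q FQ Qb] := Fk m c; have [S GS Sb] := Gl m c.
exists (Q + S); first by rewrite FQ GS mulmxDr mulmxDl addrACA.
move=> z y; rewrite mulmxDl dotvDr mulrDl (le_trans (ler_normD _ _)) //.
exact: lerD.
Qed.

Lemma lyap_imageZ a F : lyap_image F -> lyap_image (fun m c => a *: F m c).
Proof.
move=> [k k0 Fk]; exists (`|a| * k); first exact: mulr_ge0.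
move=> m c; have [Q FQ Qb] := Fk m c.
exists (a *: Q); first by rewrite FQ scalerDr -scalemxAr -scalemxAl.
by move=> z y; rewrite -scalemxAl dotvZr normrM -mulrA ler_wpM2l.
Qed.

Lemma lyap_image_ext F G : (forall m c, F m c = G m c) -> lyap_image F -> lyap_image G.
Proof.
move=> FG [k k0 Fk]; exists k => // m c.
by have [Q FQ Qb] := Fk m c; exists Q => //; rewrite -FG.
Qed.

Lemma lyap_image0 : lyap_image (fun _ _ => 0).
Proof.
exists 0 => // m c; exists 0; first by rewrite mulmx0 mul0mx addr0.
by move=> z y; rewrite mul0mx dotv0r normr0 mul0r.
Qed.

Lemma lyap_image_sum d (F : 'I_d -> forall m, 'M[R]_(m, n.+1) -> 'M[R]_n.+1) :
  (forall i, lyap_image (F i)) -> lyap_image (fun m c => \sum_i F i m c).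
Proof.
elim: d F => [|d IH] F Fi.
  by apply: lyap_image_ext lyap_image0 => m c; rewrite big_ord0.
apply: (@lyap_image_ext (fun m c => F ord0 m c + \sum_i F (lift ord0 i) m c)).
  by move=> m c; rewrite big_ord_recl.
by apply: lyap_imageD => //; apply: IH.
Qed.

Lemma form_bound (h k : {poly R}) : exists2 b, 0 <= b &
  forall m (c : 'M[R]_(m, n.+1)) z y,
    `|dotv (c *m hA h *m z) (c *m hA k *m y)| <= b * (krylov c z + krylov c y).
Proof.
have [b1 b10 H1] := horner_mx_krylov h; have [b2 b20 H2] := horner_mx_krylov k.
exists (b1 + b2); first exact: addr_ge0.
move=> m c z y.
set x1 := c *m hA h *m z; set x2 := c *m hA k *m y.
have := dotv_le_young x1 x2 ltr01; have := dotv_le_young (- x1) x2 ltr01.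
rewrite dotvNl sqnN invr1 !mul1r => y1 y2.
have := H1 _ c z; have := H2 _ c y; rewrite -/x1 -/x2 => h2 h1.
have := sqn_ge0 x1; have := sqn_ge0 x2 => s2 s1.
have kz := krylov_ge0 c z; have ky := krylov_ge0 c y.
have p1 := mulr_ge0 b10 ky; have p2 := mulr_ge0 b20 kz.
rewrite ler_norml; apply/andP; split; lra.
Qed.

(** Integration by parts: transferring one factor [A] from the left slot to the right one changes
    its sign and costs a total derivative. Induction on [h] thus replaces [h] by [h \Po (- 'X)]. *)
Lemma form_shift (h k : {poly R}) : lyap_image (fun m c =>
  (hA h)^T *m c^T *m c *m hA k - c^T *m c *m hA ((h \Po (- 'X)) * k)).
Proof.
elim/poly_ind: h k => [|h a IH] k.
  apply: lyap_image_ext lyap_image0 => m c; rewrite comp_poly0 mul0r !rmorph0.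
  by rewrite trmx0 !mul0mx mulmx0 subr0.
have [b b0 H] := form_bound h k.
have L1 : lyap_image (fun m c =>
    A^T *m ((hA h)^T *m c^T *m c *m hA k) + ((hA h)^T *m c^T *m c *m hA k) *m A).
  exists b => // m c; exists ((hA h)^T *m c^T *m c *m hA k) => // z y.
  apply: le_trans (H _ c z y).
  by rewrite (dotvMl _ z) trmx_mul !mulmxA.
have L2 := lyap_imageZ (-1) (IH (k * 'X)).
apply: lyap_image_ext (lyap_imageD L1 L2) => m c.
have hM (f g : {poly R}) : hA (f * g) = hA f *m hA g by exact: rmorphM.
have hD (f g : {poly R}) : hA (f + g) = hA f + hA g by exact: rmorphD.
have hN (f : {poly R}) : hA (- f) = - hA f by exact: rmorphN.
rewrite scaleN1r opprB comp_poly_MXaddC mulrDl mulrN mulNr.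
rewrite !(hD, hN, hM) horner_mx_C horner_mx_X.
have cm : A *m hA k = hA k *m A.
  by have := comm_horner_mx k (comm_mx_refl A); rewrite /comm_mx => ->.
rewrite linearD /= trmx_mul tr_scalar_mx mul_scalar_mx.
rewrite !(mulmxDl, mulmxDr, mulmxN) mul_scalar_mx -!scalemxAl -scalemxAr.
rewrite !mulmxA -(mulmxA _ A (hA k)) cm !mulmxA opprD opprK.
by rewrite [LHS]addrACA [RHS]addrACA !subrr.
Qed.

End LyapunovImage.

(** * Bernstein's inequality for the free motion *)

Section Bernstein.
Variable R : realType.

Definition csq (z : R[i]) : R := complex.Re z ^+ 2 + complex.Im z ^+ 2.

Lemma csqM (z w : R[i]) : csq (z * w) = csq z * csq w.
Proof. case: z => a b; case: w => c d; rewrite /csq /=; ring. Qed.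

Lemma csq_ge0 (z : R[i]) : 0 <= csq z.
Proof. by rewrite addr_ge0 // sqr_ge0. Qed.

Lemma horner_char_poly (F : comNzRingType) n (M : 'M[F]_n) (l : F) :
  (char_poly M).[l] = \det (l%:M - M).
Proof.
rewrite /char_poly -horner_evalE -det_map_mx; congr (\det _).
apply/matrixP => i j.
by rewrite !mxE /= /horner_eval hornerD hornerN hornerC hornerMn hornerX.
Qed.

Lemma eigenvalue_of_root n (A : 'M[R]_n) l :
  eigenvalue_of A l <-> root (char_poly (cmx A)) l.
Proof.
rewrite /eigenvalue_of -horner_char_poly; split=> [/eqP //|]; exact/eqP.
Qed.

Lemma eigenvalue_of_conj n (A : 'M[R]_n) a b :
  eigenvalue_of A (Complex a b) -> eigenvalue_of A (Complex a (- b)).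
Proof.
have e : map_poly (@conjc R) (char_poly (cmx A)) = char_poly (cmx A).
  rewrite map_char_poly; congr char_poly; apply/matrixP => i j.
  by rewrite !mxE; exact: conjc_real.
rewrite !eigenvalue_of_root => h.
by have := complex_root_conj (char_poly (cmx A)) (Complex a b); rewrite e h => /esym.
Qed.

(** The supremum ranges over a subset of the finitely many roots of the characteristic polynomial,
    so it is a genuine upper bound; conjugation symmetry turns it into a bound on the modulus and
    makes it nonnegative. *)
Lemma omega_max_spec n (A : 'M[R]_n) : eig_closed_lhp A ->
  0 <= omega_max A /\ forall l, eigenvalue_of A l ->
    complex.Re l < 0 \/ `|complex.Im l| <= omega_max A.
Proof.
move=> Acl; rewrite /omega_max; case: asboolP => [Ah|nAh].
  by split=> // l /Ah; left.
set S := [set w | _]%classic.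
have [rs rsE] := closed_field_poly_normal (char_poly (cmx A)).
have Sub w : S w -> w <= \big[Num.max/0]_(l <- rs) complex.Im l.
  move=> /eigenvalue_of_root; rewrite rsE rootZ ?lead_coef_eq0; last first.
    by rewrite monic_neq0 // char_poly_monic.
  rewrite root_prod_XsubC => wrs.
  have : complex.Im (Complex 0 w) <= \big[Num.max/0]_(l <- rs) complex.Im l by exact: le_bigmax_seq.
  by [].
have Sup w : S w -> w <= sup S.
  move=> Sw; apply: sup_upper_bound => //; split; first by exists w.
  by exists (\big[Num.max/0]_(l <- rs) complex.Im l) => u /Sub.
have [l [lA l0]] : exists l, eigenvalue_of A l /\ complex.Re l = 0.
  apply: contra_notP nAh => nl l lA.
  have := Acl l lA; rewrite le_eqVlt => /orP[/eqP l0|//].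
  by exfalso; apply: nl; exists l.
have imS : forall l, eigenvalue_of A l -> complex.Re l = 0 -> `|complex.Im l| <= sup S.
  case=> a b /= lb a0; rewrite a0 in lb.
  rewrite ler_norml; apply/andP; split; last exact: Sup.
  rewrite lerNl; apply: Sup; exact: eigenvalue_of_conj.
split; first by apply: le_trans (imS l lA l0).
move=> k kA; have := Acl k kA; rewrite le_eqVlt => /orP[/eqP k0|]; last by left.
by right; apply: imS.
Qed.

Lemma factor_lower_bound (l : R[i]) (Om : R) : 0 < Om ->
  complex.Re l < 0 \/ `|complex.Im l| < Om ->
  exists2 c, 0 < c & forall w, Om <= `|w| -> c * (1 + w ^+ 2) <= csq (Complex 0 w - l).
Proof.
case: l => a b Om0 /= lP; rewrite /csq /=.
have [a0|a0] := eqVneq a 0.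
  case: lP => [|bO]; first by rewrite a0 ltxx.
  (* Beyond [Om] the distance from [w] to [b] is at least [k] times the modulus of [w]; the
     denominator [1 + Om ^- 2] pays for replacing [w ^+ 2] by [1 + w ^+ 2]. *)
  pose k := 1 - `|b| / Om.
  have k0 : 0 < k by rewrite subr_gt0 ltr_pdivrMr // mul1r.
  exists (k ^+ 2 / (1 + Om ^- 2)).
    by rewrite divr_gt0 ?exprn_gt0 // addr_gt0 // invr_gt0 exprn_gt0.
  move=> w Ow; have w0 : 0 < `|w| by apply: lt_le_trans Ow.
  have h1 : 1 + w ^+ 2 <= w ^+ 2 * (1 + Om ^- 2).
    rewrite mulrDr mulr1 addrC lerD2l ler_pdivlMr ?exprn_gt0 // mul1r.
    by rewrite -(real_normK (num_real w)) lerXn2r // nnegrE ltW.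
  have h2 : k * `|w| <= `|w - b|.
    apply: le_trans (lerB_dist _ _).
    rewrite /k mulrBl mul1r lerD2l lerN2 mulrAC ler_pdivlMr //.
    by rewrite ler_wpM2l.
  have h3 : k ^+ 2 * w ^+ 2 <= (w - b) ^+ 2.
    rewrite -(real_normK (num_real w)) -(real_normK (num_real (w - b))) -exprMn.
    by rewrite lerXn2r // nnegrE ?mulr_ge0 // ltW.
  have Om2 : 0 < 1 + Om ^- 2 by rewrite addr_gt0 // invr_gt0 exprn_gt0.
  rewrite a0 subr0 expr0n add0r (le_trans _ h3) // mulrAC ler_pdivrMr // -[leRHS]mulrA.
  by rewrite ler_wpM2l // sqr_ge0.
have a2 : 0 < a ^+ 2 by rewrite exprn_even_gt0.
(* Chosen from [w^2 <= 2 (w - b)^2 + 2 b^2]: the fraction turns [a ^+ 2] into [1 + 2 * b ^+ 2], and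
   the summand 2 covers the rest. *)
pose K := (1 + 2 * b ^+ 2) / a ^+ 2 + 2.
have b2 := sqr_ge0 b.
have K0 : 0 < K by rewrite addr_gt0 // divr_gt0 //; lra.
exists K^-1; first by rewrite invr_gt0.
move=> w _; rewrite mulrC ler_pdivrMr //.
have e : (1 + 2 * b ^+ 2) / a ^+ 2 * a ^+ 2 = 1 + 2 * b ^+ 2 by rewrite divfK // gt_eqF.
have K1 : 0 <= (1 + 2 * b ^+ 2) / a ^+ 2 by rewrite divr_ge0 //; lra.
rewrite /K mulrDr [X in _ <= X + _]mulrDl sub0r sqrrN [a ^+ 2 * _]mulrC e.
have := mulr_ge0 (sqr_ge0 (w - b)) K1.
have := sqr_ge0 (w - 2 * b).
nra.
Qed.

Lemma prod_lower_bound (rs : seq R[i]) (Om : R) : 0 < Om ->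
  (forall l, l \in rs -> complex.Re l < 0 \/ `|complex.Im l| < Om) ->
  exists2 c, 0 < c & forall w, Om <= `|w| ->
    c * (1 + w ^+ 2) ^+ size rs <= csq (\prod_(l <- rs) (Complex 0 w - l)).
Proof.
move=> Om0; elim: rs => [|l rs IH] H.
  exists 1 => // w _; rewrite big_nil expr0 /csq /= expr1n expr0n addr0; lra.
have [c c0 cH] := factor_lower_bound Om0 (H l (mem_head _ _)).
have [|d d0 dH] := IH; first by move=> k kr; apply: H; rewrite inE kr orbT.
exists (c * d); first exact: mulr_gt0.
move=> w Ow; rewrite big_cons csqM /= exprS mulrACA.
have w1 : 0 <= 1 + w ^+ 2 by rewrite addr_ge0 // sqr_ge0.
by apply: ler_pM; rewrite ?cH ?dH // mulr_ge0 ?exprn_ge0 // ltW.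
Qed.

(** The product [f f(-X)] is even; with even part [e] and odd part [o] of [f] it is [e^2 - X o^2]
    evaluated at [X^2]. Passing to [X^2] moves the imaginary axis to the half-line where
    [spectral_factor] applies. *)
Lemma even_norm_poly (f : {poly R}) : exists2 s : {poly R},
  s \Po 'X^2 = f * (f \Po (- 'X)) &
  forall w, s.[- w ^+ 2] = csq (map_poly (real_complex R) f).[Complex 0 w].
Proof.
pose e := even_poly f; pose o := odd_poly f.
have fE : f = e \Po 'X^2 + (o \Po 'X^2) * 'X by rewrite poly_even_odd.
exists (e ^+ 2 - 'X * o ^+ 2).
  have -> : f \Po (- 'X) = e \Po 'X^2 - (o \Po 'X^2) * 'X.
    by rewrite {1}fE comp_polyD comp_polyM comp_polyX -!comp_polyA opX_X2 mulrN.
  rewrite {1}fE comp_polyB ['X * _ \Po _]comp_polyM comp_polyX !rmorphXn /=; ring.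
move=> w.
have ce (g : {poly R}) : (map_poly (real_complex R) (g \Po 'X^2)).[Complex 0 w] =
    (g.[- w ^+ 2])%:C%C.
  rewrite map_comp_poly horner_comp map_polyXn hornerXn.
  have -> : Complex 0 w ^+ 2 = (- w ^+ 2)%:C%C.
    by rewrite expr2; apply/eqP; rewrite eq_complex /=; apply/andP; split; apply/eqP; ring.
  by rewrite horner_map.
have -> : (map_poly (real_complex R) f).[Complex 0 w] =
    (e.[- w ^+ 2])%:C%C + (o.[- w ^+ 2])%:C%C * Complex 0 w.
  by rewrite {1}fE rmorphD rmorphM /= map_polyX hornerD hornerM hornerX !ce.
rewrite /csq /=
  !(hornerD, hornerN, hornerM, hornerX, horner_exp); ring.
Qed.

(** At [i w] the left side is [C |chi(i w)|^2 + Om0^2 - w^2 - th \sum_k w^(2k)], with [chi] the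
    characteristic polynomial. At low frequencies the gap between [Om0] and [omega_max] keeps it
    nonnegative; at high frequencies [chi] has no zeros and grows with full degree, so a large [C]
    wins. *)
Lemma frequency_inequality n (A : 'M[R]_n.+1) (Om0 : R) :
  eig_closed_lhp A -> omega_max A < Om0 ->
  exists th C, 0 < th /\ exists h : {poly R},
    C *: (char_poly A * (char_poly A \Po (- 'X))) + (Om0 ^+ 2)%:P + 'X^2
      - th *: \sum_(k < n.+1) ('X^k * ('X^k \Po (- 'X))) = h * (h \Po (- 'X)).
Proof.
move=> Acl Omlt; have [om0 omP] := omega_max_spec Acl.
pose Om1 := (omega_max A + Om0) / 2.
have Om1a : omega_max A < Om1 by rewrite /Om1; lra.
have Om1b : Om1 < Om0 by rewrite /Om1; lra.
have Om10 : 0 < Om1 by lra.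
have [rs rsE] := closed_field_poly_normal (char_poly (cmx A)).
rewrite (eqP (char_poly_monic _)) scale1r in rsE.
have srs : size rs = n.+1.
  by have := congr1 (fun p : {poly _} => size p) rsE; rewrite size_char_poly size_prod_XsubC => -[].
have [|c c0 cH] := @prod_lower_bound rs Om1 Om10.
  move=> l lrs; have /omP[|lim] : eigenvalue_of A l.
  - by apply/eigenvalue_of_root; rewrite rsE root_prod_XsubC.
  - by left.
  - by right; apply: le_lt_trans Om1a.
pose S := \sum_(k < n.+1) (Om1 ^+ 2) ^+ k.
have S0 : 0 <= S by apply: sumr_ge0 => k _; rewrite exprn_ge0 // sqr_ge0.
have dO : 0 < Om0 ^+ 2 - Om1 ^+ 2 by nra.
(* The quotient serves the low frequencies, where the power sum is at most [S]; the bound by 1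
   serves the high ones. *)
pose th := Num.min 1 ((Om0 ^+ 2 - Om1 ^+ 2) / (1 + S)).
have th0 : 0 < th by rewrite lt_min ltr01 divr_gt0 //; lra.
have th1 : th <= 1 by rewrite ge_min lexx.
have thS : th * (1 + S) <= Om0 ^+ 2 - Om1 ^+ 2.
  by rewrite -ler_pdivlMr ?ge_min ?lexx ?orbT //; lra.
(* One unit of [(1 + w ^+ 2) ^+ n.+1] dominates [w ^+ 2], and the remaining [n.+1] dominate the
   terms of the power sum. *)
pose C := (n.+2)%:R / c.
exists th, C; split=> //.
have [s sE sH] := even_norm_poly (char_poly A).
pose p := C *: s + (Om0 ^+ 2)%:P + 'X - th *: \sum_(k < n.+1) (- 'X) ^+ k.
have [|h hE] := @spectral_factor R p; last first.
  exists h; rewrite -hE /p !(comp_polyB, comp_polyD) !comp_polyZ sE comp_polyC comp_polyX.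
  congr (_ - _ *: _); rewrite raddf_sum /=; apply: eq_bigr => k _.
  rewrite comp_Xn_poly rmorphXn /= -exprMn; congr (_ ^+ _).
  by rewrite raddfN /= comp_polyX expr2 mulrN.
move=> y y0; pose w := Num.sqrt (- y).
have w2 : w ^+ 2 = - y by rewrite sqr_sqrtr // oppr_ge0.
have yE : y = - w ^+ 2 by rewrite w2 opprK.
have w0 : 0 <= w by exact: sqrtr_ge0.
rewrite yE /p !(hornerD, hornerN, hornerZ, hornerC, hornerX) sH.
have -> : (\sum_(k < n.+1) (- 'X) ^+ k).[- w ^+ 2] = \sum_(k < n.+1) (w ^+ 2) ^+ k.
  by rewrite horner_sum; apply: eq_bigr => k _; rewrite horner_exp hornerN hornerX opprK.
have -> : (map_poly (real_complex R) (char_poly A)) = char_poly (cmx A).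
  by rewrite map_char_poly.
set G := csq _; set T := \sum_(k < _) _.
have T0 : 0 <= T by apply: sumr_ge0 => k _; rewrite exprn_ge0 // sqr_ge0.
have C0 : 0 <= C by rewrite divr_ge0 ?ler0n // ltW.
have G0 : 0 <= C * G by rewrite mulr_ge0 // csq_ge0.
have [wO|wO] := leP Om1 w; last first.
  have TS : T <= S.
    apply: ler_sum => k _; rewrite lerXn2r ?nnegrE ?sqr_ge0 //.
    by rewrite lerXn2r ?nnegrE // ltW.
  have : w ^+ 2 <= Om1 ^+ 2 by rewrite lerXn2r ?nnegrE // ltW.
  nra.
have GC : (n.+2)%:R * (1 + w ^+ 2) ^+ n.+1 <= C * G.
  have := cH w; rewrite ger0_norm // => /(_ wO); rewrite srs => h1.
  rewrite /C -mulrA ler_wpM2l ?ler0n // mulrC ler_pdivlMr // mulrC.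
  apply: le_trans h1 _; rewrite /G rsE horner_prod.
  by under [X in _ <= csq X]eq_bigr do rewrite hornerXsubC.
have base : 1 <= 1 + w ^+ 2 by rewrite lerDl sqr_ge0.
have pw k : (k <= n.+1)%N -> (w ^+ 2) ^+ k <= (1 + w ^+ 2) ^+ n.+1.
  move=> kn; apply: (@le_trans _ _ ((1 + w ^+ 2) ^+ k)).
    by rewrite lerXn2r ?nnegrE ?sqr_ge0 ?(le_trans ler01) // lerDr.
  exact: ler_weXn2l.
have Tn : T <= n.+1%:R * (1 + w ^+ 2) ^+ n.+1.
  rewrite mulr_natl -[X in _ *+ X]card_ord -sumr_const; apply: ler_sum => k _.
  by apply: pw; apply: ltnW.
have := pw 1%N isT; rewrite expr1.
move: GC; rewrite -[in X in X -> _](addn1 n.+1) natrD mulrDl mul1r => GC w1.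
have : th * T <= T by rewrite ler_piMl.
have := sqr_ge0 Om0.
lra.
Qed.

(* The quadratic form [Q] is an integrated version of Bernstein's inequality
   [|(c z)'| <= Om0 |c z|] for the free motion, whose spectrum lies in
   [-omega_max, omega_max] up to decaying modes. *)
Lemma bernstein_form n (A : 'M[R]_n.+1) (Om0 : R) :
  eig_closed_lhp A -> omega_max A < Om0 ->
  exists th k, [/\ 0 < th, 0 <= k & forall m (c : 'M[R]_(m, n.+1)),
    exists2 Q : 'M[R]_n.+1,
      forall z, dotv (A *m z) (Q *m z) + dotv z (Q *m (A *m z)) <=
        Om0 ^+ 2 * sqn (c *m z) - sqn (c *m (A *m z)) - th * krylov A c z &
      forall z y, `|dotv z (Q *m y)| <= k * (krylov A c z + krylov A c y)].
Proof.
move=> Acl Omlt; have [th [C [th0 [h hE]]]] := frequency_inequality Acl Omlt.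
pose F f m (c : 'M[R]_(m, n.+1)) := (horner_mx A f)^T *m c^T *m c *m horner_mx A f
  - c^T *m c *m horner_mx A ((f \Po (- 'X)) * f).
have FL f : lyap_image A (F f) by exact: form_shift.
have FE f m c : F f m c = (horner_mx A f)^T *m c^T *m c *m horner_mx A f
  - c^T *m c *m horner_mx A ((f \Po (- 'X)) * f) by [].
clearbody F.
(* The combination mirrors the frequency identity: the polynomial parts of the four contributions
   combine into [Om0 ^+ 2 * sqn (c *m z)], the square belonging to [char_poly A] vanishes by
   Cayley-Hamilton, and the square belonging to [h] has the sign that lets it be dropped. *)
have [k k0 H] : lyap_image A (fun m c => - 1 *: (F h m c + (- C *: F (char_poly A) m c
    + (F 'X m c + th *: \sum_(i < n.+1) F ('X^i) m c)))).
  apply: lyap_imageZ; apply: lyap_imageD => //; apply: lyap_imageD.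
    exact: lyap_imageZ.
  apply: lyap_imageD => //; apply: lyap_imageZ; exact: lyap_image_sum.
exists th, k; split=> // m c; have [Q QE Qb] := H m c; exists Q => // z.
have -> : dotv (A *m z) (Q *m z) + dotv z (Q *m (A *m z)) =
    dotv z ((A^T *m Q + Q *m A) *m z).
  by rewrite mulmxDl dotvDr dotvMl -!mulmxA.
rewrite -QE.
pose Psi (f : {poly R}) := dotv z (c^T *m c *m horner_mx A f *m z).
have Fz (f : {poly R}) : dotv z (F f m c *m z) =
    sqn (c *m horner_mx A f *m z) - Psi (f * (f \Po (- 'X))).
  rewrite FE mulmxBl dotvDr dotvNr [f * _]mulrC; congr (_ - _).
  by rewrite /sqn dotvMl trmx_mul !mulmxA.
have PsiD f g : Psi (f + g) = Psi f + Psi g.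
  by rewrite /Psi rmorphD /= mulmxDr mulmxDl dotvDr.
have PsiZ a f : Psi (a *: f) = a * Psi f.
  by rewrite /Psi linearZ /= -scalemxAr -scalemxAl dotvZr.
have Psi0 : Psi 0 = 0 by rewrite -(scale0r 0) PsiZ mul0r.
have PsiN f : Psi (- f) = - Psi f by rewrite -scaleN1r PsiZ mulN1r.
have Psi_sum (f : 'I_n.+1 -> {poly R}) : Psi (\sum_i f i) = \sum_i Psi (f i).
  exact: (big_morph Psi PsiD Psi0).
have := congr1 Psi hE.
rewrite !(PsiD, PsiN, PsiZ, Psi_sum) => PE.
have PC : Psi (Om0 ^+ 2)%:P = Om0 ^+ 2 * sqn (c *m z).
  by rewrite /Psi horner_mx_C mul_mx_scalar -scalemxAl dotvZr /sqn dotvMl mulmxA.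
have PX : Psi ('X * ('X \Po (- 'X))) = - Psi 'X^2.
  by rewrite comp_polyX mulrN -expr2 PsiN.
have KE : \sum_(i < n.+1) dotv z (F 'X^i m c *m z) =
    krylov A c z - \sum_(i < n.+1) Psi ('X^i * ('X^i \Po (- 'X))).
  rewrite /krylov -sumrB; apply: eq_bigr => i _.
  by rewrite Fz rmorphXn /= horner_mx_X.
rewrite -scalemxAl dotvZr !mulmxDl !dotvDr -!scalemxAl !dotvZr mulmx_suml dotv_sumr.
rewrite KE !Fz Cayley_Hamilton horner_mx_X mulmx0 mul0mx PX !mulmxA {1}/sqn.
have := sqn_ge0 (c *m horner_mx A h *m z).
rewrite [X in - C * (X - _)](_ : _ = 0) ?/sqn ?dotv0l // -!/(sqn _).
move: PE; rewrite PC; lra.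
Qed.

End Bernstein.

(** * Low-gain Riccati equation *)

Section Riccati.
Variables (R : realType) (n m : nat) (A : 'M[R]_n) (B : 'M[R]_(n, m)).

Definition riccati (eps : R) (P : 'M[R]_n) :=
  posdef P /\ A^T *m P + P *m A - P *m B *m B^T *m P + eps%:M = 0.

Lemma posdef_sym (P : 'M[R]_n) : posdef P -> P^T = P.
Proof. by case. Qed.

Lemma posdef_ge0 (P : 'M[R]_n) : posdef P -> forall z, 0 <= dotv z (P *m z).
Proof.
move=> [_ Pp] z; have [->|z0] := eqVneq z 0; first by rewrite dotv0l.
by rewrite /dotv mulmxA ltW // Pp.
Qed.

Lemma posdef_unitmx (P : 'M[R]_n) : posdef P -> P \in unitmx.
Proof.
move=> Ppd; have [Ps Pp] := Ppd.
rewrite -row_free_unit -kermx_eq0; apply/eqP/row_matrixP => i; rewrite row0.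
apply: contraTeq isT => /eqP ri0; apply/negP => _.
have := Pp (row i (kermx P))^T; rewrite trmx_eq0 => /(_ (introN eqP ri0)).
rewrite trmxK -row_mul mulmx_ker row0 mul0mx mxE ltxx //.
Qed.

Lemma trace_ge0 (P : 'M[R]_n) : (forall z, 0 <= dotv z (P *m z)) -> 0 <= \tr P.
Proof.
move=> Pp; apply: sumr_ge0 => i _; have := Pp (delta_mx i 0).
by rewrite /dotv trmx_delta -colE -rowE !mxE.
Qed.

Lemma sqn_psd_le (P : 'M[R]_n) z : P^T = P -> (forall z, 0 <= dotv z (P *m z)) ->
  sqn (P *m z) <= \tr P * dotv z (P *m z).
Proof.
move=> Ps Pp; rewrite sqnE /mxtrace mulr_suml; apply: ler_sum => i _.
have := psd_CS (delta_mx i 0) z Ps Pp.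
by rewrite /dotv trmx_delta -!colE -!rowE !mxE.
Qed.

Lemma psd_le_trace (P : 'M[R]_n) z : P^T = P -> (forall z, 0 <= dotv z (P *m z)) ->
  dotv z (P *m z) <= \tr P * sqn z.
Proof.
move=> Ps Pp; have := Pp z; rewrite le_eqVlt => /orP[/eqP<-|V0].
  by rewrite mulr_ge0 ?sqn_ge0 ?trace_ge0.
rewrite -(ler_pM2r V0) -expr2.
apply: le_trans (dotv_CS _ _) _.
by rewrite mulrC -mulrA [sqn z * _]mulrC mulrA ler_wpM2r ?sqn_ge0 // sqn_psd_le.
Qed.

Lemma riccati_form eps P z y : riccati eps P ->
  dotv z (P *m (A *m y)) = - dotv (A *m z) (P *m y)
    + dotv (B^T *m P *m z) (B^T *m P *m y) - eps * dotv z y.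
Proof.
move=> [Ppd E]; have Ps := posdef_sym Ppd.
have := congr1 (fun M => dotv z (M *m y)) E.
rewrite !mulmxDl mulNmx !dotvDr dotvNr mul0mx dotv0r mul_scalar_mx dotvZr.
rewrite (dotvMl A z) (dotvMl (B^T *m P)) trmx_mul trmxK Ps !mulmxA; lra.
Qed.

(* Computed from [(P^-1) A^T + A P^-1 - B B^T + eps P^-2 = 0]. *)
Lemma riccati_lower_bound : exists2 k, 0 < k & forall eps P,
  0 < eps -> eps <= 1 -> riccati eps P -> forall z, eps * sqn z <= k * dotv z (P *m z).
Proof.
pose a := frob A; pose b := frob B.
have a0 : 0 <= a := frob_ge0 A; have b0 : 0 <= b := frob_ge0 B.
exists (1 + 2 * b + 4 * a); first lra.
move=> eps P e0 e1 [Ppd E].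
have Pu := posdef_unitmx Ppd; have Ps := posdef_sym Ppd; have Pp := posdef_ge0 Ppd.
pose Y := invmx P.
have Ys : Y^T = Y by rewrite /Y trmx_inv Ps.
have YP : Y *m P = 1%:M by rewrite mulVmx.
have PY : P *m Y = 1%:M by rewrite mulmxV.
have EY : Y *m A^T + A *m Y - B *m B^T + eps *: (Y *m Y) = 0.
  have := congr1 (fun M => Y *m M *m Y) E.
  rewrite mulmx0 mul0mx !(mulmxDr, mulmxDl, mulmxN, mulNmx) => <-.
  rewrite mul_mx_scalar -scalemxAl; congr (_ + _ - _ + _).
  - by rewrite -!mulmxA PY mulmx1.
  - by rewrite !mulmxA YP mul1mx.
  - by rewrite -!mulmxA PY mulmx1 !mulmxA YP mul1mx.
pose y := frob Y.
have y0 : 0 <= y := frob_ge0 Y.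
(* Trace of [EY], with [2 \tr (A Y)] split by Young's inequality at weight [eps / 2] so that half of
   [eps * y] can be absorbed on the left. *)
have trY : eps * y <= b + (2 / eps * a + eps / 2 * y).
  have := congr1 mxtrace EY; rewrite !linearD linearN linearZ /= linear0.
  rewrite -{3}Ys trace_mul_tr -[B *m B^T]trmxK trmx_mul trmxK.
  have -> : \tr (B *m B^T)^T = b.
    by rewrite mxtrace_tr -mxtrace_mulC trace_mul_tr.
  rewrite -(mxtrace_tr (Y *m A^T)) trmx_mul trmxK Ys -/y => H.
  suff : - (2 * \tr (A *m Y)) <= 2 / eps * a + eps / 2 * y by lra.
  rewrite -mulrN -raddfN /mxtrace /a /y /frob !mulr_sumr -big_split /=.
  apply: ler_sum => i _; rewrite !mxE -sumrN !mulr_sumr -big_split /=.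
  apply: ler_sum => j _.
  have -> : Y j i = Y i j by rewrite -[in LHS]Ys mxE.
  have h0 : 0 < eps / 2 by rewrite divr_gt0.
  have -> : 2 / eps = (eps / 2)^-1 by rewrite invf_div.
  have := sqr_ge0 (A i j + eps / 2 * Y i j).
  rewrite -(ler_pM2l h0) mulrDr (mulrA (eps / 2) (eps / 2)^-1) mulfV ?gt_eqF //.
  lra.
have yb : eps ^+ 2 * y <= 2 * b + 4 * a.
  have := ler_wpM2l (ltW e0) trY.
  have -> : eps * (b + (2 / eps * a + eps / 2 * y)) = eps * b + 2 * a + eps ^+ 2 * y / 2.
    by field; rewrite gt_eqF.
  have := ler_wpM2r b0 e1.
  have -> : eps * (eps * y) = eps ^+ 2 * y by ring.
  lra.
move=> z; set V := dotv z (P *m z); have V0 : 0 <= V := Pp z.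
set x := sqn z; have x0 : 0 <= x := sqn_ge0 z.
have k0 : 0 <= 1 + 2 * b + 4 * a by lra.
have [xz|xn] := eqVneq x 0; first by rewrite xz mulr0 mulr_ge0.
have x2 : 0 < x ^+ 2 by rewrite exprn_gt0 // lt_neqAle eq_sym xn.
(* As [z = P Y z], Cauchy-Schwarz for [P] gives [|z|^4 <= w V], and the Euclidean one bounds [w];
   together [|z|^4 <= y V^2]. *)
set w := dotv (Y *m z) z.
have h1 : x ^+ 2 <= w * V.
  have := psd_CS (Y *m z) z Ps Pp.
  by rewrite mulmxA PY mul1mx dotvMl mulmxA Ys YP mul1mx.
have h2 : w ^+ 2 <= y * x ^+ 2.
  apply: le_trans (dotv_CS _ _) _; rewrite expr2 mulrA ler_wpM2r // sqn_mul_le //.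
have h3 : x ^+ 2 <= y * V ^+ 2.
  rewrite -(ler_pM2r x2); apply: (@le_trans _ _ ((w * V) ^+ 2)).
    rewrite -expr2 lerXn2r ?nnegrE //; first exact: ltW.
    exact: le_trans (ltW x2) h1.
  by rewrite exprMn [leRHS]mulrAC ler_wpM2r ?sqr_ge0.
suff : (eps * x) ^+ 2 <= ((1 + 2 * b + 4 * a) * V) ^+ 2.
  by rewrite ler_sqr // nnegrE mulr_ge0 // ltW.
rewrite !exprMn.
apply: (@le_trans _ _ (eps ^+ 2 * (y * V ^+ 2))); first by rewrite ler_wpM2l ?sqr_ge0.
rewrite mulrA ler_wpM2r ?sqr_ge0 // (le_trans yb) //.
nra.
Qed.

(* One power of [A] is moved across [P] by the Riccati equation. *)
Lemma riccati_moment i : exists2 k, 0 <= k & forall eps P mu z,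
  0 < eps -> eps <= 1 -> \tr P <= 1 -> riccati eps P ->
  dotv mu (P *m (A ^+ i *m z)) ^+ 2 <= k * (\tr P + eps) * sqn mu * dotv z (P *m z).
Proof.
have [k0 k00 H0] := riccati_lower_bound.
elim: i => [|i [k kp IH]].
  exists 1 => // eps P mu z e0 e1 t1 [Ppd _].
  have Ps := posdef_sym Ppd; have Pp := posdef_ge0 Ppd.
  rewrite expr0 mul1mx mul1r; apply: le_trans (psd_CS mu z Ps Pp) _.
  rewrite ler_wpM2r // (le_trans (psd_le_trace mu Ps Pp)) // ler_wpM2r ?sqn_ge0 //.
  by rewrite lerDl ltW.
pose c1 := 2 * frob (B *m B^T) + 2 * frob A.
have c10 : 0 <= c1 by rewrite addr_ge0 // mulr_ge0 // frob_ge0.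
exists (2 * k * c1 + 2 * (frob (A ^+ i) * k0)).
  by rewrite addr_ge0 ?mulr_ge0 ?frob_ge0 // ltW.
move=> eps P mu z e0 e1 t1 Ric; have [Ppd _] := Ric.
have Ps := posdef_sym Ppd; have Pp := posdef_ge0 Ppd.
have t0 := trace_ge0 Pp.
set V := dotv z (P *m z); have V0 : 0 <= V := Pp z.
set T := \tr P + eps; have T0 : 0 <= T by rewrite addr_ge0 // ltW.
set y := A ^+ i *m z; pose nu := B *m B^T *m (P *m mu) - A *m mu.
have E : dotv mu (P *m (A ^+ i.+1 *m z)) = dotv nu (P *m y) - eps * dotv mu y.
  rewrite exprS -mulmxE -mulmxA -/y (riccati_form _ _ Ric).
  rewrite /nu dotvDl dotvNl [_ + dotv (B^T *m _ *m _) _]addrC.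
  by rewrite -!mulmxA [dotv (B *m _) _]dotvMl.
have nb : sqn nu <= c1 * sqn mu.
  apply: le_trans (sqnD_le _ _) _; rewrite sqnN /c1 [leRHS]mulrDl; apply: lerD.
    rewrite -mulrA ler_wpM2l // (le_trans (sqn_mul_le _ _)) // ler_wpM2l ?frob_ge0 //.
    apply: le_trans (sqn_psd_le _ Ps Pp) _.
    rewrite -[leRHS]mul1r ler_pM //.
    by apply: le_trans (psd_le_trace _ Ps Pp) _; rewrite ler_piMl ?sqn_ge0.
  by rewrite -mulrA ler_wpM2l // sqn_mul_le.
have h1 : dotv nu (P *m y) ^+ 2 <= k * T * (c1 * sqn mu) * V.
  apply: le_trans (IH eps P nu z e0 e1 t1 Ric) _.
  by rewrite ler_wpM2r // ler_wpM2l // mulr_ge0.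
(* One factor [eps] is bounded by [T]; the other converts [sqn z] into [V] through
   [riccati_lower_bound]. *)
have h2 : (eps * dotv mu y) ^+ 2 <= T * sqn mu * (frob (A ^+ i) * (k0 * V)).
  rewrite exprMn expr2 -mulrA.
  apply: (@le_trans _ _ (eps * (sqn mu * (frob (A ^+ i) * (eps * sqn z))))).
    rewrite ler_wpM2l ?(ltW e0) //.
    have -> : sqn mu * (frob (A ^+ i) * (eps * sqn z)) =
              eps * (sqn mu * (frob (A ^+ i) * sqn z)) by ring.
    rewrite ler_wpM2l ?(ltW e0) // (le_trans (dotv_CS _ _)) // ler_wpM2l ?sqn_ge0 //.
    exact: sqn_mul_le.
  rewrite -mulrA ler_pM ?(ltW e0) ?mulr_ge0 ?sqn_ge0 ?frob_ge0 ?(ltW e0) //.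
    by rewrite /T lerDr.
  by rewrite ler_wpM2l ?sqn_ge0 // ler_wpM2l ?frob_ge0 // H0.
rewrite E; have := sqr_ge0 (dotv nu (P *m y) + eps * dotv mu y).
move: h1 h2; set u := dotv nu _; set w := eps * _ => h1 h2 h3.
apply: (@le_trans _ _ (2 * u ^+ 2 + 2 * w ^+ 2)); first by lra.
have -> : (2 * k * c1 + 2 * (frob (A ^+ i) * k0)) * T * sqn mu * V =
  2 * (k * T * (c1 * sqn mu) * V) + 2 * (T * sqn mu * (frob (A ^+ i) * (k0 * V))) by ring.
by rewrite lerD // ler_wpM2l.
Qed.

(** An ultrafilter makes every bounded sequence converge, so all matrix entries have limits at once,
    without extracting subsequences. *)
Lemma ultra_limit (u : nat -> R) (U : set_system nat) : UltraFilter U ->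
  (forall k, `|u k| <= 1) -> exists l : R, (u @ U --> l)%classic.
Proof.
move=> UU ub.
have Uu : (u @ U)%classic `[-1, 1]%classic.
  have h k : `[-1, 1]%classic (u k) by rewrite /= in_itv /= -ler_norml.
  exact: (@filterE _ U _ (u @^-1` `[-1, 1])%classic h).
have [l [_ cl]] := segment_compact (fmap_proper_filter u _) Uu.
exists l => N lN; have [//|UN] := in_ultra_setVsetC (u @^-1` N)%classic UU.
by have [x []] := cl (~` N)%classic N UN lN.
Qed.

Lemma cvg_dotv (U : set_system nat) (Q : nat -> 'M[R]_n) (Q0 : 'M[R]_n) x y :
  ProperFilter U -> (forall i j, ((fun k => Q k i j) @ U --> Q0 i j)%classic) ->
  ((fun k => dotv x (Q k *m y)) @ U --> dotv x (Q0 *m y))%classic.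
Proof.
move=> UU QQ.
have E M : dotv x (M *m y) = \sum_i \sum_j x i 0 * (M i j * y j 0).
  by rewrite dotvE; apply: eq_bigr => i _; rewrite mxE mulr_sumr.
under eq_fun do rewrite E; rewrite E.
apply: cvg_big => [|i _]; first by move=> ?; exact: add_continuous.
apply: cvg_big => [|j _]; first by move=> ?; exact: add_continuous.
by apply: cvgMr; apply: cvgMl; exact: QQ.
Qed.

End Riccati.

(** * Vanishing of the Riccati solution in the low-gain limit *)

Section RiccatiLimit.
Variables (R : realType) (n m : nat) (A : 'M[R]_n) (B : 'M[R]_(n, m)).

Lemma cmxE k l (M : 'M[R]_(k, l)) : cmx M = map_mx (real_complex R) M.
Proof. by []. Qed.

Lemma mul_delta_entry k l (M : 'M[R]_(k, l)) i j :
  (M *m (delta_mx j 0 : 'cV[R]_l)) i 0 = M i j.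
Proof. by rewrite -colE mxE. Qed.

Lemma left_eigenvalue_of (M : 'M[R]_n) (p : 'rV[R[i]]_n) l :
  p *m cmx M = l *: p -> p != 0 -> eigenvalue_of M l.
Proof.
move=> pM p0; apply/eigenvalue_of_root; rewrite -eigenvalue_root_char.
by apply/eigenvalueP; exists p.
Qed.

(* A nonzero positive semidefinite [Q] whose kernel is [A]-invariant has a
   left eigenvector [xi Q] of [A]; testing [A^T Q + Q A] on [xi] locates the
   eigenvalue on the imaginary axis. *)
Lemma psd_lyapunov_eq0 (Q : 'M[R]_n) (d : R) : 0 < d ->
  stabilizable A B -> eig_closed_lhp A -> Q^T = Q ->
  (forall z, 0 <= dotv z (Q *m z)) ->
  (forall z, d * sqn (B^T *m Q *m z) <= 2 * dotv z (Q *m (A *m z))) -> Q = 0.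
Proof.
move=> d0 [F hF] Acl Qs Qp QB; apply/eqP/negPn/negP => Q0.
pose M := A^T *m Q + Q *m A.
have Ms : M^T = M by rewrite linearD /= !trmx_mul trmxK Qs addrC.
have ME z : dotv z (M *m z) = 2 * dotv z (Q *m (A *m z)).
  rewrite mulmxDl dotvDr -!mulmxA (dotvMr A^T) trmxK (dotvC (A *m z)) dotvMl Qs.
  by rewrite mulr_natl mulr2n.
have Mp z : 0 <= dotv z (M *m z).
  by rewrite ME (le_trans _ (QB z)) // mulr_ge0 ?sqn_ge0 // ltW.
have ker (z : 'cV[R]_n) : Q *m z = 0 -> Q *m (A *m z) = 0.
  move=> Qz; have : M *m z = 0.
    by apply: psd_ker => //; rewrite ME dotvMr Qs Qz dotv0l mulr0.
  by rewrite mulmxDl -!mulmxA Qz mulmx0 add0r.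
(* Invariance of the kernel dualizes to invariance of the row space. [A] then acts on the full-rank
   basis [R0] through [D], and an eigenvector of [D] lifts to a left eigenvector of [A]. *)
have st : (Q *m A <= Q)%MS.
  rewrite submxE; apply/eqP/matrixP => i j.
  have : Q *m (A *m (cokermx Q *m (delta_mx j 0 : 'cV[R]_n))) = 0.
    by apply: ker; rewrite mulmxA mulmx_coker mul0mx.
  by rewrite 2!mulmxA => h; rewrite -[LHS]mul_delta_entry h !mxE.
pose R0 := row_base Q.
have RA : (R0 *m A <= R0)%MS.
  by rewrite (eqmxMr _ (eq_row_base Q)) (submx_trans st) ?eq_row_base.
pose D := R0 *m A *m pinvmx R0.
have DE : D *m R0 = R0 *m A by rewrite mulmxKpV.
have [G GE] : exists G, R0 = G *m Q by apply/submxP; rewrite eq_row_base.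
have [|l rl] := closed_rootP (char_poly (cmx D)) _.
  by rewrite size_char_poly eqSS mxrank_eq0.
move: rl; rewrite -eigenvalue_root_char => /eigenvalueP[v vD v0].
pose xi := v *m cmx G; pose p := xi *m cmx Q.
have pE : p = v *m cmx R0 by rewrite /p /xi -mulmxA !cmxE -map_mxM -GE.
have p0 : p != 0.
  by rewrite pE mul_mx_rowfree_eq0 // cmxE /row_free mxrank_map; exact: row_base_free.
have pA : p *m cmx A = l *: p.
  rewrite pE -mulmxA !cmxE -map_mxM -DE map_mxM mulmxA -!cmxE vD.
  by rewrite -scalemxAl.
pose a := \col_i complex.Re (xi 0 i); pose b := \col_i complex.Im (xi 0 i).
have ReS k (f : 'I_k -> R[i]) : complex.Re (\sum_i f i) = \sum_i complex.Re (f i).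
  by apply: (big_morph (@complex.Re R)) => // -[? ?] [? ?].
have ImS k (f : 'I_k -> R[i]) : complex.Im (\sum_i f i) = \sum_i complex.Im (f i).
  by apply: (big_morph (@complex.Im R)) => // -[? ?] [? ?].
have mulE k (x : 'rV[R[i]]_n) (N : 'M[R]_(n, k)) (y z : 'cV[R]_n) :
    (forall i, x 0 i = Complex (y i 0) (z i 0)) ->
    forall j, (x *m cmx N) 0 j = Complex ((N^T *m y) j 0) ((N^T *m z) j 0).
  move=> xE j; apply/eqP; rewrite eq_complex /= !mxE ReS ImS; apply/andP.
  split; apply/eqP; apply: eq_bigr => i _; rewrite xE !mxE /= mulr0 ?subr0 ?add0r;
  by rewrite mulrC.
have xiE i : xi 0 i = Complex (a i 0) (b i 0) by rewrite [a i 0]mxE [b i 0]mxE; case: (xi 0 i).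
have pQ i : p 0 i = Complex ((Q *m a) i 0) ((Q *m b) i 0).
  by rewrite /p (mulE _ _ _ _ _ xiE) Qs.
set s := complex.Re l; set w := complex.Im l.
have lE : l = Complex s w by rewrite /s /w; case: (l).
have Aa : A^T *m (Q *m a) = s *: (Q *m a) - w *: (Q *m b).
  apply/matrixP => i j; rewrite ord1.
  have := congr1 (fun x : 'rV_n => complex.Re (x 0 i)) pA.
  rewrite (mulE _ _ _ _ _ pQ) /= mxE [in RHS]mxE pQ lE /= => ->.
  by move: (Q *m a) (Q *m b) => x y; rewrite !mxE.
have Ab : A^T *m (Q *m b) = s *: (Q *m b) + w *: (Q *m a).
  apply/matrixP => i j; rewrite ord1.
  have := congr1 (fun x : 'rV_n => complex.Im (x 0 i)) pA.
  rewrite (mulE _ _ _ _ _ pQ) /= mxE [in RHS]mxE pQ lE /= => ->.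
  by move: (Q *m a) (Q *m b) => x y; rewrite !mxE.
have formA z : dotv z (Q *m (A *m z)) = dotv z (A^T *m (Q *m z)).
  by rewrite dotvMr Qs dotvMr dotvC.
have sym : dotv b (Q *m a) = dotv a (Q *m b) by rewrite dotvMr Qs dotvC.
(* Adding the tests on real and imaginary parts cancels [w] and leaves [s * S]. It is nonpositive by
   the spectrum of [A] and nonnegative by [QB], so both [B] terms vanish; [p] is then a left
   eigenvector of [A + B F] as well, for the same eigenvalue, which forces [s < 0]. *)
set S := dotv a (Q *m a) + dotv b (Q *m b).
have SE : 2 * dotv a (Q *m (A *m a)) + 2 * dotv b (Q *m (A *m b)) = 2 * (s * S).
  rewrite !formA Aa Ab !dotvDr dotvNr !dotvZr sym /S; ring.
have S0 : 0 < S.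
  rewrite lt_neqAle addr_ge0 ?Qp // andbT eq_sym; apply: contraNneq p0 => S0.
  have a0 : dotv a (Q *m a) = 0 by have := Qp a; have := Qp b; rewrite -/S in S0; move: S0; rewrite /S; lra.
  have b0 : dotv b (Q *m b) = 0 by have := Qp a; have := Qp b; rewrite -/S in S0; move: S0; rewrite /S; lra.
  apply/eqP/rowP => i; rewrite pQ (psd_ker Qs Qp a0) (psd_ker Qs Qp b0) !mxE.
  by [].
have s0 : s <= 0 by apply: Acl; apply: left_eigenvalue_of pA p0.
have := QB a; have := QB b.
have na := sqn_ge0 (B^T *m Q *m a); have nb := sqn_ge0 (B^T *m Q *m b).
move=> hb ha.
have sS : s * S <= 0 by rewrite mulr_le0_ge0 // ltW.
have da : 0 <= d * sqn (B^T *m Q *m a) by rewrite mulr_ge0 // ltW.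
have db : 0 <= d * sqn (B^T *m Q *m b) by rewrite mulr_ge0 // ltW.
have Ba : B^T *m Q *m a = 0.
  apply/eqP; rewrite -sqn_eq0; have : d * sqn (B^T *m Q *m a) = 0 by lra.
  by move/eqP; rewrite mulf_eq0 gt_eqF.
have Bb : B^T *m Q *m b = 0.
  apply/eqP; rewrite -sqn_eq0; have : d * sqn (B^T *m Q *m b) = 0 by lra.
  by move/eqP; rewrite mulf_eq0 gt_eqF.
have pB : p *m cmx B = 0.
  by apply/rowP => j; rewrite (mulE _ _ _ _ _ pQ) !mulmxA Ba Bb !mxE.
have : s < 0.
  apply: hF; apply: left_eigenvalue_of p0.
  by rewrite cmxE map_mxD map_mxM mulmxDr mulmxA -!cmxE pB mul0mx addr0.
have : 0 <= s by rewrite -(pmulr_lge0 _ S0); lra.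
lra.
Qed.

(** If traces [t] stayed above [d] along [eps -> 0], the Riccati form divided by [t] would carry the
    quadratic term of [P / t] with weight [t > d] and a constant term [eps / t] tending to 0. The
    limit satisfies the hypothesis of [psd_lyapunov_eq0] yet has trace 1. *)
Lemma riccati_trace_small (d : R) : stabilizable A B -> eig_closed_lhp A -> 0 < d ->
  exists2 e, 0 < e & forall eps P, 0 < eps -> eps <= e -> riccati A B eps P -> \tr P <= d.
Proof.
move=> st Acl d0; apply: contrapT => H.
have {}H (k : nat) : exists eP : R * 'M[R]_n,
    [/\ 0 < eP.1, eP.1 <= k.+1%:R^-1, riccati A B eP.1 eP.2 & d < \tr eP.2].
  apply: contrapT => Hk; apply: H; exists k.+1%:R^-1 => // eps P e0 ek Ric.
  by rewrite leNgt; apply/negP => dP; apply: Hk; exists (eps, P).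
have [eP ePH] := choice H.
pose t k := \tr (eP k).2; pose Q k := (t k)^-1 *: (eP k).2.
have t0 k : 0 < t k by have [_ _ _ h] := ePH k; apply: lt_trans h.
have Psym k : (eP k).2^T = (eP k).2 by have [_ _ [/posdef_sym]] := ePH k.
have Ppos k z : 0 <= dotv z ((eP k).2 *m z) by have [_ _ [/posdef_ge0]] := ePH k.
have Qs k : (Q k)^T = Q k by rewrite linearZ /= Psym.
have Qp k z : 0 <= dotv z (Q k *m z).
  by rewrite -scalemxAl dotvZr mulr_ge0 // invr_ge0 ltW.
have Qtr k : \tr (Q k) = 1 by rewrite linearZ /= mulVf // gt_eqF.
have Qb k i j : `|Q k i j| <= 1.
  rewrite -(ler_pXn2r (isT : (0 < 2)%N)) ?nnegrE // expr1n real_normK ?num_real // -mul_delta_entry.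
  apply: le_trans (entry_sqr_le_sqn _ _) _.
  apply: le_trans (sqn_psd_le _ (Qs k) (Qp k)) _; rewrite Qtr mul1r.
  apply: le_trans (psd_le_trace _ (Qs k) (Qp k)) _; rewrite Qtr mul1r.
  by rewrite /sqn /dotv trmx_delta mul_delta_mx mxE !eqxx.
have [U [UU oU]] := ultraFilterLemma (@eventually_filter).
have [Q0 QQ] : exists Q0 : 'M[R]_n, forall i j, ((fun k => Q k i j) @ U --> Q0 i j)%classic.
  have h i j := ultra_limit UU (fun k => Qb k i j).
  exists (\matrix_(i, j) projT1 (cid (h i j))) => i j.
  by rewrite mxE; case: cid.
have cv x y : ((fun k => dotv x (Q k *m y)) @ U --> dotv x (Q0 *m y))%classic.
  exact: cvg_dotv.
have Q0s : Q0^T = Q0.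
  apply/matrixP => i j; rewrite mxE; apply: (cvg_unique (@Rhausdorff R) (QQ j i)).
  have -> : (fun k => Q k j i) = (fun k => Q k i j); last exact: QQ.
  by apply/funext => k; rewrite -[in LHS]Qs mxE.
have Q0p z : 0 <= dotv z (Q0 *m z).
  by apply: (cvgr_to_ge (cv z z)); apply: filterE => k; exact: Qp.
have trE (N : 'M[R]_n) : \tr N = \sum_i dotv (delta_mx i 0) (N *m delta_mx i 0).
  by apply: eq_bigr => i _; rewrite /dotv trmx_delta -colE -rowE !mxE.
have Q0tr : \tr Q0 = 1.
  have c0 : ((fun k => \tr (Q k)) @ U --> \tr Q0)%classic.
    rewrite trE; under eq_fun do rewrite trE.
    by apply: cvg_big => [|i _]; [exact: add_continuous|exact: cv].
  apply: (cvg_unique (@Rhausdorff R) c0).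
  have -> : (fun k => \tr (Q k)) = (fun=> 1) by apply/funext => k; rewrite Qtr.
  exact: cvg_cst.
have : Q0 = 0; last first.
  by move=> Q00; move: Q0tr; rewrite Q00 mxtrace0 => /eqP; rewrite eq_sym oner_eq0.
apply: (psd_lyapunov_eq0 d0 st Acl Q0s Q0p) => z.
have sqE (N : 'M[R]_n) : sqn (B^T *m N *m z) = \sum_j dotv (col j B) (N *m z) ^+ 2.
  rewrite sqnE -mulmxA; apply: eq_bigr => j _; congr (_ ^+ 2).
  by move: (N *m z) => y; rewrite dotvE mxE; apply: eq_bigr => i _; rewrite !mxE.
have ch : ((fun k : nat => (d * k.+1%:R)^-1) @ \oo --> (0 : R))%classic.
  rewrite (_ : (fun k => _) = (fun k : nat => d^-1 * k.+1%:R^-1)); last first.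
    by apply/funext => k; rewrite invfM.
  by rewrite -(mulr0 d^-1); apply: cvgMl_tmp; exact: cvg_harmonic.
have c1 : ((fun k => 2 * dotv z (Q k *m (A *m z)) + (d * k.+1%:R)^-1 * sqn z
             - d * sqn (B^T *m Q k *m z)) @ U -->
           2 * dotv z (Q0 *m (A *m z)) + 0 * sqn z - d * sqn (B^T *m Q0 *m z))%classic.
  apply: cvgB; first apply: cvgD.
  - by apply: cvgMl_tmp; exact: cv.
  - by apply: cvgMr_tmp => N NN; apply: oU; exact: ch NN.
  apply: cvgMl_tmp; rewrite sqE; under eq_fun do rewrite sqE.
  apply: cvg_big => [|j _]; first exact: add_continuous.
  by under eq_fun do rewrite expr2; rewrite expr2; apply: cvgM; exact: cv.
have : 0 <= 2 * dotv z (Q0 *m (A *m z)) + 0 * sqn z - d * sqn (B^T *m Q0 *m z).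
  apply: (cvgr_to_ge c1); apply: filterE => k /=.
  have [e0 ek Ric dt] := ePH k.
  have := riccati_form z z Ric; rewrite (dotvC (A *m z)) dotvMl Psym -/(sqn _) -/(sqn z).
  set f := dotv z _; set g := sqn _ => fg.
  have -> : dotv z (Q k *m (A *m z)) = (t k)^-1 * f by rewrite -scalemxAl dotvZr.
  have -> : sqn (B^T *m Q k *m z) = (t k)^-2 * g.
    by rewrite -scalemxAr -scalemxAl sqnZ exprVn.
  have ti : (t k)^-1 * t k = 1 by rewrite mulVf // gt_eqF.
  have tp : 0 < (t k)^-1 by rewrite invr_gt0.
  have g0 : 0 <= g by exact: sqn_ge0.
  have z0 := sqn_ge0 z.
  have f2 : 2 * ((t k)^-1 * f) = (t k)^-1 * g - (t k)^-1 * (eP k).1 * sqn z.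
    have : 2 * f = g - (eP k).1 * sqn z by lra.
    move=> h; rewrite mulrCA h; ring.
  rewrite f2.
  have h1 : d * ((t k) ^- 2 * g) <= (t k)^-1 * g.
    rewrite mulrA ler_wpM2r // expr2 invfM mulrA -[leRHS]mul1r ler_wpM2r ?(ltW tp) //.
    by rewrite ler_pdivrMr // mul1r ltW.
  have h2 : (t k)^-1 * (eP k).1 * sqn z <= (d * k.+1%:R)^-1 * sqn z.
    rewrite ler_wpM2r // invfM ler_pM ?(ltW tp) ?(ltW e0) //.
    by rewrite lef_pV2 ?posrE // ltW.
  have aux (x1 x2 x3 x4 : R) : x1 <= x4 -> x2 <= x3 -> 0 <= x4 - x2 + x3 - x1 by lra.
  exact: aux h1 h2.
lra.
Qed.

End RiccatiLimit.

(** The source of all smallness in the delay analysis: both estimates carry the factor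
    [\tr P + eps]. Each entry of [B^T P A^j z] pairs a column of [B] with [P A^j z], which is the
    quantity bounded by [riccati_moment]. *)
Lemma riccati_krylov_small (R : realType) n m (A : 'M[R]_n.+1) (B : 'M[R]_(n.+1, m)) (d : R) :
  stabilizable A B -> eig_closed_lhp A -> 0 < d ->
  exists2 e, 0 < e & forall eps P, 0 < eps -> eps <= e -> riccati A B eps P ->
    (forall z, krylov A (B^T *m P) z <= d * dotv z (P *m z)) /\
    (forall u, krylov A (B^T *m P) (B *m u) <= d * sqn u).
Proof.
move=> st Acl d0.
have [k kH] := choice (fun j : 'I_n.+1 => let: ex_intro2 k k0 H := riccati_moment A B j in
  ex_intro (fun k => 0 <= k /\ forall eps P mu z, 0 < eps -> eps <= 1 -> \tr P <= 1 ->
    riccati A B eps P -> dotv mu (P *m (A ^+ j *m z)) ^+ 2 <=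
      k * (\tr P + eps) * sqn mu * dotv z (P *m z)) k (conj k0 H)).
pose K := \sum_j k j.
have K0 : 0 <= K by apply: sumr_ge0 => j _; have [] := kH j.
pose b := frob B; have b0 : 0 <= b := frob_ge0 B.
have Kb : 0 <= K * b by exact: mulr_ge0.
pose e1 := Num.min 1 (d / (2 * (1 + K * b) * (1 + b))).
have den : 0 < 2 * (1 + K * b) * (1 + b) by rewrite !mulr_gt0 //; lra.
have e10 : 0 < e1 by rewrite lt_min ltr01 divr_gt0.
have [e e0 He] := riccati_trace_small st Acl e10.
exists (Num.min e e1); first by rewrite lt_min e0.
move=> eps P eps0; rewrite le_min => /andP[epse epse1] Ric.
have trP := He eps P eps0 epse Ric.
have e11 : e1 <= 1 by rewrite ge_min lexx.
have eps1 := le_trans epse1 e11; have tr1 := le_trans trP e11.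
have [Ppd _] := Ric; have Ps := posdef_sym Ppd; have Pp := posdef_ge0 Ppd.
have tr0 := trace_ge0 Pp.
have e1d : e1 * (2 * (1 + K * b) * (1 + b)) <= d.
  by rewrite -ler_pdivlMr // ge_min lexx orbT.
have Hz z : krylov A (B^T *m P) z <= (\tr P + eps) * (K * b) * dotv z (P *m z).
  have -> : (\tr P + eps) * (K * b) * dotv z (P *m z) =
      \sum_j \sum_l k j * (\tr P + eps) * sqn (col l B) * dotv z (P *m z).
    rewrite /K mulr_suml mulr_sumr mulr_suml; apply: eq_bigr => j _.
    have -> : b = \sum_l sqn (col l B).
      rewrite /b /frob exchange_big; apply: eq_bigr => l _; rewrite sqnE.
      by apply: eq_bigr => i _; rewrite mxE.
    by rewrite !mulr_sumr mulr_suml; apply: eq_bigr => l _; ring.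
  apply: ler_sum => j _; rewrite sqnE; apply: ler_sum => l _.
  have [_ kj] := kH j.
  have -> : (B^T *m P *m A ^+ j *m z) l 0 = dotv (col l B) (P *m (A ^+ j *m z)).
    rewrite -!mulmxA; move: (P *m _) => y.
    by rewrite dotvE mxE; apply: eq_bigr => i _; rewrite !mxE.
  exact: kj.
have T1 : \tr P + eps <= 2 * e1 by lra.
have T0 : 0 <= \tr P + eps by lra.
have bd : (\tr P + eps) * (K * b) * (1 + b) <= d.
  apply: le_trans e1d; rewrite !mulrA ler_wpM2r; [|lra|].
    by [].
  have := ler_wpM2r Kb T1; lra.
have bd1 : (\tr P + eps) * (K * b) <= d.
  apply: le_trans bd; rewrite ler_peMr ?mulr_ge0 //; lra.
split=> [z|u]; first by apply: le_trans (Hz z) _; rewrite ler_wpM2r.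
apply: le_trans (Hz _) _; apply: le_trans (_ : _ <= (\tr P + eps) * (K * b) * (b * sqn u)) _.
  rewrite ler_wpM2l ?mulr_ge0 // (le_trans (psd_le_trace _ Ps Pp)) //.
  apply: le_trans (sqn_mul_le _ _); rewrite ler_piMl ?sqn_ge0 //.
rewrite mulrA ler_wpM2r ?sqn_ge0 // (le_trans _ bd) // ler_wpM2l ?mulr_ge0 //; lra.
Qed.

(** * Square integrability under Hurwitz dynamics *)

Section HurwitzSignals.
Variable R : realType.
Notation D f t d := (is_derive (t : R) (1 : R) (f : R -> R) (d : R)).
Implicit Types (y z g : R -> R[i]).

Definition cder y (t : R) (d : R[i]) :=
  D (fun s => complex.Re (y s)) t (complex.Re d) /\
  D (fun s => complex.Im (y s)) t (complex.Im d).

Definition L2 y := [/\ evcont (fun t => complex.Re (y t)),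
  evcont (fun t => complex.Im (y t)) & intbl (fun t => csq (y t))].

Lemma ReD (a b : R[i]) : complex.Re (a + b) = complex.Re a + complex.Re b.
Proof. by case: a; case: b. Qed.

Lemma ImD (a b : R[i]) : complex.Im (a + b) = complex.Im a + complex.Im b.
Proof. by case: a; case: b. Qed.

Lemma ReN (a : R[i]) : complex.Re (- a) = - complex.Re a.
Proof. by case: a. Qed.

Lemma ImN (a : R[i]) : complex.Im (- a) = - complex.Im a.
Proof. by case: a. Qed.

Lemma ReM (a b : R[i]) : complex.Re (a * b) =
  complex.Re a * complex.Re b - complex.Im a * complex.Im b.
Proof. by case: a; case: b. Qed.

Lemma ImM (a b : R[i]) : complex.Im (a * b) =
  complex.Re a * complex.Im b + complex.Im a * complex.Re b.
Proof. by case: a; case: b. Qed.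

Lemma cder_eq y t d e : cder y t d -> d = e -> cder y t e.
Proof. by move=> ? <-. Qed.

Lemma cderD y z t d e : cder y t d -> cder z t e ->
  cder (fun s => y s + z s) t (d + e).
Proof.
move=> [yr yi] [zr zi]; split.
  by under eq_fun do rewrite ReD; rewrite ReD; exact: derD.
by under eq_fun do rewrite ImD; rewrite ImD; exact: derD.
Qed.

Lemma cderZ k y t d : cder y t d -> cder (fun s => k * y s) t (k * d).
Proof.
move=> [yr yi]; split.
  by under eq_fun do rewrite ReM; rewrite ReM; apply: derB; exact: derZ.
by under eq_fun do rewrite ImM; rewrite ImM; apply: derD; exact: derZ.
Qed.

Lemma cder0 t : cder (fun=> 0) t 0.
Proof. by split; exact: der_cst. Qed.

Lemma cder_sum n (y : 'I_n -> R -> R[i]) t (d : 'I_n -> R[i]) :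
  (forall i, cder (y i) t (d i)) -> cder (fun s => \sum_i y i s) t (\sum_i d i).
Proof.
elim: n y d => [|n IH] y d H.
  by under eq_fun do rewrite big_ord0; rewrite big_ord0; exact: cder0.
under eq_fun do rewrite big_ord_recl; rewrite big_ord_recl.
by apply: cderD => //; apply: IH.
Qed.

Lemma evcont_csq y : evcont (fun t => complex.Re (y t)) ->
  evcont (fun t => complex.Im (y t)) -> evcont (fun t => csq (y t)).
Proof. by move=> yr yi; apply: evcontD; exact: evcontX. Qed.

Lemma L2_ext y z : y =1 z -> L2 y -> L2 z.
Proof. by move=> /funext ->. Qed.

Lemma L2D y z : L2 y -> L2 z -> L2 (fun t => y t + z t).
Proof.
move=> [yr yi yI] [zr zi zI].
have cr : evcont (fun t => complex.Re (y t + z t)).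
  by under eq_fun do rewrite ReD; exact: evcontD.
have ci : evcont (fun t => complex.Im (y t + z t)).
  by under eq_fun do rewrite ImD; exact: evcontD.
split=> //; apply: (intbl_le (evcont_csq cr ci)
  (intblD (intblZ (ler0n R 2) yI) (intblZ (ler0n R 2) zI))).
apply: evt_all => t; rewrite csq_ge0 /csq !ReD !ImD /=.
have := sqr_ge0 (complex.Re (y t) - complex.Re (z t)).
have := sqr_ge0 (complex.Im (y t) - complex.Im (z t)).
by move=> h1 h2; lra.
Qed.

Lemma L2Z k y : L2 y -> L2 (fun t => k * y t).
Proof.
move=> [yr yi yI]; split.
- under eq_fun do rewrite ReM -mulNr.
  by apply: evcontD; apply: evcontM => //; exact: evcont_cst.
- under eq_fun do rewrite ImM.
  by apply: evcontD; apply: evcontM => //; exact: evcont_cst.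
- apply: intbl_ext (intblZ (csq_ge0 k) yI) => t; by rewrite csqM.
Qed.

Lemma L20 : L2 (fun=> 0).
Proof.
split; [exact: evcont_cst|exact: evcont_cst|].
by apply: intbl_ext (intbl0 R) => t; rewrite /csq /= expr0n addr0.
Qed.

Lemma L2_sum n (y : 'I_n -> R -> R[i]) : (forall i, L2 (y i)) ->
  L2 (fun t => \sum_i y i t).
Proof.
elim: n y => [|n IH] y H.
  by apply: L2_ext L20 => t; rewrite big_ord0.
apply: (@L2_ext (fun t => y ord0 t + \sum_i y (lift ord0 i) t)).
  by move=> t; rewrite big_ord_recl.
by apply: L2D => //; apply: IH.
Qed.

(** The Lyapunov function is [|y|^2]: its derivative is at most [- a |y|^2 + a^-1 |g|^2] with
    [a = - Re l], and the rotation by [Im l] contributes nothing. *)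
Lemma stable_scalar_L2 (l : R[i]) y g : complex.Re l < 0 ->
  evt (fun t => cder y t (l * y t + g t)) -> L2 g -> L2 y.
Proof.
move=> l0 yd [gr gi gI].
have cr : evcont (fun t => complex.Re (y t)).
  by apply: evt_mono yd => t [h _]; exact: der_continuous h.
have ci : evcont (fun t => complex.Im (y t)).
  by apply: evt_mono yd => t [_ h]; exact: der_continuous h.
split=> //.
pose a := - complex.Re l; have a0 : 0 < a by rewrite oppr_gt0.
have ai : 0 <= a^-1 by rewrite invr_ge0 ltW.
suff H : intbl (fun t => a * csq (y t)).
  apply: intbl_ext (intblZ ai H) => t; by rewrite mulKf // gt_eqF.
have gc : evcont (fun t => a * csq (y t)).
  by apply: evcontM; [exact: evcont_cst|exact: evcont_csq].
apply: (@dissipation_intbl R (fun t => csq (y t))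
  (fun t => 2 * complex.Re (y t) * complex.Re (l * y t + g t) +
            2 * complex.Im (y t) * complex.Im (l * y t + g t)) _ _ 0 gc (intblZ ai gI)).
apply: evt_mono yd => t [dr di]; split; last by rewrite oppr0 csq_ge0.
  exact: derD (der_sqr dr) (der_sqr di).
rewrite ReD ImD ReM ImM /csq.
set p := complex.Re (y t); set q := complex.Im (y t).
set u := complex.Re (g t); set v := complex.Im (g t).
set w := complex.Im l; have -> : complex.Re l = - a by rewrite opprK.
have e : a * a^-1 = 1 by rewrite mulfV // gt_eqF.
have := mulr_ge0 ai (sqr_ge0 (a * p - u)); have := mulr_ge0 ai (sqr_ge0 (a * q - v)).
have -> : a^-1 * (a * p - u) ^+ 2 = a * p ^+ 2 - 2 * (p * u) + a^-1 * u ^+ 2.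
  by field; rewrite gt_eqF.
have -> : a^-1 * (a * q - v) ^+ 2 = a * q ^+ 2 - 2 * (q * v) + a^-1 * v ^+ 2.
  by field; rewrite gt_eqF.
clear; lra.
Qed.

Definition mder m n (X : R -> 'M[R[i]]_(m, n)) t (d : 'M[R[i]]_(m, n)) :=
  forall i j, cder (fun s => X s i j) t (d i j).

Definition mL2 m n (X : R -> 'M[R[i]]_(m, n)) := forall i j, L2 (fun t => X t i j).

Lemma mder_mulr m n p (X : R -> 'M[R[i]]_(m, n)) t d (N : 'M[R[i]]_(n, p)) :
  mder X t d -> mder (fun s => X s *m N) t (d *m N).
Proof.
move=> H i j; under eq_fun do rewrite mxE; rewrite mxE.
apply: cder_sum => k; rewrite mulrC; under eq_fun do rewrite mulrC; exact: cderZ.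
Qed.

Lemma mder_mull m n p (X : R -> 'M[R[i]]_(m, n)) t d (N : 'M[R[i]]_(p, m)) :
  mder X t d -> mder (fun s => N *m X s) t (N *m d).
Proof.
move=> H i j; under eq_fun do rewrite mxE; rewrite mxE.
by apply: cder_sum => k; exact: cderZ.
Qed.

Lemma mL2_mulr m n p (X : R -> 'M[R[i]]_(m, n)) (N : 'M[R[i]]_(n, p)) :
  mL2 X -> mL2 (fun s => X s *m N).
Proof.
move=> H i j; under eq_fun do rewrite mxE.
by apply: L2_sum => k; under eq_fun do rewrite mulrC; exact: L2Z.
Qed.

Lemma mL2_mull m n p (X : R -> 'M[R[i]]_(m, n)) (N : 'M[R[i]]_(p, m)) :
  mL2 X -> mL2 (fun s => N *m X s).
Proof.
by move=> H i j; under eq_fun do rewrite mxE; apply: L2_sum => k; exact: L2Z.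
Qed.

Lemma mL2D m n (X Y : R -> 'M[R[i]]_(m, n)) :
  mL2 X -> mL2 Y -> mL2 (fun s => X s + Y s).
Proof. by move=> HX HY i j; under eq_fun do rewrite mxE; exact: L2D. Qed.

(* Cayley-Hamilton replaces triangularization: the vectors
   [(M - l_1) ... (M - l_k) z] form a chain of scalar equations ending in 0. *)
Lemma hurwitz_mL2 n p (M : 'M[R[i]]_n) (z f : R -> 'M[R[i]]_(n, p)) :
  (forall l, root (char_poly M) l -> complex.Re l < 0) ->
  evt (fun t => mder z t (M *m z t + f t)) -> mL2 f -> mL2 z.
Proof.
case: n M z f => [|n] M z f Mh zd fL; first by move=> [].
have [rs rsE] := closed_field_poly_normal (char_poly M).
rewrite (eqP (char_poly_monic _)) scale1r in rsE.
have {}Mh l : l \in rs -> complex.Re l < 0.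
  by move=> lrs; apply: Mh; rewrite rsE root_prod_XsubC.
have : mL2 (fun t => horner_mx M (\prod_(l <- rs) ('X - l%:P)) *m z t).
  rewrite -rsE Cayley_Hamilton => i j.
  by under eq_fun do rewrite mul0mx mxE; exact: L20.
elim: rs {rsE} Mh z f zd fL => [|l rs IH] Mh z f zd fL H.
  by move: H; rewrite big_nil rmorph1; under eq_fun do rewrite mul1mx.
pose N := M - l%:M.
have HN : horner_mx M ('X - l%:P) = N by rewrite rmorphB /= horner_mx_X horner_mx_C.
have MN : M *m N = N *m M by rewrite mulmxBr mulmxBl scalar_mxC.
have L1 : mL2 (fun t => N *m z t).
  apply: (IH _ _ (fun t => N *m f t)).
  - by move=> k krs; apply: Mh; rewrite inE krs orbT.
  - apply: evt_mono zd => t /(mder_mull N); rewrite mulmxDr !mulmxA.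
    by rewrite -MN.
  - exact: mL2_mull.
  - move: H; rewrite big_cons mulrC rmorphM /= HN.
    by under eq_fun do rewrite -mulmxE -mulmxA.
move=> i j; apply: (@stable_scalar_L2 l _ (fun t => (N *m z t + f t) i j)).
- by apply: Mh; rewrite mem_head.
- apply: evt_mono zd => t /(_ i j) h; apply: cder_eq h _.
  by rewrite /N mulmxBl mul_scalar_mx !mxE; ring.
- exact: (mL2D L1 fL i j).
Qed.

(** The chain argument runs on the right factor [N], each stage being a left system with matrix
    [M + l%:M]; this avoids Kronecker products. *)
Lemma sylvester_mL2 n p (M : 'M[R[i]]_n) (N : 'M[R[i]]_p) (X W : R -> 'M[R[i]]_(n, p)) :
  (forall l k, root (char_poly M) l -> root (char_poly N) k -> complex.Re (l + k) < 0) ->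
  evt (fun t => mder X t (M *m X t + X t *m N + W t)) -> mL2 W -> mL2 X.
Proof.
case: p N X W => [|p] N X W MN Xd WL; first by move=> i [].
have [rs rsE] := closed_field_poly_normal (char_poly N).
rewrite (eqP (char_poly_monic _)) scale1r in rsE.
have {}MN l k : root (char_poly M) l -> k \in rs -> complex.Re (l + k) < 0.
  by move=> lr krs; apply: MN => //; rewrite rsE root_prod_XsubC.
have : mL2 (fun t => X t *m horner_mx N (\prod_(l <- rs) ('X - l%:P))).
  rewrite -rsE Cayley_Hamilton => i j.
  by under eq_fun do rewrite mulmx0 mxE; exact: L20.
elim: rs {rsE} MN X W Xd WL => [|l rs IH] MN X W Xd WL H.
  by move: H; rewrite big_nil rmorph1; under eq_fun do rewrite mulmx1.
pose S := N - l%:M.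
have HS : horner_mx N ('X - l%:P) = S by rewrite rmorphB /= horner_mx_X horner_mx_C.
have NS : N *m S = S *m N by rewrite mulmxBr mulmxBl scalar_mxC.
have L1 : mL2 (fun t => X t *m S).
  apply: (IH _ _ (fun t => W t *m S)).
  - by move=> k1 k kr krs; apply: MN => //; rewrite inE krs orbT.
  - apply: evt_mono Xd => t /(mder_mulr S); rewrite !mulmxDl -!mulmxA.
    by rewrite NS.
  - exact: mL2_mulr.
  - move: H; rewrite big_cons rmorphM /= HS.
    by under eq_fun do rewrite -mulmxE mulmxA.
apply: (@hurwitz_mL2 _ _ (M + l%:M) X (fun t => X t *m S + W t)).
- move=> k; rewrite /root horner_char_poly => kM.
  have := MN (k - l) l; rewrite subrK; apply; last exact: mem_head.
  by rewrite /root horner_char_poly rmorphB /= -addrA -opprD [l%:M + _]addrC.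
- apply: evt_mono Xd => t h i j; apply: cder_eq (h i j) _.
  rewrite /S mulmxDl mulmxBr mul_scalar_mx mul_mx_scalar.
  by move: (M *m X t) (X t *m N) (X t) (W t) => x1 x2 x3 x4; rewrite !mxE; ring.
- exact: mL2D.
Qed.

End HurwitzSignals.

(** * Grounded Laplacian *)

Section Graph.
Variable R : realType.

(** The exosystem acts as one more node held at zero error; [Cs] collects the nodes with an edge of
    weight 1 from it. *)
Definition grounded_laplacian N (Cs : {set 'I_N}) (a : 'M[R]_N) : 'M[R]_N :=
  \matrix_(i, j) ((\sum_k a i k + (if i \in Cs then 1 else 0)) *+ (i == j) - a i j).

(* On an eigenvector of an eigenvalue with nonpositive real part, the nodes
   of maximal modulus are closed under parents and avoid [Cs]. *)
Lemma grounded_laplacian_eigenvalue N (Cs : {set 'I_N}) (a : 'M[R]_N) l :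
  in_graph_set Cs a -> root (char_poly (cmx (grounded_laplacian Cs a))) l ->
  0 < complex.Re l.
Proof.
move=> [a0 [adiag tree]] rl; rewrite ltNge; apply/negP => l0.
(* [det0P] supplies a row vector; after transposition it is a right eigenvector, whose equation
   reads as a balance at each node. *)
have : \det (l%:M - cmx (grounded_laplacian Cs a))^T = 0.
  by rewrite det_tr -horner_char_poly; apply/eqP.
move=> /eqP/det0P[v v0 vM].
pose w i := v 0 i.
pose io i : R := if i \in Cs then 1 else 0.
have wE i : l * w i = ((\sum_k a i k + io i)%:C)%C * w i - \sum_j ((a i j)%:C)%C * w j.
  have := congr1 (fun x : 'rV_N => x 0 i) vM.
  rewrite linearB /= mulmxBr tr_scalar_mx mul_mx_scalar [X in X = _]mxE [X in X + _]mxE.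
  rewrite [X in _ + X]mxE [X in _ = X]mxE -/(w i) => /eqP; rewrite subr_eq0 => /eqP ->.
  rewrite mxE; set s := \sum_k a i k + io i.
  have -> : (s%:C)%C * w i = \sum_j ((s%:C)%C *+ (i == j)) * w j.
    rewrite (bigD1 i) //= eqxx mulr1n big1 ?addr0 // => j ji.
    by rewrite eq_sym (negPf ji) mulr0n mul0r.
  rewrite -sumrB; apply: eq_bigr => j _; rewrite !mxE -/(io i) -/s -/(w j) -mulrBl mulrC.
  by rewrite rmorphB rmorphMn.
have [i1 wi1] : exists i, w i != 0.
  apply: contrapT => nw; case/eqP: v0; apply/rowP => i; rewrite mxE.
  by apply/eqP/negPn/negP => h; apply: nw; exists i.
pose m := csq (w [arg max_(i > i1) csq (w i)]%O).
have mmax i : csq (w i) <= m.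
  by rewrite /m; case: arg_maxP => // k _; apply.
have m0 : 0 < m.
  apply: lt_le_trans (mmax i1); rewrite lt_neqAle csq_ge0 andbT eq_sym.
  rewrite /csq paddr_eq0 ?sqr_ge0 // !sqrf_eq0.
  by apply: contraNN wi1; case: (w i1) => p q /= /andP[/eqP-> /eqP->].
have key i : csq (w i) = m -> io i = 0 /\ forall j, 0 < a i j -> csq (w j) = m.
  move=> wi.
  (* The real part of [conj (w i) * w j], obtained on multiplying the equation of node [i] by
     [conj (w i)]. *)
  pose c j := complex.Re (w i) * complex.Re (w j) + complex.Im (w i) * complex.Im (w j).
  have cb j : c j <= m.
    have := mmax j; rewrite -wi /csq /c.
    have := sqr_ge0 (complex.Re (w i) - complex.Re (w j)).
    have := sqr_ge0 (complex.Im (w i) - complex.Im (w j)).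
    lra.
  have cb2 j : c j <= (m + csq (w j)) / 2.
    rewrite -wi /csq /c.
    have := sqr_ge0 (complex.Re (w i) - complex.Re (w j)).
    have := sqr_ge0 (complex.Im (w i) - complex.Im (w j)).
    lra.
  have ReS (f : 'I_N -> R[i]) : complex.Re (\sum_i f i) = \sum_i complex.Re (f i).
    by apply: (big_morph (@complex.Re R)) => // -[? ?] [? ?].
  have ImS (f : 'I_N -> R[i]) : complex.Im (\sum_i f i) = \sum_i complex.Im (f i).
    by apply: (big_morph (@complex.Im R)) => // -[? ?] [? ?].
  have E : complex.Re l * m = (\sum_k a i k + io i) * m - \sum_j a i j * c j.
    have := wE i; set s := \sum_k a i k + io i => e.
    have := congr1 (@complex.Re R) e; have := congr1 (@complex.Im R) e.
    rewrite !(ReD, ImD, ReN, ImN, ReM, ImM) ReS ImS /=.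
    under eq_bigr do rewrite ImM /= mul0r addr0.
    rewrite [X in _ -> _ = _ - X -> _](_ : _ = \sum_j a i j * complex.Re (w j)); last first.
      by apply: eq_bigr => j _; rewrite ReM /= mul0r subr0.
    rewrite !(mul0r, subr0, addr0) => ei er.
    have -> : \sum_j a i j * c j = complex.Re (w i) * (\sum_j a i j * complex.Re (w j)) +
        complex.Im (w i) * (\sum_j a i j * complex.Im (w j)).
      by rewrite !mulr_sumr -big_split /=; apply: eq_bigr => j _; rewrite /c; ring.
    rewrite -wi /csq.
    transitivity (complex.Re (w i) * (complex.Re l * complex.Re (w i) -
       complex.Im l * complex.Im (w i)) + complex.Im (w i) * (complex.Re l * complex.Im (w i) +
       complex.Im l * complex.Re (w i))); first by ring.
    by rewrite er ei; ring.
  have io0 : 0 <= io i by rewrite /io; case: ifP.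
  (* The balance becomes [S + io i * m = Re l * m] with nonnegative terms on the left and a
     nonpositive right side. Every term vanishes, and [c j = m] along an edge forces [w j] to have
     maximal modulus. *)
  pose S := \sum_j a i j * (m - c j).
  have SE : S = (\sum_k a i k) * m - \sum_j a i j * c j.
    by rewrite mulr_suml -sumrB; apply: eq_bigr => j _; rewrite mulrBr.
  have tS j : 0 <= a i j * (m - c j) by rewrite mulr_ge0 // subr_ge0.
  have S0 : 0 <= S by apply: sumr_ge0 => j _; exact: tS.
  have lm : complex.Re l * m <= 0 by rewrite mulr_le0_ge0 // ltW.
  have iom : 0 <= io i * m by rewrite mulr_ge0 // ltW.
  have {}E : S + io i * m = complex.Re l * m by rewrite E SE; ring.
  split.
    by apply/eqP; rewrite -(mulIr_eq0 _ (mulIf (lt0r_neq0 m0))); apply/eqP; lra.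
  move=> j aj; have aS : a i j * (m - c j) <= S.
    rewrite /S (bigD1 j) //= lerDl; apply: sumr_ge0 => k _; exact: tS.
  have : m - c j <= 0 by rewrite -(pmulr_rle0 _ aj); lra.
  have := cb2 j; have := mmax j; lra.
pose k0 := [arg max_(i > i1) csq (w i)]%O.
have [T [r [par [[rT Ttree] rC iT]]]] := tree k0.
have walk k : forall u, u \in T -> csq (w u) = m -> iter k par u = r -> csq (w r) = m.
  elim: k => [u _ um <- //|k IH u uT um kr].
  have [ur|ur] := eqVneq u r; first by rewrite -ur.
  have [pT pa _] := Ttree u uT ur.
  by apply: (IH (par u)) => //; [exact: (key u um).2|rewrite -iterSr].
have : csq (w r) = m.
  have [<- //|k0r] := eqVneq k0 r.
  by have [_ _ [k kr]] := Ttree k0 iT k0r; apply: (walk k k0).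
by move=> /key[]; rewrite /io rC => /eqP; rewrite oner_eq0.
Qed.

End Graph.

(** * Real vector signals and their decay *)

Section VectorSignals.
Variable R : realType.
Notation D f t d := (is_derive (t : R) (1 : R) (f : R -> R) (d : R)).

Definition vder n (z : R -> 'cV[R]_n) (t : R) (d : 'cV[R]_n) :=
  forall k, D (fun s => z s k 0) t (d k 0).

Definition vcont n (z : R -> 'cV[R]_n) := forall k, evcont (fun t => z t k 0).

Lemma vder_mulmx n p (M : 'M[R]_(p, n)) (z : R -> 'cV[R]_n) t d :
  vder z t d -> vder (fun s => M *m z s) t (M *m d).
Proof.
move=> zd k; under eq_fun do rewrite mxE; rewrite mxE.
by apply: der_sum => i; exact: derZ.
Qed.

Lemma vder_dotv n (x y : R -> 'cV[R]_n) t d e : vder x t d -> vder y t e ->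
  D (fun s => dotv (x s) (y s)) t (dotv d (y t) + dotv (x t) e).
Proof.
move=> xd ye; under eq_fun do rewrite dotvE; rewrite !dotvE -big_split /=.
by apply: der_sum => i; exact: derM.
Qed.

Lemma vder_form n (Q : 'M[R]_n) (z : R -> 'cV[R]_n) t d : vder z t d ->
  D (fun s => dotv (z s) (Q *m z s)) t (dotv d (Q *m z t) + dotv (z t) (Q *m d)).
Proof. by move=> zd; apply: vder_dotv => //; exact: vder_mulmx. Qed.

Lemma vcont_mulmx n p (M : 'M[R]_(p, n)) (z : R -> 'cV[R]_n) :
  vcont z -> vcont (fun s => M *m z s).
Proof.
move=> zc k; under eq_fun do rewrite mxE.
by apply: evcont_sum => i; apply: evcontM => //; exact: evcont_cst.
Qed.

Lemma vcontD n (x y : R -> 'cV[R]_n) : vcont x -> vcont y -> vcont (fun s => x s + y s).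
Proof. by move=> xc yc k; under eq_fun do rewrite mxE; exact: evcontD. Qed.

Lemma vcont_shift n (z : R -> 'cV[R]_n) c : vcont z -> vcont (fun s => z (s - c)).
Proof. by move=> zc k; exact: (evcont_shift c (zc k)). Qed.

Lemma vcont_sqn n (z : R -> 'cV[R]_n) : vcont z -> evcont (fun t => sqn (z t)).
Proof.
by move=> zc; under eq_fun do rewrite sqnE; apply: evcont_sum => i; exact: evcontX.
Qed.

Lemma vder_vcont n (z : R -> 'cV[R]_n) d : evt (fun t => vder z t (d t)) -> vcont z.
Proof. by move=> zd k; apply: evt_mono zd => t /(_ k) /der_continuous. Qed.

Lemma sqn_cvg0 n (z : R -> 'cV[R]_n) :
  ((fun t => sqn (z t)) @ +oo%R --> (0 : R))%classic ->
  forall k, ((fun t => z t k 0) @ +oo%R --> (0 : R))%classic.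
Proof.
move=> /cvgrPdist_le H k; apply/cvgrPdist_le => e e0.
have e2 : 0 < e ^+ 2 by rewrite exprn_gt0.
apply: filterS (H _ e2) => t; rewrite !sub0r !normrN (ger0_norm (sqn_ge0 _)) => h.
rewrite -(ler_pXn2r (isT : (0 < 2)%N)) ?nnegrE ?(ltW e0) // real_normK ?num_real //.
exact: le_trans (entry_sqr_le_sqn _ _) h.
Qed.

(** Barbalat's lemma for [|z|^2], whose derivative [2 z . (A z + b)] is dominated by an integrable
    combination of [|z|^2] and [|b|^2]. *)
Lemma L2_state_cvg0 n (A : 'M[R]_n) (z b : R -> 'cV[R]_n) :
  evt (fun t => vder z t (A *m z t + b t)) ->
  intbl (fun t => sqn (z t)) -> intbl (fun t => sqn (b t)) ->
  forall k, ((fun t => z t k 0) @ +oo%R --> (0 : R))%classic.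
Proof.
move=> zd zI bI; apply: sqn_cvg0.
pose h t := sqn (z t) + (2 * frob A * sqn (z t) + 2 * sqn (b t)).
have fA : 0 <= 2 * frob A by rewrite mulr_ge0 // frob_ge0.
apply: (@barbalat _ _ (fun t => dotv (A *m z t + b t) (z t) + dotv (z t) (A *m z t + b t)) h).
- by apply: evt_all => t; exact: sqn_ge0.
- exact: zI.
- apply: evt_mono zd => t zt; split; first exact: vder_dotv.
  rewrite (dotvC (A *m z t + b t)); set d := A *m z t + b t.
  have := dotv_le_young (z t) d ltr01; rewrite invr1 !mul1r => y1.
  have := sqnD_le (A *m z t) (b t); rewrite -/d => y2.
  have := sqn_mul_le A (z t) => y3.
  have := ler_wpM2l (ler0n R 2) y3; rewrite mulrA => y4.
  rewrite /h; lra.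
- apply: evt_all => t; rewrite /h !addr_ge0 ?sqn_ge0 // mulr_ge0 ?sqn_ge0 //.
- apply: intblD => //; apply: intblD; exact: intblZ.
Qed.

End VectorSignals.

(** * Lyapunov functional of the delayed loop *)

Section DelayLyapunov.
Variable R : realType.
Notation D f t d := (is_derive (t : R) (1 : R) (f : R -> R) (d : R)).

Variables (n m : nat) (A : 'M[R]_n.+1) (B : 'M[R]_(n.+1, m)) (P Q : 'M[R]_n.+1).
Variables (eps rho Om tau g C4 k2 k3 k4 k5 : R).
Local Notation c := (B^T *m P).
Local Notation V x := (dotv x (P *m x)).
Let al := Om * tau.
(** The weight for which [rho / Om] times the oscillation bound has exactly [k] times an increment
    of the energy on its right. *)
Let k := rho * sin al / Om.
Hypotheses (eps0 : 0 < eps) (Ric : riccati A B eps P) (Om0 : 0 < Om) (tau0 : 0 <= tau).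
Hypotheses (alpi : al < pi / 2) (rhocos : 2 <= rho * cos al) (rho0 : 0 < rho).
Hypotheses (g0 : 0 <= g) (C40 : 0 <= C4) (k50 : 0 <= k5) (k30 : 0 <= k3).
(** Bernstein's inequality for a motion with input [b]; the input costs its Krylov norm, which [F4]
    and [F5] bound for the feedback and for the forcing. *)
Hypothesis F1 : forall x b, sqn (c *m (A *m x + b)) - Om ^+ 2 * sqn (c *m x) <=
  - g * (dotv (A *m x + b) (Q *m x) + dotv x (Q *m (A *m x + b))) + C4 * krylov A c b.
Hypothesis F2 : forall x, `|dotv x (Q *m x)| <= k2 * V x.
Hypothesis F3 : forall x, sqn (c *m x) <= k3 * V x.
Hypothesis F4 : forall u, krylov A c (B *m u) <= k4 * sqn u.
Hypothesis F5 : forall x, krylov A c x <= k5 * sqn x.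
(** The budget: [S2] and [S3] let the corrections consume a quarter of the current [V] and a quarter
    of its bound over the delay window, and [S4] charges the delayed feedback to the
    [2 |v(t - tau)|^2] gained from [rhocos]. *)
Hypothesis S2 : k * tau * g * k2 <= 4^-1.
Hypothesis S3 : k * Om ^+ 2 * tau ^+ 2 * k3 <= 4^-1.
Hypothesis S4 : k * tau * C4 * (2 * rho ^+ 2) * k4 <= 2.

Lemma delay_gain_ge0 : 0 <= k.
Proof.
rewrite divr_ge0 ?(ltW Om0) // mulr_ge0 ?(ltW rho0) // sin_ge0_pi //.
have al0 : 0 <= al by rewrite mulr_ge0 // ltW.
rewrite al0 (le_trans (ltW alpi)) //; have := pi_gt0 R; lra.
Qed.

Variables (z f : R -> 'cV[R]_n.+1).
Let b t := - rho *: (B *m (c *m z (t - tau))) + f t.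
Hypothesis zd : evt (fun t => vder z t (A *m z t + b t)).
Hypothesis fc : vcont f.
Hypothesis fI : intbl (fun t => sqn (f t)).

Let zc : vcont z.
Proof. exact: vder_vcont zd. Qed.

Let bc : vcont b.
Proof.
apply: vcontD => // i; under eq_fun do rewrite mxE.
apply: evcontM; first exact: evcont_cst.
exact: (vcont_mulmx B (vcont_mulmx c (vcont_shift tau zc))).
Qed.

Let v t := c *m z t.
Let dv t := c *m (A *m z t + b t).

Lemma sqn_input_le t : krylov A c (b t) <=
  2 * rho ^+ 2 * k4 * sqn (v (t - tau)) + 2 * k5 * sqn (f t).
Proof.
apply: le_trans (krylovD_le _ _ _ _) _; apply: lerD; last by rewrite -mulrA ler_wpM2l.
have -> : 2 * rho ^+ 2 * k4 * sqn (v (t - tau)) = 2 * (rho ^+ 2 * (k4 * sqn (v (t - tau)))).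
  by ring.
by rewrite krylovZ sqrrN ler_wpM2l // ler_wpM2l ?sqr_ge0 //; exact: F4.
Qed.

Lemma delay_V_derivative t : dotv (A *m z t + b t) (P *m z t) + dotv (z t) (P *m (A *m z t + b t)) =
  sqn (v t) - eps * sqn (z t) - 2 * rho * dotv (v t) (v (t - tau)) + 2 * dotv (z t) (P *m f t).
Proof.
have [Ppd _] := Ric; have Ps := posdef_sym Ppd.
have -> : dotv (A *m z t + b t) (P *m z t) = dotv (z t) (P *m (A *m z t + b t)).
  by rewrite dotvMr Ps dotvC.
have := riccati_form (z t) (z t) Ric.
have -> : dotv (A *m z t) (P *m z t) = dotv (z t) (P *m (A *m z t)).
  by rewrite dotvMr Ps dotvC.
rewrite -/(sqn _) -/(sqn (z t)) -/(v t) => E.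
rewrite !mulmxDr !dotvDr -scalemxAr dotvZr.
have -> : dotv (z t) (P *m (B *m v (t - tau))) = dotv (v t) (v (t - tau)).
  by rewrite mulmxA (dotvMr (P *m B)) trmx_mul Ps.
rewrite -/(v (t - tau)) in E *; lra.
Qed.

(* The Lyapunov functional is [L]; [W] is the delayed double integral of
   [|v'|^2 - Om^2 |v|^2] and turns the oscillation estimate over
   [[t - tau, t]] into a derivative. *)
Lemma delay_lyapunov : exists L dL T C5, [/\ 0 <= C5,
  forall t, T < t -> D L t (dL t),
  forall t, T < t -> dL t <= - (eps / 2 * sqn (z t)) + C5 * sqn (f t),
  forall t, T < t -> vder z (t - tau) (A *m z (t - tau) + b (t - tau)) /\
                     vder z t (A *m z t + b t) &
  forall t M, T < t -> (forall s, t - tau <= s <= t -> V (z s) <= M) ->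
    V (z t) - V (z t) / 4 - M / 4 <= L t].
Proof.
have k0 := delay_gain_ge0.
have al0 : 0 <= al by rewrite mulr_ge0 // ltW.
pose phi j t := dv t j 0 ^+ 2 - Om ^+ 2 * v t j 0 ^+ 2.
have vc : vcont v by exact: vcont_mulmx.
have dvc : vcont dv by apply: vcont_mulmx; apply: vcontD => //; exact: vcont_mulmx.
have phic j : evcont (phi j).
  rewrite /phi; under eq_fun do rewrite -mulNr.
  apply: evcontD; first exact: evcontX.
  by apply: evcontM; [exact: evcont_cst|exact: evcontX].
have [Phi PhiP] := choice (fun j => evcont_primitive (phic j)).
have [T0 E0] := evt_and zd (evt_fin PhiP).
pose Phi1 t := \sum_j Phi j t.
pose ph t := sqn (dv t) - Om ^+ 2 * sqn (v t).
have dPhi1 t : T0 < t -> D Phi1 t (ph t).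
  move=> tT; have [_ h] := E0 t tT; apply: der_eq (der_sum h) _.
  by rewrite /ph !sqnE mulr_sumr -sumrB.
have [Phi2 [T1 E1]] : exists Phi2, evt (fun t => D Phi2 t (Phi1 t)).
  by apply: evcont_primitive; exists T0 => t /dPhi1 /der_continuous.
pose T2 := Num.max T0 T1; pose T := T2 + tau.
have T20 t : T2 < t -> T0 < t by move=> h; apply: le_lt_trans h; rewrite le_max lexx.
have T21 t : T2 < t -> T1 < t by move=> h; apply: le_lt_trans h; rewrite le_max lexx orbT.
have Tt t : T < t -> T2 < t - tau by rewrite ltrBrDr.
have Tt' t : T < t -> T2 < t.
  by move=> h; apply: le_lt_trans h; rewrite lerDl.
have in_T t s : T < t -> t - tau <= s -> T2 < s.
  by move=> h; apply: lt_le_trans (Tt t h).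
pose W t := tau * Phi1 t - Phi2 t + Phi2 (t - tau).
have dW t : T < t -> D W t (tau * ph t - Phi1 t + Phi1 (t - tau)).
  move=> h; apply: derD; first apply: derB.
  - by apply: derZ; apply: dPhi1; apply/T20/Tt'.
  - by apply: E1; apply/T21/Tt'.
  - by apply: der_shift; apply: E1; apply/T21/Tt.
pose q t := dotv (z t) (Q *m z t).
pose dq t := dotv (A *m z t + b t) (Q *m z t) + dotv (z t) (Q *m (A *m z t + b t)).
pose dV t := dotv (A *m z t + b t) (P *m z t) + dotv (z t) (P *m (A *m z t + b t)).
have zd2 t : T2 < t -> vder z t (A *m z t + b t) by move=> /T20 /E0[].
(* Differentiating [k * W] gives the useful decrement of [Phi1] and an unwanted [k * tau * ph t];
   the last term of [L] is scaled so that [F1] cancels the latter up to the input. *)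
pose L t := V (z t) + k * W t + k * tau * g * q t.
pose dL t := dV t + k * (tau * ph t - Phi1 t + Phi1 (t - tau)) + k * tau * g * dq t.
pose C5 := 2 * (k * tau * C4 * k5) + (eps / 2)^-1 * frob P.
have kt : 0 <= k * tau by rewrite mulr_ge0.
exists L, dL, T, C5; split.
- have e2 : 0 <= (eps / 2)^-1 by rewrite invr_ge0 divr_ge0 // ltW.
  rewrite /C5 addr_ge0 //; last by rewrite mulr_ge0 // frob_ge0.
  by rewrite mulr_ge0 // mulr_ge0 // mulr_ge0.
- move=> t h; have zt := zd2 _ (Tt' _ h).
  apply: derD; first apply: derD; [exact: vder_form|by apply: derZ; exact: dW|].
  by apply: derZ; exact: vder_form.
- move=> t h.
  have osc : rho * (cos al * (sqn (v t) + sqn (v (t - tau))) - 2 * dotv (v t) (v (t - tau)))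
      <= k * (Phi1 t - Phi1 (t - tau)).
    have -> : k * (Phi1 t - Phi1 (t - tau)) = rho / Om * (sin al * (Phi1 t - Phi1 (t - tau))).
      by rewrite /k; ring.
    have rO : 0 <= rho / Om by rewrite divr_ge0 // ltW.
    have -> : rho * (cos al * (sqn (v t) + sqn (v (t - tau))) - 2 * dotv (v t) (v (t - tau)))
      = rho / Om * (Om * (cos al * (sqn (v t) + sqn (v (t - tau))) - 2 * dotv (v t) (v (t - tau)))).
      by field; rewrite gt_eqF.
    rewrite ler_wpM2l // -sumrB mulr_sumr !sqnE dotvE -big_split /= !mulr_sumr -sumrB mulr_sumr.
    apply: ler_sum => j _; rewrite [2 * (_ * _)]mulrA.
    apply: (oscillation_energy (u := fun s => v s j 0) (du := fun s => dv s j 0)) => //.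
    move=> s /andP[s1 _]; have sT := in_T _ _ h s1; split.
      exact: (vder_mulmx c (zd2 s sT) j).
    by have [_] := E0 s (T20 _ sT); apply.
  have ph1 : ph t <= - g * dq t + C4 * krylov A c (b t) by exact: F1.
  have kb := sqn_input_le t.
  have h1 : k * tau * (ph t + g * dq t) <= 2 * sqn (v (t - tau)) + 2 * (k * tau * C4 * k5) * sqn (f t).
    apply: (@le_trans _ _ (k * tau * (C4 * krylov A c (b t)))).
      by rewrite ler_wpM2l //; lra.
    apply: (@le_trans _ _ (k * tau * (C4 * (2 * rho ^+ 2 * k4 * sqn (v (t - tau)) + 2 * k5 * sqn (f t))))).
      by rewrite ler_wpM2l // ler_wpM2l.
    have := ler_wpM2r (sqn_ge0 (v (t - tau))) S4.
    lra.
  have h2 : 2 * dotv (z t) (P *m f t) <= eps / 2 * sqn (z t) + (eps / 2)^-1 * (frob P * sqn (f t)).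
    apply: le_trans (dotv_le_young _ _ (divr_gt0 eps0 (ltr0n R 2))) _.
    by rewrite lerD2l ler_wpM2l ?invr_ge0 ?divr_ge0 ?(ltW eps0) // sqn_mul_le.
  have h3 := delay_V_derivative t.
  have h4 := ler_wpM2r (sqn_ge0 (v t)) rhocos.
  have h5 := ler_wpM2r (sqn_ge0 (v (t - tau))) rhocos.
  have v0 := sqn_ge0 (v t).
  have aux (e kk ta p d gg p1 p2 s1 s2 s3 s4 s5 s6 co r X i2 fP : R) :
    r * (co * (s1 + s2) - 2 * s3) <= kk * (p1 - p2) ->
    kk * ta * (p + gg * d) <= 2 * s2 + X * s4 ->
    2 * s6 <= e / 2 * s5 + i2 * (fP * s4) -> 2 * s1 <= r * co * s1 ->
    2 * s2 <= r * co * s2 -> 0 <= s1 ->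
    s1 - e * s5 - 2 * r * s3 + 2 * s6 + kk * (ta * p - p1 + p2) + kk * ta * gg * d
      <= - (e / 2 * s5) + (X + i2 * fP) * s4 by lra.
  by rewrite /dL /dV h3; exact: aux osc h1 h2 h4 h5 v0.
- by move=> t h; split; apply: zd2; [exact: Tt|exact: Tt'].
- move=> t M h VM.
  have le1 : t - tau <= t by rewrite gerBl.
  have M0 : 0 <= M.
    apply: le_trans (VM t _); last by rewrite le1 lexx.
    exact: (posdef_ge0 Ric.1).
  (* A bound for [Om^2 |v|^2] over the window: [Phi1 s + mm * s] is nondecreasing there. With the
     mean value form of [W] this yields [W t >= - mm * tau ^+ 2]. *)
  pose mm := Om ^+ 2 * (k3 * M).
  have mm0 : 0 <= mm by rewrite mulr_ge0 ?sqr_ge0 // mulr_ge0.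
  have [xi /andP[x1 x2] xE] : exists2 xi, t - tau <= xi <= t &
      Phi2 t - Phi2 (t - tau) = Phi1 xi * (t - (t - tau)).
    apply: der_MVT => // s /andP[s1 _]; apply: E1; apply: T21; exact: in_T h s1.
  have Pxi : Phi1 xi + mm * xi <= Phi1 t + mm * t.
    apply: (@der_ge0_le _ (fun s => Phi1 s + mm * s) (fun s => ph s + mm * 1)) => //.
      move=> s /andP[s1 _]; have d1 : D Phi1 s (ph s).
        by apply: dPhi1; apply/T20/(in_T t) => //; exact: le_trans s1.
      have d2 : D (fun x => mm * x) s (mm * 1) := derZ mm (is_derive_id s (1 : R)).
      exact: (derD d1 d2).
    move=> s /andP[s1 s2]; rewrite mulr1 /ph /mm.
    have : sqn (v s) <= k3 * M.
      apply: le_trans (F3 _) _; rewrite ler_wpM2l //; apply: VM.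
      by rewrite s2 (le_trans x1).
    move=> /(ler_wpM2l (sqr_ge0 Om)); have := sqn_ge0 (dv s); lra.
  have WE : W t = tau * (Phi1 t - Phi1 xi).
    have e : t - (t - tau) = tau by ring.
    by rewrite e in xE; rewrite /W -addrA [- Phi2 t + _]addrC -[_ - Phi2 t]opprB xE; ring.
  have Wb : - (mm * tau ^+ 2) <= W t.
    rewrite WE.
    have : - (mm * tau) <= Phi1 t - Phi1 xi.
      have : mm * (t - xi) <= mm * tau by rewrite ler_wpM2l //; lra.
      lra.
    move=> /(ler_wpM2l tau0); lra.
  have h1 := ler_wpM2l k0 Wb.
  have h2 : k * Om ^+ 2 * tau ^+ 2 * k3 * M <= 4^-1 * M by rewrite ler_wpM2r.
  have V0 : 0 <= V (z t) := posdef_ge0 Ric.1 (z t).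
  have h3 : k * tau * g * k2 * V (z t) <= 4^-1 * V (z t) by rewrite ler_wpM2r.
  have ktg : 0 <= k * tau * g by rewrite mulr_ge0.
  have h4 : - (k2 * V (z t)) <= q t by have := F2 (z t); rewrite ler_norml => /andP[].
  have {}h4 := ler_wpM2l ktg h4.
  have e : k * (mm * tau ^+ 2) = k * Om ^+ 2 * tau ^+ 2 * k3 * M.
    by rewrite /mm; move: k => kk; ring.
  have aux (kk mt w Y M' X kV q' k2' : R) : kk * - mt <= kk * w -> kk * mt = Y ->
    Y <= 4^-1 * M' -> X * k2' * kV <= 4^-1 * kV -> X * - (k2' * kV) <= X * q' ->
    kV - kV / 4 - M' / 4 <= kV + kk * w + X * q' by lra.
  exact: aux h1 e h2 h3 h4.
Qed.

(** [L] controls [V] only up to a maximum over the delay window, so boundedness of [V] comes first,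
    by evaluating [L] where [V] is maximal since the start. Then [L] is bounded below and
    dissipation makes [|z|^2] integrable. *)
Lemma delay_state_cvg0 i : ((fun t => z t i 0) @ +oo%R --> (0 : R))%classic.
Proof.
have [L [dL [T [C5 [C50 LD Ldis zdT Llow]]]]] := delay_lyapunov.
have Vp x : 0 <= V x := posdef_ge0 Ric.1 x.
have [F [MF FP]] := fI; have [T' FE] := FP.
pose t1 := Num.max T T' + tau + 1.
have Tt1 : T < t1 - tau.
  by apply: le_lt_trans (_ : Num.max T T' < _); rewrite ?le_max ?lexx // /t1; lra.
have T't1 : T' < t1 - tau.
  by apply: le_lt_trans (_ : Num.max T T' < _); rewrite ?le_max ?lexx ?orbT // /t1; lra.
have t1t : t1 - tau <= t1 by rewrite gerBl.
have Vd s : T < s -> D (fun s => V (z s)) s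
    (dotv (A *m z s + b s) (P *m z s) + dotv (z s) (P *m (A *m z s + b s))).
  by move=> h; apply: vder_form; have [] := zdT s h.
have evtmax t : t1 - tau <= t -> exists2 s, t1 - tau <= s <= t &
    forall r, t1 - tau <= r <= t -> V (z r) <= V (z s).
  move=> le; have [||s sin sm] := @EVT_max R (fun s => V (z s)) (t1 - tau) t.
  - exact: le.
  - apply: der_within => s /andP[s1 _]; apply: Vd; exact: lt_le_trans s1.
  - by exists s; [move: sin; rewrite in_itv|move=> r h; apply: sm; rewrite in_itv].
have [s1 s1b s1m] := evtmax t1 t1t.
pose L1 := L t1 + C5 * (MF - F t1).
have Lup t : t1 <= t -> L t <= L1.
  move=> le; have : C5 * F t1 - L t1 <= C5 * F t - L t.
    apply: (@der_ge0_le _ (fun s => C5 * F s - L s) (fun s => C5 * sqn (f s) - dL s)) => //.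
      move=> s /andP[s0 _]; apply: derB.
        apply: derZ; have [] := FE s; last by [].
        by apply: lt_le_trans T't1 _; exact: le_trans s0.
      by apply: LD; apply: lt_le_trans Tt1 _; exact: le_trans s0.
    move=> s /andP[s0 _]; have := Ldis s (lt_le_trans Tt1 (le_trans t1t s0)).
    have := mulr_ge0 (ltW (divr_gt0 eps0 (ltr0n R 2))) (sqn_ge0 (z s)).
    lra.
  have : F t <= MF by have [] := FE t (lt_le_trans T't1 (le_trans t1t le)).
  move=> /(ler_wpM2l C50); rewrite /L1; lra.
(* A maximizer [s] after [t1] dominates its own window, so [V (z s) / 2 <= L s <= L1]; a maximizer
   before [t1] is covered by [s1]. *)
pose M := Num.max (V (z s1)) (2 * L1).
have Vb t : t1 - tau <= t -> V (z t) <= M.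
  move=> le; have [s sb sm] := evtmax t le.
  apply: (@le_trans _ _ (V (z s))); first by apply: sm; rewrite le lexx.
  have /andP[sb1 sb2] := sb.
  have [st|st] := leP s t1; first by rewrite le_max s1m // sb1.
  have Ts : T < s by apply: lt_le_trans Tt1 _.
  have := Llow s (V (z s)) Ts; have := Lup s (ltW st).
  move=> h1 h2.
  have : V (z s) - V (z s) / 4 - V (z s) / 4 <= L s.
    apply: h2 => r /andP[r1 r2]; apply: sm; rewrite (le_trans r2 sb2) andbT.
    by apply: le_trans r1; rewrite lerD2r ltW.
  move=> h3; rewrite le_max; apply/orP; right; lra.
have zI : intbl (fun t => sqn (z t)).
  have e2 : 0 < eps / 2 by rewrite divr_gt0.
  suff H : intbl (fun t => eps / 2 * sqn (z t)).
    have ei : 0 <= (eps / 2)^-1 by rewrite invr_ge0 ltW.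
    by apply: intbl_ext (intblZ ei H) => t; rewrite mulKf // gt_eqF.
  apply: (@dissipation_intbl R L dL _ (fun t => C5 * sqn (f t)) (M / 4)).
  - by apply: evcontM; [exact: evcont_cst|exact: vcont_sqn].
  - exact: intblZ.
  - exists t1 => t h; have Th : T < t by apply: lt_le_trans Tt1 (le_trans t1t (ltW h)).
    split; [exact: LD|exact: Ldis|].
    have := Llow t M Th; have := Vp (z t) => V0 h1.
    have : V (z t) - V (z t) / 4 - M / 4 <= L t.
      by apply: h1 => r /andP[r1 _]; apply: Vb; apply: le_trans r1; rewrite lerD2r ltW.
    lra.
apply: (L2_state_cvg0 zd zI).
pose K1 := 2 * (rho ^+ 2 * frob (B *m c)).
have K10 : 0 <= K1 by rewrite mulr_ge0 // mulr_ge0 ?sqr_ge0 ?frob_ge0.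
apply: (@intbl_le _ _ (fun t => K1 * sqn (z (t - tau)) + 2 * sqn (f t))).
- exact: vcont_sqn.
- apply: intblD; last exact: intblZ.
  exact: (intbl_shift tau (intblZ K10 zI)).
- apply: evt_all => t; rewrite sqn_ge0 /=.
  apply: le_trans (sqnD_le _ _) _; rewrite lerD2r /K1 sqnZ sqrrN.
  have -> x y : 2 * (rho ^+ 2 * x) * y = 2 * (rho ^+ 2 * (x * y)) :> R by ring.
  by rewrite ler_wpM2l // ler_wpM2l ?sqr_ge0 // mulmxA sqn_mul_le.
Qed.

End DelayLyapunov.

(** * Forced Bernstein inequality and uniform choice of constants *)

(** Two slacks absorb the input: the gap between [Om0] and [Om] pays for the Young factor [1 + eta],
    and the term in [th] pays for the cross terms of [Q] after rescaling the state by [s] and the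
    input by [s^-1]. *)
Lemma bernstein_input (R : realType) n m (A Q : 'M[R]_n.+1) (c : 'M[R]_(m, n.+1))
    (Om0 Om eta th k s : R) :
  0 < eta -> (1 + eta) * Om0 ^+ 2 = Om ^+ 2 -> 0 <= k -> 0 < s -> 2 * k * s ^+ 2 <= th ->
  (forall z, dotv (A *m z) (Q *m z) + dotv z (Q *m (A *m z)) <=
     Om0 ^+ 2 * sqn (c *m z) - sqn (c *m (A *m z)) - th * krylov A c z) ->
  (forall z y, `|dotv z (Q *m y)| <= k * (krylov A c z + krylov A c y)) ->
  forall x b, sqn (c *m (A *m x + b)) - Om ^+ 2 * sqn (c *m x) <=
    - (1 + eta) * (dotv (A *m x + b) (Q *m x) + dotv x (Q *m (A *m x + b)))
    + ((1 + eta) * (2 * k * s ^- 2) + (1 + eta^-1)) * krylov A c b.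
Proof.
move=> eta0 OmE k0 s0 sth QA Qb x b.
have sn : s != 0 by rewrite gt_eqF.
have cross1 : dotv x (Q *m b) <= k * (s ^+ 2 * krylov A c x + s ^- 2 * krylov A c b).
  have -> : dotv x (Q *m b) = dotv (s *: x) (Q *m (s^-1 *: b)).
    by rewrite -scalemxAr dotvZl dotvZr mulrA mulfV // mul1r.
  apply: le_trans (ler_norm _) _; apply: le_trans (Qb _ _) _.
  by rewrite !krylovZ exprVn.
have cross2 : dotv b (Q *m x) <= k * (s ^+ 2 * krylov A c x + s ^- 2 * krylov A c b).
  have -> : dotv b (Q *m x) = dotv (s^-1 *: b) (Q *m (s *: x)).
    by rewrite -scalemxAr dotvZl dotvZr mulrA mulVf // mul1r.
  apply: le_trans (ler_norm _) _; apply: le_trans (Qb _ _) _.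
  by rewrite !krylovZ exprVn addrC.
have XE : dotv (A *m x + b) (Q *m x) + dotv x (Q *m (A *m x + b)) =
    (dotv (A *m x) (Q *m x) + dotv x (Q *m (A *m x))) + (dotv b (Q *m x) + dotv x (Q *m b)).
  by rewrite dotvDl mulmxDr dotvDr addrACA.
have h1 := QA x.
have h2 := sqnD_young (c *m (A *m x)) (c *m b) eta0.
have h3 := sqn_le_krylov A c b.
have h4 := ler_wpM2r (krylov_ge0 A c x) sth.
have ei : 0 < 1 + eta^-1 by rewrite addr_gt0 // invr_gt0.
have h5 := ler_wpM2l (ltW ei) h3.
rewrite -OmE mulmxDr; rewrite XE.
have e1 : 0 <= 1 + eta by lra.
have h6 : sqn (c *m (A *m x)) <= Om0 ^+ 2 * sqn (c *m x)
   - (dotv (A *m x) (Q *m x) + dotv x (Q *m (A *m x)) + (dotv b (Q *m x) + dotv x (Q *m b)))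
   + 2 * k * s ^- 2 * krylov A c b.
  move: cross1 cross2 h1 h4; move: (s ^- 2) => si; lra.
have h7 := ler_wpM2l e1 h6.
move: h2 h5 h7; move: (s ^- 2) (eta^-1) => si ei'; lra.
Qed.

(** The order of choices gives uniformity: the frequencies, the Bernstein constants and [rho] come
    first, then the smallness level [d] in terms of them, and last the threshold [es] attaining
    [d]. *)
Lemma delay_stability (R : realType) n m (A : 'M[R]_n.+1) (B : 'M[R]_(n.+1, m)) (taubar : R) :
  stabilizable A B -> eig_closed_lhp A -> 0 <= taubar -> taubar * omega_max A < pi / 2 ->
  exists rho es, [/\ 1 < rho, 0 < es & forall eps P, 0 < eps -> eps <= es ->
    riccati A B eps P -> forall tau, 0 <= tau <= taubar ->
    forall z f : R -> 'cV[R]_n.+1,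
      evt (fun t => vder z t (A *m z t + (- rho *: (B *m (B^T *m P *m z (t - tau))) + f t))) ->
      vcont f -> intbl (fun t => sqn (f t)) ->
      forall i, ((fun t => z t i 0) @ +oo%R --> (0 : R))%classic].
Proof.
move=> st Acl tb0 tbw.
have [w0 _] := omega_max_spec Acl; set w := omega_max A in tbw w0.
(* Dividing by [1 + taubar] covers [taubar = 0] and makes [h * taubar] strictly less than the gap,
   so [Om * taubar < pi / 2] persists. *)
pose h := (pi / 2 - taubar * w) / (1 + taubar).
have gap : 0 < pi / 2 - taubar * w by rewrite subr_gt0.
have tb1 : 0 < 1 + taubar by lra.
have h0 : 0 < h by rewrite divr_gt0.
have hE : h * (1 + taubar) = pi / 2 - taubar * w by rewrite divfK // gt_eqF.
pose Om := w + h; pose Om0 := w + h / 2.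
have Om00 : 0 < Om0 by rewrite /Om0; lra.
have Omp : 0 < Om by rewrite /Om; lra.
have wOm0 : w < Om0 by rewrite /Om0; lra.
have Omtb : Om * taubar < pi / 2 by rewrite /Om mulrDl; lra.
have Omtb0 : 0 <= Om * taubar by rewrite mulr_ge0 // ltW.
pose eta := (Om ^+ 2 - Om0 ^+ 2) / Om0 ^+ 2.
have Om02 : 0 < Om0 ^+ 2 by rewrite exprn_gt0.
have eta0 : 0 < eta by rewrite divr_gt0 // subr_gt0 ltrXn2r // ?(ltW Om00) // /Om /Om0; lra.
have etaE : (1 + eta) * Om0 ^+ 2 = Om ^+ 2 by rewrite /eta; field; rewrite gt_eqF.
clearbody eta.
have [th [kq [th0 kq0 QH]]] := bernstein_form Acl wOm0.
(* Since [s <= 1], [s ^+ 2 <= s], and the second bound then gives [2 * kq * s ^+ 2 <= th]. *)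
pose s := Num.min 1 (th / (2 * kq + 1)).
have kq1 : 0 < 2 * kq + 1 by lra.
have s0 : 0 < s by rewrite lt_min ltr01 divr_gt0.
have s1 : s <= 1 by rewrite ge_min lexx.
have sth : 2 * kq * s ^+ 2 <= th.
  have : s * (2 * kq + 1) <= th by rewrite -ler_pdivlMr // ge_min lexx orbT.
  have : s ^+ 2 <= s by rewrite expr2 ler_piMr // ltW.
  move=> /(ler_wpM2l (mulr_ge0 (ler0n R 2) kq0)); lra.
pose C4 := (1 + eta) * (2 * kq * s ^- 2) + (1 + eta^-1).
have C40 : 0 <= C4.
  rewrite addr_ge0 //; last by rewrite addr_ge0 // invr_ge0 ltW.
  by rewrite mulr_ge0 ?mulr_ge0 ?invr_ge0 ?sqr_ge0 //; lra.
pose rho := 2 / cos (Om * taubar).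
have pi0 := pi_gt0 R.
have cb0 : 0 < cos (Om * taubar) by apply: cos_gt0_pihalf; apply/andP; split; lra.
have rho2 : 2 <= rho by rewrite ler_pdivlMr // ler_piMr // cos_le1.
have rhoE : rho * cos (Om * taubar) = 2 by rewrite divfK // gt_eqF.
clearbody rho.
have rho0 : 0 < rho by lra.
pose ro := rho / Om.
have ro0 : 0 <= ro by rewrite divr_ge0 // ltW.
pose X1 := ro * taubar * (1 + eta) * (2 * kq).
pose X2 := ro * Om ^+ 2 * taubar ^+ 2.
pose X3 := ro * taubar * C4 * (2 * rho ^+ 2).
have e1 : 0 <= 1 + eta by lra.
have rt0 : 0 <= ro * taubar by rewrite mulr_ge0.
have X10 : 0 <= X1 by apply: mulr_ge0; exact: mulr_ge0.
have X20 : 0 <= X2 by apply: mulr_ge0; rewrite ?sqr_ge0 //; apply: mulr_ge0; rewrite ?sqr_ge0.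
have r2 : 0 <= 2 * rho ^+ 2 by rewrite mulr_ge0 // sqr_ge0.
have X30 : 0 <= X3 by apply: mulr_ge0 => //; exact: mulr_ge0.
(* [X1], [X2], [X3] bound the coefficients in the three budget conditions uniformly in [tau]; with
   this [d] each product is at most a quarter. *)
pose d := (4 * (1 + X1 + X2 + X3))^-1.
have Xp : 0 < 4 * (1 + X1 + X2 + X3) by lra.
have d0 : 0 < d by rewrite invr_gt0.
have dE : d * (1 + X1 + X2 + X3) = 4^-1 by rewrite /d; field; rewrite gt_eqF //; lra.
clearbody d.
have dX1 := mulr_ge0 (ltW d0) X10; have dX2 := mulr_ge0 (ltW d0) X20.
have dX3 := mulr_ge0 (ltW d0) X30.
have [es es0 small] := riccati_krylov_small st Acl d0.
exists rho, es; split=> //; first lra.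
move=> eps P eps0 epses Ric tau /andP[tau0 taub] z f zd fc fI i.
have [sz su] := small eps P eps0 epses Ric.
have [Q QA Qb] := QH m (B^T *m P).
have [k5 k50 F5] := krylov_le A (B^T *m P).
have al0 : 0 <= Om * tau by rewrite mulr_ge0 // ltW.
have alb : Om * tau <= Om * taubar by rewrite ler_pM2l.
have sin1 := sin_le1 (Om * tau).
have sin0 : 0 <= sin (Om * tau) by apply: sin_ge0_pi; apply/andP; split => //; lra.
have kr : rho * sin (Om * tau) / Om <= ro.
  by rewrite /ro ler_pM2r ?invr_gt0 // ler_piMr // ltW.
have kp : 0 <= rho * sin (Om * tau) / Om by apply: divr_ge0; [apply: mulr_ge0 => //; exact: ltW|exact: ltW].
have kt : rho * sin (Om * tau) / Om * tau <= ro * taubar by apply: ler_pM.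
have ktp : 0 <= rho * sin (Om * tau) / Om * tau by rewrite mulr_ge0.
apply: (@delay_state_cvg0 R n m A B P Q eps rho Om tau (1 + eta) C4 (2 * kq * d) d d k5) => //.
- lra.
- have : cos (Om * taubar) <= cos (Om * tau).
    rewrite leNgt ltr_cos ?in_itv /= -?leNgt //; apply/andP; split => //; lra.
  move=> /(ler_wpM2l (ltW rho0)); by rewrite rhoE.
- exact: ltW.
- exact: (bernstein_input eta0 etaE kq0 s0 sth QA Qb).
- move=> x; apply: le_trans (Qb x x) _.
  have := ler_wpM2l kq0 (sz x); lra.
- by move=> x; apply: le_trans (sqn_le_krylov A _ x) (sz x).
- have : rho * sin (Om * tau) / Om * tau * (1 + eta) * (2 * kq) <= X1.
    by apply: ler_wpM2r; [exact: mulr_ge0|apply: ler_wpM2r].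
  move=> /(ler_wpM2r (ltW d0)); lra.
- have : rho * sin (Om * tau) / Om * Om ^+ 2 * tau ^+ 2 <= X2.
    apply: ler_pM; rewrite ?sqr_ge0 //; first by rewrite mulr_ge0 // sqr_ge0.
      by rewrite ler_wpM2r // sqr_ge0.
    by rewrite lerXn2r ?nnegrE.
  move=> /(ler_wpM2r (ltW d0)); lra.
- have : rho * sin (Om * tau) / Om * tau * C4 * (2 * rho ^+ 2) <= X3.
    by apply: ler_wpM2r => //; apply: ler_wpM2r.
  move=> /(ler_wpM2r (ltW d0)); lra.
- exact: zd.
Qed.

(** * The network *)

Section RealToComplex.
Variable R : realType.
Notation D f t d := (is_derive (t : R) (1 : R) (f : R -> R) (d : R)).

Lemma mder_cmx n p (X : R -> 'M[R]_(n, p)) t (d : 'M[R]_(n, p)) :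
  (forall i j, D (fun s => X s i j) t (d i j)) -> mder (fun s => cmx (X s)) t (cmx d).
Proof.
move=> H i j; split.
  by under eq_fun do rewrite mxE /=; rewrite mxE.
by under eq_fun do rewrite mxE /=; rewrite mxE /=; exact: der_cst.
Qed.

Lemma mL2_cmx n p (X : R -> 'M[R]_(n, p)) : mL2 (fun s => cmx (X s)) ->
  forall i j, evcont (fun t => X t i j) /\ intbl (fun t => X t i j ^+ 2).
Proof.
move=> H i j; have [cr _ ci] := H i j; split.
  by move: cr; under eq_fun do rewrite mxE.
by apply: intbl_ext ci => t; rewrite mxE /csq /= expr0n addr0.
Qed.

Lemma cmx_mL2 n p (X : R -> 'M[R]_(n, p)) :
  (forall i j, evcont (fun t => X t i j) /\ intbl (fun t => X t i j ^+ 2)) ->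
  mL2 (fun s => cmx (X s)).
Proof.
move=> H i j; have [cr ci] := H i j; split.
- by under eq_fun do rewrite mxE.
- by under eq_fun do rewrite mxE /=; exact: evcont_cst.
- by apply: intbl_ext ci => t; rewrite mxE /csq /= expr0n addr0.
Qed.

Lemma cmxM n p q (X : 'M[R]_(n, p)) (Y : 'M[R]_(p, q)) : cmx (X *m Y) = cmx X *m cmx Y.
Proof. exact: map_mxM. Qed.

Lemma cmxD n p (X Y : 'M[R]_(n, p)) : cmx (X + Y) = cmx X + cmx Y.
Proof. exact: map_mxD. Qed.

Lemma hurwitz_L2 n (M : 'M[R]_n) (z : R -> 'cV[R]_n) : hurwitz M ->
  evt (fun t => vder z t (M *m z t)) ->
  forall k, evcont (fun t => z t k 0) /\ intbl (fun t => z t k 0 ^+ 2).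
Proof.
move=> Mh zd k; apply: mL2_cmx.
apply: (@hurwitz_mL2 _ _ _ (cmx M) _ (fun=> 0)).
- by move=> l /eigenvalue_of_root /Mh.
- apply: evt_mono zd => t zt; rewrite addr0 -cmxM.
  by apply: mder_cmx => i j; rewrite ord1.
- by move=> i j; under eq_fun do rewrite mxE; exact: L20.
Qed.

Lemma eigenvalue_of_tr n (A : 'M[R]_n) l : eigenvalue_of A^T l -> eigenvalue_of A l.
Proof.
rewrite /eigenvalue_of cmxE -map_trmx -cmxE => h.
by rewrite -det_tr linearB /= tr_scalar_mx.
Qed.

Lemma eigenvalue_of_opp n (A : 'M[R]_n) l : eigenvalue_of (- A) l -> eigenvalue_of A (- l).
Proof.
rewrite /eigenvalue_of cmxE map_mxN -cmxE opprK => h.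
have -> : (- l)%:M - cmx A = -1 *: (l%:M + cmx A) by rewrite scaleN1r opprD raddfN.
by rewrite detZ h mulr0.
Qed.

Lemma grounded_laplacian_mul N n (Cs : {set 'I_N}) (a : 'M[R]_N) (X : 'M[R]_(N, n)) i l :
  (grounded_laplacian Cs a *m X) i l =
  \sum_j a i j * (X i l - X j l) + (if i \in Cs then 1 else 0) * X i l.
Proof.
rewrite mxE; set io := if _ then _ else _; set s := \sum_k a i k.
under eq_bigr do rewrite mxE -/io -/s mulrBl.
under [in RHS]eq_bigr do rewrite mulrBr.
rewrite !sumrB -mulr_suml -/s addrAC -mulrDl; congr (_ - _).
rewrite (bigD1 i) //= eqxx mulr1n big1 ?addr0 // => j ji.
by rewrite eq_sym (negPf ji) mulr0n mul0r.
Qed.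

(** With agents as rows the network is a Sylvester system; the strict positivity of the grounded
    Laplacian spectrum compensates eigenvalues of [A] on the imaginary axis. *)
Lemma network_L2 N n (Cs : {set 'I_N}) (a : 'M[R]_N) (A : 'M[R]_n)
    (X W : R -> 'M[R]_(N, n)) :
  in_graph_set Cs a -> eig_closed_lhp A ->
  evt (fun t => forall i j, D (fun s => X s i j) t
    ((- grounded_laplacian Cs a *m X t + X t *m A^T + W t) i j)) ->
  (forall i j, evcont (fun t => W t i j) /\ intbl (fun t => W t i j ^+ 2)) ->
  forall i j, evcont (fun t => X t i j) /\ intbl (fun t => X t i j ^+ 2).
Proof.
move=> G Acl Xd WL; apply: mL2_cmx.
apply: (@sylvester_mL2 _ _ _ (cmx (- grounded_laplacian Cs a)) (cmx A^T) _ (fun t => cmx (W t))).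
- move=> l k /eigenvalue_of_root/eigenvalue_of_opp/eigenvalue_of_root.
  move=> /(grounded_laplacian_eigenvalue G); rewrite ReN oppr_gt0 => l0.
  move=> /eigenvalue_of_root/eigenvalue_of_tr/Acl k0.
  by rewrite ReD; lra.
- apply: evt_mono Xd => t Xt; rewrite -!cmxM -!cmxD; exact: mder_cmx.
- exact: cmx_mL2.
Qed.

Lemma vderD n (x y : R -> 'cV[R]_n) t d e : vder x t d -> vder y t e ->
  vder (fun s => x s + y s) t (d + e).
Proof.
by move=> xd ye k; under eq_fun do rewrite mxE; rewrite mxE; exact: derD.
Qed.

Lemma vderZ n (x : R -> 'cV[R]_n) t k d : vder x t d -> vder (fun s => k *: x s) t (k *: d).
Proof.
by move=> xd i; under eq_fun do rewrite mxE; rewrite mxE; exact: derZ.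
Qed.

Lemma vderB n (x y : R -> 'cV[R]_n) t d e : vder x t d -> vder y t e ->
  vder (fun s => x s - y s) t (d - e).
Proof.
move=> xd ye k; under eq_fun do rewrite !mxE; rewrite !mxE; exact: derB.
Qed.

Lemma vder_sum n p (x : 'I_p -> R -> 'cV[R]_n) t (d : 'I_p -> 'cV[R]_n) :
  (forall j, vder (x j) t (d j)) ->
  vder (fun s => \sum_j x j s) t (\sum_j d j).
Proof.
move=> xd k; under eq_fun do rewrite summxE; rewrite summxE.
by apply: der_sum => j; exact: xd.
Qed.

Lemma vder_eq n (x : R -> 'cV[R]_n) t d e : vder x t d -> d = e -> vder x t e.
Proof. by move=> ? <-. Qed.

Lemma deriv_pos_vder n (x dx : R -> 'cV[R]_n) : deriv_pos x dx ->
  forall t, 0 < t -> vder x t (dx t).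
Proof. by move=> H t t0 k; exact: H. Qed.

End RealToComplex.

Theorem theorem2 (R : realType) (n m q : nat)
  (A : 'M[R]_n) (B : 'M[R]_(n, m)) (C : 'M[R]_(q, n)) (taubar : R) :
  stabilizable A B -> detectable C A -> eig_closed_lhp A ->
  0 <= taubar -> taubar * omega_max A < pi / 2 ->
  exists (rho eps_star : R), 1 < rho /\ 0 < eps_star /\
  forall (K : 'M[R]_(n, q)), hurwitz (A - K *m C) ->
  forall eps : R, 0 < eps -> eps <= eps_star ->
  forall P : 'M[R]_n, posdef P ->
    A^T *m P + P *m A - P *m B *m B^T *m P + eps%:M = 0 ->
  forall (N : nat) (Cs : {set 'I_N}) (a : 'M[R]_N) (tau : 'I_N -> R),
    (0 < N)%N -> Cs != finset.set0 -> in_graph_set Cs a ->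
    (forall i, 0 <= tau i <= taubar) ->
  forall (x xhat chi : 'I_N -> R -> 'cV[R]_n) (xr : R -> 'cV[R]_n),
    let iota (i : 'I_N) : R := if i \in Cs then 1 else 0 in
    let u (i : 'I_N) (s : R) : 'cV[R]_m := - rho *: (B^T *m P *m chi i s) in
    let ud (i : 'I_N) (t : R) : 'cV[R]_m := u i (t - tau i) in
    let zbar (i : 'I_N) (t : R) : 'cV[R]_q :=
      \sum_j a i j *: (C *m x i t - C *m x j t)
      + iota i *: (C *m x i t - C *m xr t) in
    let zcheck (i : 'I_N) (t : R) : 'cV[R]_n :=
      \sum_j a i j *: (chi i t - chi j t) in
    let Phi (i : 'I_N) (t : R) : 'cV[R]_m :=
      \sum_j a i j *: (ud i t - ud j t) in
    (* initial functions on [-taubar, 0] arbitrary continuous; solutions continuous *)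
    (forall i, cont_from (- taubar) (x i)) ->
    (forall i, cont_from (- taubar) (chi i)) ->
    (forall i, cont_from 0 (xhat i)) ->
    cont_from 0 xr ->
    (* dynamics for t > 0 *)
    (forall i, deriv_pos (x i) (fun t => A *m x i t + B *m ud i t)) ->
    deriv_pos xr (fun t => A *m xr t) ->
    (forall i, deriv_pos (xhat i) (fun t =>
        A *m xhat i t + B *m Phi i t + K *m (zbar i t - C *m xhat i t)
        + iota i *: (B *m ud i t))) ->
    (forall i, deriv_pos (chi i) (fun t =>
        A *m chi i t + B *m ud i t + xhat i t - zcheck i t - iota i *: chi i t)) ->
    forall i, tends_to_zero (fun t => x i t - xr t).
Proof.
(* In dimension 0 there are no coordinates to converge, so any admissible constants do. *)
case: n A B C => [|n] A B C st _ Acl tb0 tbw.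
  exists 2, 1; split; first by rewrite ltr1n.
  by split=> [|K _ eps _ _ P _ _ N Cs a tau _ _ _ _ x xhat chi xr iota u ud zbar
    zcheck Phi _ _ _ _ _ _ _ _ i []].
have [rho [es [rho1 es0 stab]]] := delay_stability st Acl tb0 tbw.
exists rho, es; split=> //; split=> // K KC eps eps0 epses P Ppd PE N Cs a tau _ _ G taub.
move=> x xhat chi xr iota u ud zbar zcheck Phi _ _ _ _ dx dxr dxhat dchi.
have Ric : riccati A B eps P by [].
have udE i t : ud i t = - rho *: (B^T *m P *m chi i (t - tau i)) by [].
clearbody ud.
have lin (y1 y2 : 'cV[R]_n.+1) (y3 y4 : 'cV[R]_m) (k : R) :
    k *: (A *m y1 + B *m y3 - (A *m y2 + B *m y4)) = A *m (k *: (y1 - y2)) + B *m (k *: (y3 - y4)).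
  by rewrite -!scalemxAr -scalerDr !mulmxBr opprD addrACA.
pose e i t := x i t - xr t.
(* The quantity estimated by [xhat]: the grounded Laplacian applied to the errors, whose output
   [C *m S i t] is [zbar i t]. *)
pose S i t := \sum_j a i j *: (e i t - e j t) + iota i *: e i t.
pose w i t := S i t - xhat i t.
pose d i t := e i t - chi i t.
have de i t : 0 < t -> vder (e i) t (A *m e i t + B *m ud i t).
  move=> t0; apply: vder_eq (vderB (deriv_pos_vder (dx i) t0) (deriv_pos_vder dxr t0)) _.
  by rewrite mulmxBr addrAC.
(* The terms [Phi] and [iota B u] of the observer reproduce the input of [S], delays included, so
   they cancel and the observer error is autonomous. *)
have dw i t : 0 < t -> vder (w i) t ((A - K *m C) *m w i t).
  move=> t0.
  have dS : vder (S i) t (A *m S i t + B *m Phi i t + iota i *: (B *m ud i t)).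
    apply: vder_eq (vderD (vder_sum (fun j => vderZ (a i j) (vderB (de i t t0) (de j t t0))))
      (vderZ (iota i) (de i t t0))) _.
    have s1 : \sum_j a i j *: (A *m e i t + B *m ud i t - (A *m e j t + B *m ud j t)) =
        A *m (\sum_j a i j *: (e i t - e j t)) + B *m Phi i t.
      rewrite /Phi !mulmx_sumr -big_split /=; apply: eq_bigr => j _; exact: lin.
    have s2 : A *m S i t = A *m (\sum_j a i j *: (e i t - e j t)) + iota i *: (A *m e i t).
      by rewrite /S [LHS]mulmxDr -scalemxAr.
    by rewrite s1 s2 [iota i *: (_ + _)]scalerDr addrACA addrA.
  have zE : zbar i t = C *m S i t.
    rewrite /zbar /S [RHS]mulmxDr mulmx_sumr -scalemxAr -(mulmxBr C); congr (_ + _).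
    apply: eq_bigr => j _; rewrite -scalemxAr -(mulmxBr C); congr (_ *: (_ *m _)).
    by rewrite /e opprB addrA subrK.
  apply: vder_eq (vderB dS (deriv_pos_vder (dxhat i) t0)) _; rewrite zE.
  have wE : A *m w i t = A *m S i t - A *m xhat i t by exact: mulmxBr.
  rewrite -(mulmxBr C) -/(w i t) mulmxBl -mulmxA wE.
  move: (K *m _) (A *m S i t) (A *m xhat i t) (B *m Phi i t) (iota i *: _) => y1 y2 y3 y4 y5.
  by apply/matrixP => r c; rewrite !mxE; ring.
have wL i k : evcont (fun t => w i t k 0) /\ intbl (fun t => w i t k 0 ^+ 2).
  by apply: (hurwitz_L2 KC); exists 0 => t; exact: dw.
pose X t : 'M[R]_(N, n.+1) := \matrix_(i, k) d i t k 0.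
pose W t : 'M[R]_(N, n.+1) := \matrix_(i, k) w i t k 0.
have XL i k : evcont (fun t => X t i k) /\ intbl (fun t => X t i k ^+ 2).
  apply: (network_L2 G Acl (W := W)); last first.
    by move=> j l; under eq_fun do rewrite mxE; under [X in _ /\ intbl X]eq_fun do rewrite mxE.
  exists 0 => t t0 j l; under eq_fun do rewrite mxE.
  have dd := vderB (de j t t0) (deriv_pos_vder (dchi j) t0).
  apply: der_eq (dd l) _.
  have xE : xhat j t = S j t - w j t by rewrite /w opprB addrC subrK.
  (* The delayed input cancels, and substituting [S - w] for [xhat] turns [S - zcheck - iota chi]
     into the grounded Laplacian of [d]. *)
  have -> : A *m e j t + B *m ud j t - (A *m chi j t + B *m ud j t + xhat j t
      - zcheck j t - iota j *: chi j t) =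
      A *m d j t - (\sum_k a j k *: (d j t - d k t) + iota j *: d j t) + w j t.
    have sE : \sum_k a j k *: (d j t - d k t) =
       \sum_k a j k *: (e j t - e k t) - zcheck j t.
      rewrite /zcheck -sumrB; apply: eq_bigr => k' _; rewrite -scalerBr; congr (_ *: _).
      by rewrite /d; apply/matrixP => r c; rewrite !mxE; ring.
    have dE : A *m d j t = A *m e j t - A *m chi j t by exact: mulmxBr.
    rewrite xE sE dE /S /d.
    move: (\sum_k a j k *: (e j t - e k t)) (A *m e j t) (A *m chi j t) (B *m _).
    move: (zcheck j t) (w j t) (e j t) (chi j t).
    by move=> y1 y2 y3 y4 y5 y6 y7 y8; apply/matrixP => r c; rewrite !mxE; ring.
  have dE : (A *m d j t) l 0 = (X t *m A^T) j l.
    by rewrite !mxE; apply: eq_bigr => r _; rewrite !mxE mulrC.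
  have SE : (\sum_k a j k *: (d j t - d k t) + iota j *: d j t) l 0 =
      (grounded_laplacian Cs a *m X t) j l.
    have entry (y : 'I_N -> 'cV[R]_n.+1) (r : R) :
        (\sum_k a j k *: (y j - y k) + r *: y j) l 0 =
        \sum_k a j k * (y j l 0 - y k l 0) + r * y j l 0.
      by rewrite mxE summxE !mxE; congr (_ + _); apply: eq_bigr => k' _; rewrite !mxE.
    have XE k' : X t k' l = d k' t l 0 by rewrite mxE.
    rewrite grounded_laplacian_mul (entry (fun k => d k t)) XE; congr (_ + _).
    by apply: eq_bigr => k' _; rewrite XE.
  have WE : W t j l = w j t l 0 by rewrite mxE.
  have addE (y1 y2 y3 : 'cV[R]_n.+1) : (y1 - y2 + y3) l 0 = y1 l 0 - y2 l 0 + y3 l 0.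
    by rewrite !mxE.
  have addE' (y1 y2 y3 : 'M[R]_(N, n.+1)) : (- y1 + y2 + y3) j l = y2 j l - y1 j l + y3 j l.
    by rewrite !mxE [- _ + _]addrC.
  by rewrite addE mulNmx addE' dE SE WE.
have dc i : vcont (d i).
  by move=> k; have [h _] := XL i k; move: h; under eq_fun do rewrite mxE.
have dI i : intbl (fun t => sqn (d i t)).
  apply: (@intbl_ext _ (fun t => \sum_k X t i k ^+ 2)).
    by move=> t; rewrite sqnE; apply: eq_bigr => k _; rewrite mxE.
  by apply: intbl_sum => k; have [] := XL i k.
(* What remains when [chi] is replaced by [e - d] in the delayed feedback; each agent then forms its
   own loop with its own delay. *)
pose f i t := rho *: (B *m (B^T *m P *m d i (t - tau i))).
have fc i : vcont (f i).
  move=> k; under eq_fun do rewrite mxE.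
  apply: evcontM; first exact: evcont_cst.
  exact: (vcont_mulmx B (vcont_mulmx (B^T *m P) (vcont_shift (tau i) (dc i)))).
move=> i.
apply: (stab eps P eps0 epses Ric (tau i) (taub i) (e i) (f i)) => //.
- exists 0 => t t0; apply: vder_eq (de i t t0) _; congr (_ + _).
  rewrite udE /f /d -scalemxAr !mulmxBr scalerBr !scaleNr.
  move: (B *m _) (B *m _) (B *m _) => y1 y2 y3.
  by apply/matrixP => r c; rewrite !mxE; ring.
- pose k := rho ^+ 2 * frob (B *m (B^T *m P)).
  have k0 : 0 <= k by rewrite mulr_ge0 ?sqr_ge0 ?frob_ge0.
  apply: (intbl_le (vcont_sqn (fc i)) (intbl_shift (tau i) (intblZ k0 (dI i)))).
  apply: evt_all => t; rewrite sqn_ge0 /= /f sqnZ mulmxA /k -mulrA.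
  by apply: ler_wpM2l; [exact: sqr_ge0 | exact: sqn_mul_le].
Qed.
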